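(* Let $E$ be a finite set, let $X=(X_t)_{t\in\mathbb{Z}}$ be a process with values in $\mathbb{R}^d$, and let $\mathcal{D}\in\mathcal{B}(\mathbb{R}^d)^{\otimes\mathbb{Z}}$ with $\mathbb{P}(X\in\mathcal{D})=1$. Let $q$ be such that, for every $t\in\mathbb{Z}$, the map $(w,y,x)\mapsto q(w\vert y,x_t^-)$ is measurable from $E\times E^{\mathbb{N}}\times\mathcal{D}$ to $(0,1)$ and $\sum_{w\in E}q(w\vert y,x_t^-)=1$ for all $(y,x)\in E^{\mathbb{N}}\times\mathcal{D}$. Assume: (S1) the covariate process $X$ is stationary and ergodic; (S2) setting, for $m\ge0$, $$b_m=\sup\left\{d_{TV}\left(q(\cdot\vert y,x_t^-),q(\cdot\vert y',x_t^-)\right):(y,y',x)\in E^{\mathbb{N}}\times E^{\mathbb{N}}\times\mathcal{D},\ t\in\mathbb{Z},\ y\stackrel{m}{=}y'\right\},$$ one has $b_0<1$ and $\sum_{m\ge0}b_m<\infty$. Then: 1. There exists a unique stochastic process $(Y_t)_{t\in\mathbb{Z}}$ with values in $E$ satisfying $$\mathbb{P}\left(Y_t=w\vert Y_{t-1}^-,X\right)=q\left(w\vert Y_{t-1}^-,X_t^-\right),\qquad t\in\mathbb{Z},\ w\in E.$$ Moreover, for any bounded measurable function $h:E^{\mathbb{N}}\to\mathbb{R}$ and $t\in\mathbb{Z}$, $$\mathbb{E}\left[h(Y_t^-)\vert X\right]=\mathbb{E}\left[h(Y_t^-)\vert X_t^-\right].$$ 2. The bivariate process $((Y_t,X_t))_{t\in\mathbb{Z}}$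 is stationary and ergodic.
   Context: $\mathbb{N}=\{0,1,\ldots\}$. For a sequence $(x_t)_{t\in\mathbb{Z}}$, $x_t^-=(x_{t-j})_{j\ge0}=(x_t,x_{t-1},\ldots)$. For $y,y'\in E^{\mathbb{N}}$, $y\stackrel{m}{=}y'$ means $y_i=y'_i$ for $0\le i\le m-1$ (no constraint if $m=0$). For probability measures on $E$, $d_{TV}(\nu_1,\nu_2)=\frac12\sum_{e\in E}|\nu_1(e)-\nu_2(e)|$. Existence is understood on a possibly enlarged probability space carrying a process with the same distribution as $X$ (still denoted $X$). Uniqueness is uniqueness in law: if $(Y,X)$ and $(Y',X')$, possibly defined on different probability spaces, both satisfy the displayed conditional probability equation and $X'$ has the same distribution as $X$, then $(Y',X')$ and $(Y,X)$ have the same distribution on $E^{\mathbb{Z}}\times(\mathbb{R}^d)^{\mathbb{Z}}$. *)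

(* Defs.v *)
From HB Require Import structures.
From mathcomp Require Import all_boot all_order all_algebra.
From mathcomp Require Import all_classical all_reals all_analysis.

Set Implicit Arguments.
Unset Strict Implicit.
Unset Printing Implicit Defensive.
Import Order.TTheory GRing.Theory Num.Theory.

Local Open Scope classical_set_scope.
Local Open Scope ring_scope.

Definition product_display : measure_display -> measure_display.
Proof. exact. Qed.

(* The product sigma-algebra on I -> T for an arbitrary index type I, generated
   by the coordinate maps. *)
Section product_sigma_algebra.
Context {d} (I : Type) (T : measurableType d).

Definition cylinders : set (set (I -> T)) :=
  \bigcup_(i in [set: I])
    preimage_set_system setT (fun x : I -> T => x i) measurable.

Let product_set0 : <<s cylinders >> set0.
Proof. exact: sigma_algebra0. Qed.

Let product_setC A : <<s cylinders >> A -> <<s cylinders >> (~` A).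
Proof. exact: sigma_algebraC. Qed.

Let product_bigcup (F : (set (I -> T))^nat) :
  (forall i, <<s cylinders >> (F i)) -> <<s cylinders >> (\bigcup_i (F i)).
Proof. exact: sigma_algebra_bigcup. Qed.

HB.instance Definition _ := @isMeasurable.Build (product_display d)
  (I -> T) <<s cylinders >> product_set0 product_setC product_bigcup.

End product_sigma_algebra.

(* Measurable spaces are pointed, so these types are nonempty.  The
   sigma-algebra is not required here to be the discrete one. *)
#[short(type=finMeasurableType)]
HB.structure Definition FinMeasurable d := {T of Finite T & Measurable d T}.

Section trajectories.
Context {T : Type}.

Definition past (x : int -> T) (t : int) : nat -> T := fun j => x (t - j%:Z).

Definition shift (k : int) (x : int -> T) : int -> T := fun t => x (t + k).

Definition agree (m : nat) (y y' : nat -> T) : Prop :=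
  forall i : nat, (i < m)%N -> y i = y' i.

Definition trajectory {O : Type} (Z : int -> O -> T) : O -> (int -> T) :=
  fun o t => Z t o.

End trajectories.

Section probabilistic_notions.
Context {R : realType}.

Definition same_law d1 (O1 : measurableType d1) (P1 : probability O1 R)
    d2 (O2 : measurableType d2) (P2 : probability O2 R)
    d (S : measurableType d) (V1 : O1 -> S) (V2 : O2 -> S) : Prop :=
  forall A : set S, measurable A -> P1 (V1 @^-1` A) = P2 (V2 @^-1` A).

Definition stationary dO (O : measurableType dO) (P : probability O R)
    d (T : measurableType d) (Z : int -> O -> T) : Prop :=
  forall k : int, same_law P P (trajectory Z) (shift k \o trajectory Z).

Definition ergodic dO (O : measurableType dO) (P : probability O R)
    d (T : measurableType d) (Z : int -> O -> T) : Prop :=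
  forall A : set (int -> T), measurable A -> shift 1 @^-1` A = A ->
    P (trajectory Z @^-1` A) = 0%E \/ P (trajectory Z @^-1` A) = 1%E.

(* g is a version of E[f | V], the conditional expectation of f given the
   sigma-algebra generated by V.  A version is only required to coincide almost
   surely with a sigma(V)-measurable function, so that g may be given by a
   formula that is meaningful only almost surely. *)
Definition is_cond_exp dO (O : measurableType dO) (P : probability O R)
    d (S : measurableType d) (V : O -> S) (f g : O -> R) : Prop :=
  exists g' : O -> R,
    [/\ measurable_fun [set: g_sigma_algebra_preimageType V] g',
        P.-integrable [set: O] (EFin \o g'),
        forall A : set O, g_sigma_algebra_preimage V A ->
          (\int[P]_(o in A) (g' o)%:E = \int[P]_(o in A) (f o)%:E)%E
      & {ae P, forall o, g o = g' o}].

(* E[f | V1] = E[f | V2] almost surely: versions being almost surely unique,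
   this says that the two conditional expectations have a common version. *)
Definition same_cond_exp dO (O : measurableType dO) (P : probability O R)
    d1 (S1 : measurableType d1) (V1 : O -> S1)
    d2 (S2 : measurableType d2) (V2 : O -> S2) (f : O -> R) : Prop :=
  exists g : O -> R, is_cond_exp P V1 f g /\ is_cond_exp P V2 f g.

Definition dTV (E : finType) (nu1 nu2 : E -> R) : R :=
  2^-1 * \sum_(e : E) `|nu1 e - nu2 e|.

End probabilistic_notions.

(* q w y x stands for q(w | y, x).  It is a total function, but only its values
   at x = past xi t with xi in D are ever constrained. *)
Section model.
Context {R : realType} {dE : measure_display} {E : finMeasurableType dE}.
Context {n : nat}.
Variable q : E -> (nat -> E) -> (nat -> n.-tuple R) -> R.

Definition b_coef (D : set (int -> n.-tuple R)) (m : nat) : \bar R :=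
  ereal_sup [set r | exists (y y' : nat -> E) (x : int -> n.-tuple R) (t : int),
    [/\ D x, agree m y y' &
        r = (dTV (fun w => q w y (past x t)) (fun w => q w y' (past x t)))%:E]].

(* P(Y_t = w | Y_{t-1}^-, X) = q(w | Y_{t-1}^-, X_t^-) for all t and w. *)
Definition cond_law_eq dO (O : measurableType dO) (P : probability O R)
    (X : int -> O -> n.-tuple R) (Y : int -> O -> E) : Prop :=
  forall (t : int) (w : E),
    is_cond_exp P
      (fun o => (past (trajectory Y o) (t - 1), trajectory X o))
      (fun o => \1_(Y t @^-1` [set w]) o)
      (fun o => q w (past (trajectory Y o) (t - 1)) (past (trajectory X o) t)).

End model.

(* Main.v *)
Require Import Defs.
From HB Require Import structures.
From mathcomp Require Import all_boot all_order all_algebra.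
From mathcomp Require Import all_classical all_reals all_analysis.
From mathcomp Require Import measurable_realfun.
From mathcomp Require Import ring lra zify.

Set Implicit Arguments.
Unset Strict Implicit.
Unset Printing Implicit Defensive.
Import Order.TTheory GRing.Theory Num.Theory.
Import numFieldNormedType.Exports.

Local Open Scope classical_set_scope.
Local Open Scope ring_scope.

(** The argument rests on one contraction estimate, from which existence, uniqueness,
    stationarity and ergodicity are all derived.

    Since the covariate is stationary, it almost surely follows a path all of whose
    shifts lie in D. Off these paths q is replaced by the uniform law. This gives
    transition probabilities (kernel) that commute with the shift, depend on the
    remote past as little as b_coef prescribes (kernel_fading), and lead to the same
    conditional probability equation, which becomes a statement about expectations of
    indicators (solves).

    Loss of memory. Run two chains with the same covariate path from two different
    pasts, using at each time a maximal coupling of the two transition laws. When the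
    last m letters agree, the next ones differ with probability at most b_m, so the
    number of letters on which the pasts agree dominates a house-of-cards chain, which
    climbs from m to m + 1 with probability 1 - b_m and falls to 0 otherwise. As b is
    summable and b_0 < 1, this chain is transient (house_cvg0). No coupling is built:
    the estimate is the bound back_contract on the oscillation of the functions
    obtained from a function of finitely many letters by integrating these letters
    backwards in time.

    Uniqueness. For any solution, the expectation of a function of a finite window of
    letters times a function of the covariate is computed, up to an error that tends
    to 0, by integrating the letters from time t - k on and freezing the remote past.
    The result only involves the law of the covariate (solution_unique).

    Existence. For a fixed covariate path x, the laws of the chain started at time - k
    converge on functions of finitely many letters. The limit (limit_law) is realised
    as the law of a measurable function chain x u of x and of a uniform variable u, by
    nested subdivisions of [0, 1). Putting a uniform variable next to the covariate
    gives a solution (chain_solves).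

    Conditional expectations. By uniqueness, the conditional law of the past of Y at
    time t given X is that of the past of chain X u, a function of X that depends on the
    past of X at t only. It remains to see that a measurable function which depends on
    the past only is almost surely a measurable function of the past
    (factor_through_past). For this real paths are coded by bits: in the Cantor space
    measurable sets are approximated from inside by closed sets, and projections of
    closed sets are closed.

    Stationarity. The shifted pair solves the same equation with a covariate of the same
    law, so uniqueness applies.

    Ergodicity. Let A be an invariant event with positive probability. By stationarity A
    is approximated by events on the covariate and the letters of an arbitrarily remote
    past, so conditioning on A preserves the equation. It also preserves the law of the
    covariate: the conditional law is stationary and absolutely continuous with respect
    to an ergodic law, hence equal to it (ergodic_unique). By uniqueness the pair has
    the same law under the conditional probability, so A has probability 1. *)

(** * Expectations of bounded measurable functions *)

Definition bmfun {d} {T : measurableType d} {R : realType} (f : T -> R) : Prop :=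
  measurable_fun setT f /\ exists M : R, forall x, `|f x| <= M.

Lemma indic_pred {T : Type} {R : pzRingType} (b : T -> bool) (x : T) :
  \1_[set y | b y] x = (b x)%:R :> R.
Proof. by rewrite indicE; congr (nat_of_bool _)%:R; apply/idP/idP => [/set_mem|/mem_set]. Qed.

Definition mfun_of {d1} {T1 : measurableType d1} {d2} {T2 : measurableType d2}
    (f : T1 -> T2) (mf : measurable_fun setT f) : {mfun T1 >-> T2} :=
  MeasurableFun.Pack (MeasurableFun.Class (isMeasurableFun.Build _ _ _ _ _ mf)).

Section bmfun_theory.
Context {d} {T : measurableType d} {R : realType}.
Implicit Types f g : T -> R.

Lemma bmfun_cst (c : R) : bmfun (fun _ : T => c).
Proof. by split; [exact: measurable_cst|exists `|c|]. Qed.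

Lemma bmfunD f g : bmfun f -> bmfun g -> bmfun (fun x => f x + g x).
Proof.
move=> [mf [M hM]] [mg [N hN]]; split; first exact: measurable_funD.
by exists (M + N) => x; rewrite (le_trans (ler_normD _ _))// lerD.
Qed.

Lemma bmfunM f g : bmfun f -> bmfun g -> bmfun (fun x => f x * g x).
Proof.
move=> [mf [M hM]] [mg [N hN]]; split; first exact: measurable_funM.
by exists (M * N) => x; rewrite normrM ler_pM.
Qed.

Lemma bmfunZ (c : R) f : bmfun f -> bmfun (fun x => c * f x).
Proof. by move=> ?; apply: bmfunM => //; exact: bmfun_cst. Qed.

Lemma bmfunB f g : bmfun f -> bmfun g -> bmfun (fun x => f x - g x).
Proof.
move=> bf bg; apply: bmfunD => //.
by under eq_fun do rewrite -mulN1r; exact: bmfunZ.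
Qed.

Lemma bmfun_sum (I : Type) (r : seq I) (F : I -> T -> R) :
  (forall i, bmfun (F i)) -> bmfun (fun x => \sum_(i <- r) F i x).
Proof.
move=> bF; elim: r => [|i r IH].
  by under eq_fun do rewrite big_nil; exact: bmfun_cst.
by under eq_fun do rewrite big_cons; exact: bmfunD.
Qed.

Lemma bmfun_indic (A : set T) : measurable A -> bmfun (\1_A : T -> R).
Proof.
move=> mA; split; first exact: measurable_indic.
by exists 1 => x; rewrite indicE normr_nat lern1 leq_b1.
Qed.

Lemma bmfun_comp d' (S : measurableType d') (V : S -> T) f :
  measurable_fun setT V -> bmfun f -> bmfun (fun s => f (V s)).
Proof.
move=> mV [mf [M hM]]; split; first exact: measurableT_comp.
by exists M.
Qed.

End bmfun_theory.

Definition expect {d} {T : measurableType d} {R : realType}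
  (P : probability T R) (f : T -> R) : R := \int[P]_x f x.

Section expect_theory.
Context {d} {T : measurableType d} {R : realType} (P : probability T R).
Implicit Types f g : T -> R.

Lemma bmfun_integrable f : bmfun f -> P.-integrable setT (EFin \o f).
Proof.
move=> [mf [M hM]]; apply: measurable_bounded_integrable => //.
  exact: (le_lt_trans (probability_le1 P measurableT) (ltry _)).
exists M; split; first exact: num_real.
by move=> N MN x _ /=; rewrite (le_trans (hM x))// ltW.
Qed.

Lemma EFin_expect f : bmfun f -> ((expect P f)%:E = \int[P]_x (f x)%:E)%E.
Proof.
by move=> bf; rewrite /expect /Rintegral fineK//;
  apply: integrable_fin_num => //; exact: bmfun_integrable.
Qed.

Lemma expect_cst (c : R) : expect P (fun=> c) = c.
Proof.
rewrite /expect Rintegral_cst//.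
rewrite (_ : fine _ = 1) ?mulr1//.
exact: (congr1 fine (probability_setT P)).
Qed.

Lemma expectD f g : bmfun f -> bmfun g ->
  expect P (fun x => f x + g x) = expect P f + expect P g.
Proof. by move=> bf bg; rewrite /expect RintegralD//; exact: bmfun_integrable. Qed.

Lemma expectB f g : bmfun f -> bmfun g ->
  expect P (fun x => f x - g x) = expect P f - expect P g.
Proof. by move=> bf bg; rewrite /expect RintegralB//; exact: bmfun_integrable. Qed.

Lemma expectZ (c : R) f : bmfun f -> expect P (fun x => c * f x) = c * expect P f.
Proof. by move=> bf; rewrite /expect RintegralZl//; exact: bmfun_integrable. Qed.

Lemma expect_sum (I : Type) (r : seq I) (F : I -> T -> R) :
  (forall i, bmfun (F i)) ->
  expect P (fun x => \sum_(i <- r) F i x) = \sum_(i <- r) expect P (F i).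
Proof.
move=> bF; elim: r => [|i r IH].
  by under eq_fun do rewrite big_nil; rewrite expect_cst big_nil.
under eq_fun do rewrite big_cons; rewrite expectD ?IH ?big_cons//.
exact: bmfun_sum.
Qed.

Lemma expect_indic (A : set T) : measurable A -> expect P \1_A = fine (P A).
Proof.
by move=> mA; rewrite /expect /Rintegral integral_indic// setIT.
Qed.

Lemma le_expect f g : bmfun f -> bmfun g -> (forall x, f x <= g x) ->
  expect P f <= expect P g.
Proof.
by move=> bf bg fg; apply: le_Rintegral => //; exact: bmfun_integrable.
Qed.

Lemma expect_dist_fun f g h : bmfun f -> bmfun g -> bmfun h ->
  (forall x, `|f x - g x| <= h x) -> `|expect P f - expect P g| <= expect P h.
Proof.
move=> bf bg bh fg; rewrite ler_distl; apply/andP; split.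
- rewrite -expectB//; apply: le_expect => //; first exact: bmfunB.
  by move=> x; have := fg x; rewrite ler_distl => /andP[].
- rewrite -expectD//; apply: le_expect => //; first exact: bmfunD.
  by move=> x; have := fg x; rewrite ler_distl => /andP[].
Qed.

Lemma expect_dist f g (c : R) : bmfun f -> bmfun g ->
  (forall x, `|f x - g x| <= c) -> `|expect P f - expect P g| <= c.
Proof.
move=> bf bg fg; rewrite -(expect_cst c); apply: expect_dist_fun => //.
exact: bmfun_cst.
Qed.

Lemma eq_expect_ae f g : bmfun f -> bmfun g -> {ae P, forall x, f x = g x} ->
  expect P f = expect P g.
Proof.
move=> [mf _] [mg _] fg; rewrite /expect /Rintegral; congr fine.
apply: ae_eq_integral => //; first exact/measurable_EFinP.
  exact/measurable_EFinP.
by apply: filterS fg => x fgx _ /=; rewrite fgx.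
Qed.

Lemma expect_setI f A : bmfun f -> measurable A ->
  (\int[P]_(x in A) (f x)%:E = (expect P (fun x => \1_A x * f x))%:E)%E.
Proof.
move=> bf mA; rewrite EFin_expect; last by apply: bmfunM => //; exact: bmfun_indic.
rewrite integral_mkcond; apply: eq_integral => x _.
by rewrite patchE indicE; case: (x \in A); rewrite ?mul1r ?mul0r.
Qed.

Lemma expect_cvg (f_ : nat -> T -> R) f (M : R) :
  (forall n, measurable_fun setT (f_ n)) -> bmfun f ->
  (forall n x, `|f_ n x| <= M) ->
  (forall x, f_ n x @[n --> \oo] --> f x) ->
  expect P (f_ n) @[n --> \oo] --> expect P f.
Proof.
move=> mf bf hM ff.
have bn n : bmfun (f_ n) by split => //; exists M.
suff : ((expect P (f_ n))%:E @[n --> \oo] --> (expect P f)%:E)%E.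
  by move/fine_cvg.
rewrite EFin_expect// (_ : (fun n => _) = fun n => \int[P]_x (f_ n x)%:E)%E.
  2: by apply/funext => n; exact: EFin_expect.
apply: (@dominated_cvg _ _ _ P setT measurableT
  (fun n x => (f_ n x)%:E) (fun x => (f x)%:E) (fun=> M%:E)) => //.
- by move=> n; exact/measurable_EFinP.
- by move=> x _; apply/fine_cvgP; split; [exact: nearW|exact: ff].
- exact: (bmfun_integrable (bmfun_cst M)).
- by move=> n x _; rewrite /= lee_fin.
Qed.

End expect_theory.

(** Functions with values in [0, 1] are uniform limits of linear combinations
    of indicators: H is within 1 / n.+1 of the average of the indicators of
    its level sets {H >= (i + 1) / n.+1}. *)
Lemma level_set_approx {R : realType} (n : nat) (h : R) : 0 <= h <= 1 ->
  `|h - n.+1%:R^-1 * \sum_(i < n.+1) ((i.+1%:R <= n.+1%:R * h)%R)%:R|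
    <= n.+1%:R^-1.
Proof.
move=> /andP[h0 h1]; have n0 : 0 < n.+1%:R :> R by rewrite ltr0n.
have nh : 0 <= n.+1%:R * h by rewrite mulr_ge0// ltW.
pose k := Num.truncn (n.+1%:R * h).
have /andP[kh hk] := truncn_itv nh.
have kn : (k <= n.+1)%N.
  rewrite -(ler_nat R) (le_trans kh)// -[leRHS]mulr1 ler_pM2l//.
have -> : \sum_(i < n.+1) ((i.+1%:R <= n.+1%:R * h)%R)%:R = k%:R :> R.
  rewrite -natr_sum; congr _%:R.
  transitivity (\sum_(i < n.+1) ((i < k)%N : nat)).
    apply: eq_bigr => i _; congr nat_of_bool; apply/idP/idP => [ih|ik].
      by rewrite ltnNge; apply/negP => ki; move: (le_lt_trans ih hk);
        rewrite ltr_nat ltnS ltnNge ki.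
    by rewrite (le_trans _ kh)// ler_nat.
  have -> m : (\sum_(i < m) (i < k) = minn m k)%N.
    by elim: m => [|m IH]; rewrite ?big_ord0 ?big_ord_recr/= ?IH; lia.
  exact/minn_idPr.
have -> : h - n.+1%:R^-1 * k%:R = n.+1%:R^-1 * (n.+1%:R * h - k%:R).
  by rewrite mulrBr mulKf// gt_eqF.
rewrite normrM (ger0_norm (ltW _)) ?invr_gt0// -[leRHS]mulr1.
rewrite ler_pM2l ?invr_gt0// ger0_norm ?subr_ge0// lerBlDl natr1.
exact: ltW.
Qed.

Section expect_gen.
Context {R : realType} {d1} {T1 : measurableType d1} (P1 : probability T1 R)
  {d2} {T2 : measurableType d2} (P2 : probability T2 R)
  {d} {S : measurableType d} (V1 : T1 -> S) (V2 : T2 -> S)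
  (f1 : T1 -> R) (f2 : T2 -> R).
Hypothesis mV1 : measurable_fun setT V1.
Hypothesis mV2 : measurable_fun setT V2.
Hypothesis bf1 : bmfun f1.
Hypothesis bf2 : bmfun f2.

Let agree_on (H : S -> R) :=
  expect P1 (fun o => H (V1 o) * f1 o) = expect P2 (fun o => H (V2 o) * f2 o).

Lemma expect_eq_of_sets :
  (forall A, measurable A -> agree_on \1_A) -> forall H, bmfun H -> agree_on H.
Proof.
move=> hA.
have b1 H : bmfun H -> bmfun (fun o => H (V1 o) * f1 o).
  by move=> bH; apply: bmfunM => //; exact: bmfun_comp.
have b2 H : bmfun H -> bmfun (fun o => H (V2 o) * f2 o).
  by move=> bH; apply: bmfunM => //; exact: bmfun_comp.
have hsum n (A : 'I_n -> set S) c : (forall i, measurable (A i)) ->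
    agree_on (fun s => c * \sum_(i < n) \1_(A i) s).
  move=> mA; rewrite /agree_on.
  have E (T : Type) (V : T -> S) (f : T -> R) :
      (fun o => c * (\sum_(i < n) \1_(A i) (V o)) * f o) =
      (fun o => c * \sum_(i < n) (\1_(A i) (V o) * f o)).
    by apply/funext => o; rewrite -mulrA mulr_suml.
  rewrite !E !expectZ ?expect_sum; last 4 first.
  - by move=> i; apply: b2; exact: bmfun_indic.
  - by move=> i; apply: b1; exact: bmfun_indic.
  - by apply: bmfun_sum => i; apply: b2; exact: bmfun_indic.
  - by apply: bmfun_sum => i; apply: b1; exact: bmfun_indic.
  by congr (c * _); apply: eq_bigr => i _; exact: hA.
have hZ c H : bmfun H -> agree_on H -> agree_on (fun s => c * H s).
  move=> bH hH; rewrite /agree_on.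
  under eq_fun do rewrite -mulrA.
  rewrite expectZ; last exact: b1.
  rewrite hH -expectZ; last exact: b2.
  by congr expect; apply/funext => o; rewrite mulrA.
have hD H K : bmfun H -> bmfun K -> agree_on H -> agree_on K ->
    agree_on (fun s => H s + K s).
  move=> bH bK hH hK; rewrite /agree_on.
  under eq_fun do rewrite mulrDl.
  rewrite expectD; [|exact: b1|exact: b1].
  rewrite hH hK -expectD; [|exact: b2|exact: b2].
  by congr expect; apply/funext => o; rewrite mulrDl.
have [_ [M1 hM1]] := bf1; have [_ [M2 hM2]] := bf2.
have h01 H : bmfun H -> (forall s, 0 <= H s <= 1) -> agree_on H.
  move=> bH H01; rewrite /agree_on.
  have M0 : 0 <= M1 + M2.
    by rewrite addr_ge0// (le_trans (normr_ge0 _) (hM1 point), le_trans (normr_ge0 _) (hM2 point)).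
  apply/eqP; rewrite -subr_eq0 -normr_le0; apply/ler_addgt0Pr => /= e e0.
  rewrite add0r.
  pose n := Num.truncn ((M1 + M2) / e).
  have ne : (M1 + M2) / n.+1%:R <= e.
    rewrite ler_pdivrMr ?ltr0n// mulrC -ler_pdivrMr//.
    exact/ltW/truncnS_gt.
  pose Hn s := n.+1%:R^-1 * \sum_(i < n.+1)
    \1_[set s | i.+1%:R <= n.+1%:R * H s] s : R.
  have mset (i : 'I_n.+1) : measurable [set s | i.+1%:R <= n.+1%:R * H s].
    rewrite -[X in measurable X]setTI.
    have -> : [set s | i.+1%:R <= n.+1%:R * H s] =
        (fun s => (i.+1%:R <= n.+1%:R * H s)%R) @^-1` [set true].
      by apply/seteqP; split.
    apply: measurable_fun_ler => //; apply: measurable_funM => //.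
    by case: bH.
  have bHn : bmfun Hn.
    by apply: bmfunZ; apply: bmfun_sum => i; exact: bmfun_indic.
  have HHn s : `|H s - Hn s| <= n.+1%:R^-1.
    have := level_set_approx n (H01 s); congr (`|_ - _ * _| <= _).
    by apply: eq_bigr => i _; rewrite indic_pred.
  have := hsum _ _ (n.+1%:R^-1) mset; rewrite -/Hn /agree_on => eHn.
  have d1' : `|expect P1 (fun o => H (V1 o) * f1 o) -
            expect P1 (fun o => Hn (V1 o) * f1 o)| <= M1 / n.+1%:R.
    apply: expect_dist; [exact: b1|exact: b1|] => o.
    by rewrite -mulrBl normrM mulrC ler_pM.
  have d2' : `|expect P2 (fun o => H (V2 o) * f2 o) -
            expect P2 (fun o => Hn (V2 o) * f2 o)| <= M2 / n.+1%:R.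
    apply: expect_dist; [exact: b2|exact: b2|] => o.
    by rewrite -mulrBl normrM mulrC ler_pM.
  rewrite (le_trans _ ne)// mulrDl (le_trans _ (lerD d1' d2'))//.
  rewrite -eHn in d2' *.
  rewrite [X in _ <= _ + X]distrC; exact: ler_distD.
move=> H bH; have [_ [M hM]] := bH.
have M0 : 0 <= M by exact: le_trans (normr_ge0 _) (hM point).
pose K s := (2 * (M + 1))^-1 * (H s + M).
have bK : bmfun K by apply: bmfunZ; apply: bmfunD => //; exact: bmfun_cst.
have MM : 0 < 2 * (M + 1) by nra.
have aK : agree_on K.
  apply: h01 => // s; rewrite /K; have := hM s; rewrite ler_norml => /andP[H1 H2].
  apply/andP; split; first by rewrite mulr_ge0 ?invr_ge0 ?(ltW MM)//; lra.
  by rewrite mulrC ler_pdivrMr//; lra.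
have aC : agree_on (fun=> - M).
  have := hsum 1%N (fun=> setT) (- M) (fun=> measurableT); congr agree_on.
  by apply/funext => s; rewrite big_ord1 indicT mulr1.
have -> : H = (fun s => 2 * (M + 1) * K s + - M).
  by apply/funext => s; rewrite /K mulVKf ?gt_eqF//; ring.
by apply: hD => //; [exact: bmfunZ|exact: bmfun_cst|exact: hZ].
Qed.

(** A functional monotone class theorem in the form in which it is used
    throughout: a pi-system on which two weighted laws agree determines all
    integrals of bounded functions against them. *)
Lemma expect_gen (G : set (set S)) :
  @measurable _ S = <<s G >> -> setI_closed G -> G setT ->
  (forall A, G A -> agree_on \1_A) ->
  forall H, bmfun H -> agree_on H.
Proof.
move=> GE GI GT hG; apply: expect_eq_of_sets => A mA.
have b1 B : measurable B -> bmfun (fun o => \1_B (V1 o) * f1 o).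
  by move=> mB; apply: bmfunM => //; apply: bmfun_comp => //; exact: bmfun_indic.
have b2 B : measurable B -> bmfun (fun o => \1_B (V2 o) * f2 o).
  by move=> mB; apply: bmfunM => //; apply: bmfun_comp => //; exact: bmfun_indic.
have aT : agree_on \1_setT by exact: hG.
have aC B : measurable B -> agree_on \1_B -> agree_on \1_(~` B).
  move=> mB aB; rewrite /agree_on.
  have E (T : Type) (V : T -> S) (f : T -> R) :
      (fun o => \1_(~` B) (V o) * f o) =
      (fun o => \1_setT (V o) * f o - \1_B (V o) * f o).
    apply/funext => o; rewrite -mulrBl !indicE in_setT in_setC.
    by case: (V o \in B); rewrite /= ?subrr ?subr0.
  by rewrite !E !expectB ?aT ?aB//; [exact: b2|exact: b2|exact: b1|exact: b1].
apply: (@dynkin_induction _ S G (fun A => agree_on \1_A)) => //; last first.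
  by rewrite -GE.
move=> F mF tF hF; rewrite /agree_on.
pose U n := \bigcup_(k < n) F k.
have mU n : measurable (U n) by exact: bigcup_measurable.
have cvgU s : (\1_(U n) s : R) @[n --> \oo] --> (\1_(\bigcup_k F k) s : R).
  apply: cvg_near_cst; have [[k _ Fks]|nF] := pselect ((\bigcup_k F k) s).
    near=> n; rewrite !indicE !mem_set//; first by exists k.
    exists k => //=; near: n; exact: nbhs_infty_gt.
  near=> n; rewrite !indicE !memNset// => -[k _ Fk]; apply: nF; by exists k.
have cvgUf (T : Type) (V : T -> S) (f : T -> R) o :
    (\1_(U n) (V o) * f o) @[n --> \oo] --> (\1_(\bigcup_k F k) (V o) * f o).
  by apply: cvgM; [exact: cvgU|exact: cvg_cst].
have bnd (T : Type) (V : T -> S) (f : T -> R) (M : R) B o : (forall o, `|f o| <= M) ->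
    `|\1_B (V o) * f o| <= M.
  move=> hM; rewrite normrM indicE; case: (_ \in _); rewrite /= ?normr1 ?mul1r//.
  by rewrite normr0 mul0r (le_trans (normr_ge0 _) (hM o)).
have [_ [M1 hM1]] := bf1; have [_ [M2 hM2]] := bf2.
have mF' : measurable (\bigcup_k F k) by exact: bigcup_measurable.
have c1 := @expect_cvg _ _ _ P1 _ _ M1 (fun n => (b1 _ (mU n)).1) (b1 _ mF')
  (fun n o => bnd _ V1 _ _ (U n) o hM1) (cvgUf _ V1 f1).
have c2 := @expect_cvg _ _ _ P2 _ _ M2 (fun n => (b2 _ (mU n)).1) (b2 _ mF')
  (fun n o => bnd _ V2 _ _ (U n) o hM2) (cvgUf _ V2 f2).
have e n : agree_on \1_(U n).
  elim: n => [|n IH].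
    rewrite /agree_on /U bigcup_mkord big_ord0 indic0.
    by under eq_fun do rewrite mul0r; under [in RHS]eq_fun do rewrite mul0r;
      rewrite !expect_cst.
  have E (T : Type) (V : T -> S) (f : T -> R) :
      (fun o => \1_(U n.+1) (V o) * f o) =
      (fun o => \1_(U n) (V o) * f o + \1_(F n) (V o) * f o).
    apply/funext => o; rewrite -mulrDl; congr (_ * _).
    rewrite /U !bigcup_mkord big_ord_recr/= -bigcup_mkord -/(U n).
    rewrite !indicE in_setU; have [Fn|nFn] := boolP (V o \in F n); last first.
      by rewrite orbF addr0.
    rewrite [V o \in U n]memNset ?add0r// => -[k /= kn Fk].
    move: tF => /trivIsetP/(_ k n Logic.I Logic.I (negbT (ltn_eqF kn))).
    by move=> /seteqP[+ _] => /(_ (V o)); apply; split => //; exact: set_mem.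
  rewrite /agree_on !E !expectD ?IH ?hF//;
    [exact: b2|exact: b2|exact: b1|exact: b1].
rewrite -(cvg_lim (@Rhausdorff R) c1) -(cvg_lim (@Rhausdorff R) c2).
have -> // : (fun n => expect P1 (fun o => \1_(U n) (V1 o) * f1 o)) =
  (fun n => expect P2 (fun o => \1_(U n) (V2 o) * f2 o)).
by apply/funext => n; exact: e.
Unshelve. all: by end_near. Qed.

End expect_gen.

Section expect_law.
Context {R : realType} {d1} {T1 : measurableType d1} (P1 : probability T1 R)
  {d2} {T2 : measurableType d2} (P2 : probability T2 R)
  {d} {S : measurableType d} (V1 : T1 -> S) (V2 : T2 -> S).
Hypothesis mV1 : measurable_fun setT V1.
Hypothesis mV2 : measurable_fun setT V2.

Lemma measurable_preimage A : measurable A -> measurable (V1 @^-1` A).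
Proof. by move=> mA; rewrite -[X in measurable X]setTI; exact: mV1. Qed.

Lemma expect_indic_comp A : measurable A ->
  expect P1 (fun o => \1_A (V1 o)) = fine (P1 (V1 @^-1` A)).
Proof. by move=> mA; rewrite -expect_indic//; exact: measurable_preimage. Qed.

End expect_law.

Lemma probability_eq_fine {R : realType} {d1} {T1 : measurableType d1}
    (P1 : probability T1 R) {d2} {T2 : measurableType d2} (P2 : probability T2 R)
    A B : measurable A -> measurable B ->
  fine (P1 A) = fine (P2 B) -> P1 A = P2 B.
Proof.
move=> mA mB e; rewrite -[P1 A]fineK ?fin_num_measure// e fineK//.
exact: fin_num_measure.
Qed.

Section expect_same_law.
Context {R : realType} {d1} {T1 : measurableType d1} (P1 : probability T1 R)
  {d2} {T2 : measurableType d2} (P2 : probability T2 R)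
  {d} {S : measurableType d} (V1 : T1 -> S) (V2 : T2 -> S).
Hypothesis mV1 : measurable_fun setT V1.
Hypothesis mV2 : measurable_fun setT V2.

Let weight1 (T : Type) (V : T -> S) (H : S -> R) :
  (fun o => H (V o) * 1) = (fun o => H (V o)).
Proof. by apply/funext => o; rewrite mulr1. Qed.

Lemma expect_same_law : same_law P1 P2 V1 V2 -> forall H : S -> R, bmfun H ->
  expect P1 (fun o => H (V1 o)) = expect P2 (fun o => H (V2 o)).
Proof.
move=> E H bH.
have := @expect_eq_of_sets R _ _ P1 _ _ P2 _ _ V1 V2 (fun=> 1) (fun=> 1) mV1 mV2
  (bmfun_cst 1) (bmfun_cst 1) _ H bH.
rewrite !weight1; apply => A mA.
by rewrite !weight1 !expect_indic_comp// E.
Qed.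

Lemma same_law_gen (G : set (set S)) :
  @measurable _ S = <<s G >> -> setI_closed G -> G setT ->
  (forall A, G A -> expect P1 (fun o => \1_A (V1 o)) = expect P2 (fun o => \1_A (V2 o))) ->
  same_law P1 P2 V1 V2.
Proof.
move=> GE GI GT hG A mA.
apply: probability_eq_fine; [exact: measurable_preimage..|].
rewrite -!expect_indic_comp//.
have := @expect_gen R _ _ P1 _ _ P2 _ _ V1 V2 (fun=> 1) (fun=> 1) mV1 mV2
  (bmfun_cst 1) (bmfun_cst 1) G GE GI GT _ _ (bmfun_indic mA).
by rewrite !weight1; apply => B GB; rewrite !weight1; exact: hG.
Qed.

End expect_same_law.

Section expect_fubini.
Context {R : realType} {d1} {T1 : measurableType d1} (P1 : probability T1 R)
  {d2} {T2 : measurableType d2} (P2 : probability T2 R).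
Implicit Types f : T1 * T2 -> R.

Lemma bmfun_section f x : bmfun f -> bmfun (fun y => f (x, y)).
Proof. by move=> bf; apply: bmfun_comp bf; exact: pair1_measurable. Qed.

Lemma bmfun_expect f : bmfun f -> bmfun (fun x => expect P2 (fun y => f (x, y))).
Proof.
move=> bf; have [mf [M hM]] := bf; split.
  apply/measurable_EFinP.
  have := @measurable_fubini_F _ _ _ _ _ P1 P2 _ (bmfun_integrable (P1 \x P2)%E bf).
  congr measurable_fun; apply/funext => x.
  by rewrite /fubini_F/= EFin_expect//; exact: bmfun_section.
exists M => x; rewrite ler_norml; apply/andP; split.
- rewrite -(expect_cst P2 (- M)); apply: le_expect; [exact: bmfun_cst|exact: bmfun_section|].
  by move=> y; have := hM (x, y); rewrite ler_norml => /andP[].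
- rewrite -(expect_cst P2 M); apply: le_expect; [exact: bmfun_section|exact: bmfun_cst|].
  by move=> y; have := hM (x, y); rewrite ler_norml => /andP[].
Qed.

Lemma expect_prod f : bmfun f ->
  expect (P1 \x P2)%E f = expect P1 (fun x => expect P2 (fun y => f (x, y))).
Proof.
move=> bf; apply: EFin_inj; rewrite !EFin_expect//; last exact: bmfun_expect.
rewrite -(integral12_prod_meas1 (bmfun_integrable (P1 \x P2)%E bf)).
by apply: eq_integral => x _; rewrite /fubini_F/= EFin_expect//; exact: bmfun_section.
Qed.

End expect_fubini.

(** * Product sigma-algebras and sets depending on finitely many coordinates *)

Section product_measurability.
Context {d} {T : measurableType d} {I : Type}.

Lemma measurable_coord (i : I) : measurable_fun setT (fun x : I -> T => x i).
Proof.
move=> _ A mA; rewrite setTI; apply: sub_sigma_algebra.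
by exists i => //; exists A => //; rewrite setTI.
Qed.

Lemma measurable_fun_coordP {dS} {S : measurableType dS} (f : S -> I -> T) :
  (forall i, measurable_fun setT (fun s => f s i)) -> measurable_fun setT f.
Proof.
move=> mf; apply: (@measurability _ _ _ _ setT f (@cylinders _ I T)) => //.
move=> _ [_ [i _ [A mA <-]] <-]; rewrite !setTI.
by have := mf i measurableT A mA; rewrite setTI.
Qed.

End product_measurability.

Section trajectory_maps.
Context {d} {T : measurableType d}.

Lemma measurable_past (t : int) :
  measurable_fun setT (fun x : int -> T => past x t).
Proof. by apply: measurable_fun_coordP => j; exact: measurable_coord. Qed.

Lemma measurable_shift (k : int) :
  measurable_fun setT (Defs.shift k : (int -> T) -> int -> T).
Proof. by apply: measurable_fun_coordP => j; exact: measurable_coord. Qed.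

Lemma measurable_trajectory {dO} {O : measurableType dO} (Z : int -> O -> T) :
  (forall t, measurable_fun setT (Z t)) -> measurable_fun setT (trajectory Z).
Proof. by move=> mZ; exact: measurable_fun_coordP. Qed.

End trajectory_maps.

(** The codomain U is arbitrary so as to cover sets, which are functions to
    Prop, along with real functions. *)
Definition depends_on {I T U : Type} (J : set I) (g : (I -> T) -> U) : Prop :=
  forall y y', (forall i, J i -> y i = y' i) -> g y = g y'.

Definition findep {I : eqType} {T U : Type} (g : (I -> T) -> U) : Prop :=
  exists s : seq I, depends_on [set` s] g.

Definition update {I : eqType} {T : Type} (y : I -> T) (i : I) (w : T) : I -> T :=
  fun j => if j == i then w else y j.

Lemma update_same {I : eqType} {T : Type} (y : I -> T) (i : I) (w : T) :
  update y i w i = w.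
Proof. by rewrite /update eqxx. Qed.

Lemma update_id {I : eqType} {T : Type} (y : I -> T) (i : I) :
  update y i (y i) = y.
Proof. by apply/funext => j; rewrite /update; case: eqP => [->|]. Qed.

Lemma findep_comp {I : eqType} {T U V : Type} (h : U -> V) (g : (I -> T) -> U) :
  findep g -> findep (h \o g).
Proof. by move=> [s sg]; exists s => y y' yy' /=; rewrite (sg y y'). Qed.

Lemma findep_comp2 {I : eqType} {T U V W : Type} (h : U -> V -> W)
    (f : (I -> T) -> U) (g : (I -> T) -> V) :
  findep f -> findep g -> findep (fun y => h (f y) (g y)).
Proof.
move=> [s sf] [s' sg]; exists (s ++ s') => y y' yy'; congr h.
  by apply: sf => i si; apply: yy'; rewrite /= mem_cat [_ \in s]si.
by apply: sg => i si; apply: yy'; rewrite /= mem_cat [_ \in s']si orbT.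
Qed.

Lemma findep_coord {I : eqType} {T : Type} (i : I) : findep (fun y : I -> T => y i).
Proof. by exists [:: i] => y y'; apply; rewrite /= inE. Qed.

Section findep_measurable.
Context {d} {E : finMeasurableType d} {I : eqType}.
Hypothesis discreteE : forall A : set E, measurable A.

Lemma findep_set_measurable (A : set (I -> E)) : findep A -> measurable A.
Proof.
move=> [s]; elim: s A => [|i s IH] A sA.
  have [[y Ay]|nA] := pselect (exists y, A y).
    by rewrite (_ : A = setT)//; apply/seteqP; split => // z _;
      rewrite (sA z y).
  by rewrite (_ : A = set0)//; apply/seteqP; split => // z Az; apply: nA; exists z.
have -> : A = \big[setU/set0]_(w <- enum E)
    ((fun y : I -> E => y i) @^-1` [set w] `&` [set y | A (update y i w)]).
  rewrite -bigcup_seq; apply/seteqP; split => [y Ay|y [w _ [/= <-]]].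
    by exists (y i); rewrite /= ?mem_enum ?update_id.
  by rewrite update_id.
apply: bigsetU_measurable => w _; apply: measurableI.
  by rewrite -[X in measurable X]setTI; apply: measurable_coord.
apply: IH => y y' yy'; apply: sA => j /=; rewrite inE /update.
by case: eqP => //= _ js; exact: yy'.
Qed.

Lemma findep_measurable dU (U : measurableType dU) (g : (I -> E) -> U) :
  findep g -> measurable_fun setT g.
Proof.
move=> fg _ A mA; rewrite setTI; apply: findep_set_measurable.
exact: (findep_comp A fg).
Qed.

Lemma findep_generate :
  @measurable _ (I -> E) = <<s [set A : set (I -> E) | findep A] >>.
Proof.
apply/seteqP; split.
  apply: smallest_sub; first exact: smallest_sigma_algebra.
  move=> _ [i _ [A mA <-]]; rewrite setTI; apply: sub_sigma_algebra.
  exact: (findep_comp A (findep_coord i)).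
apply: smallest_sub; first exact: sigma_algebra_measurable.
by move=> A /= fA; exact: findep_set_measurable.
Qed.

Lemma findepT : findep ([set: I -> E]).
Proof. by exists [::]. Qed.

Lemma findepI (A B : set (I -> E)) : findep A -> findep B -> findep (A `&` B).
Proof. exact: findep_comp2. Qed.

End findep_measurable.

Section generated_products.
Context {d1} {T1 : measurableType d1} {d2} {T2 : measurableType d2}
  (G : set (set T1)).
Hypothesis GE : @measurable _ T1 = <<s G >>.

Definition rectangles : set (set (T1 * T2)) :=
  [set C | exists A B, [/\ G A, measurable B & C = A `*` B]].

Lemma rectangles_generate : G setT -> @measurable _ (T1 * T2)%type = <<s rectangles >>.
Proof.
move=> GT; rewrite measurable_prod_measurableType; apply/seteqP; split.
  apply: smallest_sub; first exact: smallest_sigma_algebra.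
  move=> _ [A mA [B mB <-]].
  pose T : measurableType _ := g_sigma_algebraType rectangles.
  have m1 : measurable_fun setT (fst : T -> T1).
    apply: (@measurability _ _ (g_sigma_algebraType rectangles) T1 setT fst G GE).
    move=> _ [C GC <-].
    rewrite setTI; apply: sub_sigma_algebra; exists C, setT; split => //.
    by apply/seteqP; split => [[]|[? ?] []].
  have m2 : measurable_fun setT (snd : T -> T2).
    move=> _ C mC; rewrite setTI; apply: sub_sigma_algebra; exists setT, C.
    by split => //; apply/seteqP; split => [[]|[? ?] []].
  have -> : A `*` B = ((fst : T -> T1) @^-1` A) `&` ((snd : T -> T2) @^-1` B).
    by [].
  apply: (@measurableI _ T).
    by have := m1 measurableT A mA; rewrite setTI.
  by have := m2 measurableT B mB; rewrite setTI.
apply: smallest_sub; first exact: smallest_sigma_algebra.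
move=> _ [A [B [GA mB ->]]]; apply: sub_sigma_algebra; exists A.
  by rewrite /= GE; exact: sub_sigma_algebra.
by exists B.
Qed.

Lemma rectangles_setI : setI_closed G -> setI_closed rectangles.
Proof.
move=> GI _ _ [A [B [GA mB ->]]] [A' [B' [GA' mB' ->]]].
exists (A `&` A'), (B `&` B'); split; [exact: GI|exact: measurableI|].
by rewrite setXI.
Qed.

Lemma rectanglesT : G setT -> rectangles setT.
Proof. by move=> GT; exists setT, setT; split => //; rewrite setXTT. Qed.

End generated_products.

(** * Loss of memory: coupling and the house-of-cards chain *)

Section coupling_inequality.
Context {R : realType} {E : finType}.
Implicit Types p g : E -> R.

Let coupling_le p p' g g' (beta c C : R) :
  (forall w, 0 <= p w) -> (forall w, 0 <= p' w) ->
  \sum_w p w = 1 -> \sum_w p' w = 1 -> dTV p p' <= beta -> c <= C ->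
  (forall w, `|g w - g' w| <= c) -> (forall w w', `|g w - g' w'| <= C) ->
  \sum_w p w * g w - \sum_w p' w * g' w <= (1 - beta) * c + beta * C.
Proof.
move=> p0 p'0 p1 p'1 pbeta cC gc gC.
pose r w := Num.min (p w) (p' w); pose s := \sum_w r w.
have r0 w : 0 <= r w by rewrite /r le_min p0 p'0.
have rp w : 0 <= p w - r w by rewrite subr_ge0 /r ge_min lexx.
have rp' w : 0 <= p' w - r w by rewrite subr_ge0 /r ge_min lexx orbT.
have tv : dTV p p' = 1 - s.
  have e w : `|p w - p' w| = p w + p' w - 2 * r w.
    rewrite /r; have [pp'|pp'] := leP (p w) (p' w).
      by rewrite ler0_norm ?subr_le0//; ring.
    by rewrite gtr0_norm ?subr_gt0//; ring.
  rewrite /dTV (eq_bigr _ (fun w _ => e w)) sumrB big_split/= p1 p'1 -mulr_sumr.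
  by rewrite -/s; field.
have [w1 _] : exists w : E, True.
  apply: contrapT => nE; have := p1; rewrite big1 => [|w _].
    by move/eqP; rewrite eq_sym oner_eq0.
  by exfalso; apply: nE; exists w.
have [w0 w0P] : exists w0, forall w, g w <= g w0.
  case: (@Order.TotalTheory.arg_maxP _ _ E w1 xpredT g isT) => w0 _ w0P.
  by exists w0 => w; exact: w0P.
have -> : \sum_w p w * g w - \sum_w p' w * g' w = \sum_w r w * (g w - g' w) +
    \sum_w (p w - r w) * g w - \sum_w (p' w - r w) * g' w.
  by rewrite -!sumrN -!big_split/=; apply: eq_bigr => w _; ring.
have le1 : \sum_w r w * (g w - g' w) <= s * c.
  rewrite mulr_suml; apply: ler_sum => w _; apply: ler_wpM2l => //.
  exact: le_trans (ler_norm _) (gc w).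
have le2 : \sum_w (p w - r w) * g w <= (1 - s) * g w0.
  rewrite -p1 -sumrB mulr_suml; apply: ler_sum => w _; exact: ler_wpM2l.
have le3 : (1 - s) * (g w0 - C) <= \sum_w (p' w - r w) * g' w.
  rewrite -p'1 -sumrB mulr_suml; apply: ler_sum => w _; apply: ler_wpM2l => //.
  by rewrite lerBlDr -lerBlDl; exact: le_trans (ler_norm _) (gC w0 w).
rewrite tv in pbeta.
by nra.
Qed.

(** Under a maximal coupling the two letters differ with probability dTV p p';
    the bound is c when they agree and C otherwise. *)
Lemma coupling_dist p p' g g' (beta c C : R) :
  (forall w, 0 <= p w) -> (forall w, 0 <= p' w) ->
  \sum_w p w = 1 -> \sum_w p' w = 1 -> dTV p p' <= beta -> c <= C ->
  (forall w, `|g w - g' w| <= c) -> (forall w w', `|g w - g' w'| <= C) ->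
  `|\sum_w p w * g w - \sum_w p' w * g' w| <= (1 - beta) * c + beta * C.
Proof.
move=> p0 p'0 p1 p'1 pb cC gc gC; rewrite ler_norml; apply/andP; split.
- rewrite lerNl opprB; apply: coupling_le => //; last 2 first.
  + by move=> w; rewrite distrC.
  + by move=> w w'; rewrite distrC.
  by rewrite /dTV; under eq_bigr do rewrite distrC.
- exact: coupling_le.
Qed.

End coupling_inequality.

Section house_of_cards.
Context {R : realType} (b : nat -> R) (L : nat).
Hypothesis b_ge0 : forall m, 0 <= b m.
Hypothesis b_decr : forall m, b m.+1 <= b m.
Hypothesis b0_lt1 : b 0%N < 1.
Hypothesis b_tail : forall e : R, 0 < e ->
  exists m, forall k, \sum_(m <= j < m + k) b j <= e.

(** The probability that the chain on nat which jumps from m to m.+1 with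
    probability 1 - b m, and is reset to 0 otherwise, is below L after k steps
    from m. *)
Fixpoint house (k m : nat) : R :=
  if k is k'.+1 then (1 - b m) * house k' m.+1 + b m * house k' 0%N
  else (m < L)%:R.

Lemma b_lt1 m : b m < 1.
Proof.
by elim: m => // m IH; exact: le_lt_trans (b_decr m) IH.
Qed.

Lemma house_bounds k m : 0 <= house k m <= 1.
Proof.
elim: k m => [|k IH] m /=; first by rewrite ler0n lern1 leq_b1.
have /andP[h1 h2] := IH m.+1; have /andP[h3 h4] := IH 0%N.
have := b_ge0 m; have := b_lt1 m; move=> H1 H2; apply/andP; split; nra.
Qed.

Lemma house_antitone k m : house k m.+1 <= house k m.
Proof.
elim: k m => [|k IH] m /=.
  by rewrite ler_nat; case: (ltnP m.+1 L) => // /ltnW ->.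
have le0 : house k m.+1 <= house k 0%N by elim: m.+1 => // i; apply: le_trans.
have := IH m.+1; have := b_decr m; have := b_lt1 m.+1; nra.
Qed.

Lemma house_le0 k m : house k m <= house k 0%N.
Proof. by elim: m => // m; apply: le_trans; exact: house_antitone. Qed.

Lemma house_nonincreasing : nonincreasing_seq (fun k => house k 0%N).
Proof.
apply/nonincreasing_seqP => k /=; have := house_le0 k 1.
by have := b_ge0 0; have := b0_lt1; nra.
Qed.

Let survive j i := \prod_(j <= l < j + i) (1 - b l).

Let survive_recl j i : survive j i.+1 = (1 - b j) * survive j.+1 i.
Proof. by rewrite /survive addnS big_ltn ?ltnS ?leq_addr// addSn. Qed.

Let survive_bounds j i : 0 < survive j i <= 1.
Proof.
elim: i j => [|i IH] j; first by rewrite /survive addn0 big_geq// ltr01 lexx.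
rewrite survive_recl; have /andP[h1 h2] := IH j.+1.
have := b_ge0 j; have := b_lt1 j; move=> H1 H2; apply/andP; split; nra.
Qed.

Let survive_sum j i : 1 - survive j i <= \sum_(j <= l < j + i) b l.
Proof.
elim: i j => [|i IH] j; first by rewrite /survive addn0 !big_geq// subrr.
rewrite survive_recl addnS big_ltn ?ltnS ?leq_addr//.
have := IH j.+1; rewrite addSn; have /andP[h1 h2] := survive_bounds j.+1 i.
have := b_ge0 j; have := b_lt1 j; nra.
Qed.

Let house_unroll k i j : house (i + k) j <=
  survive j i * house k (j + i) + (1 - survive j i) * house k 0%N.
Proof.
elim: i j => [|i IH] j.
  by rewrite /survive addn0 big_geq// mul1r subrr mul0r addr0.
rewrite addSn /= survive_recl; have := IH j.+1; rewrite addSnnS.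
have le0 : house (i + k) 0%N <= house k 0%N.
  by apply: house_nonincreasing; rewrite leq_addl.
have := b_ge0 j; have := b_lt1 j; nra.
Qed.

(** Summability of b makes the chain transient. In the limit M of the
    nonincreasing sequence house k 0, climbing to a high level m costs a fixed
    factor, after which the chain comes back with probability at most the tail
    of b beyond m; this forces M below every such tail. *)
Lemma house_cvg0 : house k 0%N @[k --> \oo] --> (0 : R).
Proof.
have cv : cvgn (fun k => house k 0%N).
  apply: nonincreasing_is_cvgn; first exact: house_nonincreasing.
  by exists 0 => _ [k _ <-]; have /andP[] := house_bounds k 0.
pose M := limn (fun k => house k 0%N).
have Mle k : M <= house k 0%N.
  by apply: (nonincreasing_cvgn_ge house_nonincreasing cv).
have M0 : 0 <= M.
  by apply: limr_ge => //; apply: nearW => k; have /andP[] := house_bounds k 0.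
suff -> : 0 = M by exact: cv.
apply/eqP; rewrite eq_le M0/=; apply/ler_addgt0Pr => /= e e0; rewrite add0r.
have [m hm] := b_tail e0.
have /andP[s0 s1] := survive_bounds 0 m.
pose s := survive 0 m.
have hk k : (L <= k)%N -> M <= s * e + (1 - s) * house k 0%N.
  move=> Lk; apply: le_trans (Mle (m + k)%N) _.
  apply: (le_trans (house_unroll k m 0)).
  rewrite lerD2r ler_pM2l// add0n.
  have := house_unroll 0 k m; rewrite addn0 /=.
  rewrite ltnNge (leq_trans Lk (leq_addl _ _))/= mulr0 add0r.
  move=> /le_trans; apply; apply: le_trans (le_trans (survive_sum m k) (hm k)).
  rewrite -[leRHS]mulr1 ler_wpM2l ?lern1 ?leq_b1//.
  by rewrite subr_ge0; have /andP[] := survive_bounds m k.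
have lim_hk : (s * e + (1 - s) * house k 0%N) @[k --> \oo] --> s * e + (1 - s) * M.
  by apply: cvgD; [exact: cvg_cst|apply: cvgM; [exact: cvg_cst|exact: cv]].
have : M <= s * e + (1 - s) * M.
  rewrite -(cvg_lim (@Rhausdorff R) lim_hk); apply: limr_ge.
    by apply/cvg_ex; exists (s * e + (1 - s) * M).
  by exists L.
by rewrite /s; nra.
Qed.

End house_of_cards.

(** * Chains driven by a covariate: uniqueness *)

Section driven_chain.
Context {R : realType} {dE : measure_display} {E : finMeasurableType dE}
  {dS : measure_display} {S : measurableType dS}.

(** Solutions of the conditional probability equation, tested on indicators;
    x ranges over whole covariate paths. *)
Definition solves (Q : int -> E -> (nat -> E) -> S -> R)
    {dO} {O : measurableType dO} (P : probability O R)
    (X : O -> S) (Y : int -> O -> E) : Prop :=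
  forall (t : int) (w : E) (A : set ((nat -> E) * S)), measurable A ->
    expect P (fun o => \1_A (past (trajectory Y o) (t - 1), X o) * (Y t o == w)%:R) =
    expect P (fun o => \1_A (past (trajectory Y o) (t - 1), X o) *
                       Q t w (past (trajectory Y o) (t - 1)) (X o)).

(** Q t w y x is the probability of the letter w at time t, given the past y and
    the covariate path x. Its dependence on the letters beyond the last m is at
    most b m, uniformly in everything else. *)
Record fading (Q : int -> E -> (nat -> E) -> S -> R) (b : nat -> R) : Prop := Fading {
  fading_meas : forall t w,
    measurable_fun setT (fun z : (nat -> E) * S => Q t w z.1 z.2) ;
  fading_ge0 : forall t w y x, 0 <= Q t w y x ;
  fading_sum : forall t y x, \sum_w Q t w y x = 1 ;
  fading_tv : forall t m y y' x, agree m y y' ->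
    dTV (fun w => Q t w y x) (fun w => Q t w y' x) <= b m ;
  fading_b_ge0 : forall m, 0 <= b m ;
  fading_b_decr : forall m, b m.+1 <= b m ;
  fading_b0_lt1 : b 0%N < 1 ;
  fading_b_tail : forall e : R, 0 < e ->
    exists m, forall k, \sum_(m <= j < m + k) b j <= e
}.

Variable Q : int -> E -> (nat -> E) -> S -> R.

Definition step (t : int) (x : S) (g : (int -> E) -> R) : (int -> E) -> R :=
  fun y => \sum_w Q t w (past y (t - 1)) x * g (update y t w).

(** The conditional expectation of g given the letters up to time t - k, when
    g is a function of the letters up to time t. *)
Fixpoint back (t : int) (k : nat) (x : S) (g : (int -> E) -> R) : (int -> E) -> R :=
  if k is k'.+1 then step (t - k'%:Z) x (back t k' x g) else g.

Lemma backD t k j x g : back t (k + j) x g = back (t - k%:Z) j x (back t k x g).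
Proof.
elim: j => [|j IH]; first by rewrite addn0.
by rewrite addnS /= IH; congr step; rewrite PoszD; ring.
Qed.

Lemma step_depends t x g :
  depends_on [set i | i <= t] g -> depends_on [set i | i <= t - 1] (step t x g).
Proof.
move=> gt y y' yy'; apply: eq_bigr => w _; congr (_ * _).
  by congr Q; apply/funext => j; apply: yy' => /=; lia.
apply: gt => i /= it; rewrite /update; case: eqP => // /eqP it'.
by apply: yy' => /=; lia.
Qed.

Lemma back_depends t k x g :
  depends_on [set i | i <= t] g -> depends_on [set i | i <= t - k%:Z] (back t k x g).
Proof.
move=> gt; elim: k => [|k IH]; first by rewrite subr0.
rewrite (_ : t - k.+1%:Z = t - k%:Z - 1); last lia.
exact: step_depends.
Qed.

Definition window (t : int) (L : nat) (g : (int -> E) -> R) : Prop :=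
  (forall y, 0 <= g y <= 1) /\
  depends_on [set i | t - L%:Z < i <= t] g.

Lemma window_le t L g : window t L g -> depends_on [set i | i <= t] g.
Proof. by move=> [_ gd] y y' yy'; apply: gd => i /= /andP[_]; exact: yy'. Qed.

Lemma findep_window (g : (int -> E) -> R) : findep g -> (forall y, 0 <= g y <= 1) ->
  exists N : nat, forall n : nat, (N <= n)%N -> window n (n + n).+1 g.
Proof.
move=> [s gs] g01; exists (\sum_(i <- s) absz i)%N => n Nn; split => // y y' yy'.
apply: gs => i /= si; apply: yy' => /=.
have : (absz i <= n)%N.
  by apply: leq_trans Nn; rewrite (big_rem i)//= leq_addr.
lia.
Qed.

Hypothesis discreteE : forall A : set E, measurable A.
Variable b : nat -> R.
Hypothesis HQ : fading Q b.

Let Q_meas := fading_meas HQ.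
Let Q_ge0 := fading_ge0 HQ.
Let Q_sum := fading_sum HQ.

Lemma Q_le1 t w y x : Q t w y x <= 1.
Proof.
by rewrite -(Q_sum t y x) (bigD1 w)//= lerDl sumr_ge0.
Qed.

Lemma bmfunQ t w : bmfun (fun z : (nat -> E) * S => Q t w z.1 z.2).
Proof.
by split => //; exists 1 => z; rewrite ger0_norm// Q_le1.
Qed.

Lemma step_cst t x c : step t x (fun=> c) = fun=> c.
Proof. by apply/funext => y; rewrite /step -mulr_suml Q_sum mul1r. Qed.

Lemma step_le t x g g' : (forall y, g y <= g' y) ->
  forall y, step t x g y <= step t x g' y.
Proof. by move=> gg' y; apply: ler_sum => w _; rewrite ler_wpM2l. Qed.

Lemma back_le t k x g g' : (forall y, g y <= g' y) ->
  forall y, back t k x g y <= back t k x g' y.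
Proof. by move=> gg'; elim: k => //= k IH; exact: step_le. Qed.

Lemma back_cst t k x c : back t k x (fun=> c) = fun=> c.
Proof. by elim: k => //= k ->; rewrite step_cst. Qed.

Lemma step_sum (I : Type) (r : seq I) (c : I -> R) (F : I -> (int -> E) -> R) t x :
  step t x (fun y => \sum_(i <- r) c i * F i y) =
  (fun y => \sum_(i <- r) c i * step t x (F i) y).
Proof.
apply/funext => y; rewrite /step.
under eq_bigr do rewrite mulr_sumr.
rewrite exchange_big/=; apply: eq_bigr => i _.
by rewrite mulr_sumr; apply: eq_bigr => w _; rewrite mulrCA.
Qed.

Lemma back_sum (I : Type) (r : seq I) (c : I -> R) (F : I -> (int -> E) -> R) t k x :
  back t k x (fun y => \sum_(i <- r) c i * F i y) =
  (fun y => \sum_(i <- r) c i * back t k x (F i) y).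
Proof. by elim: k => //= k ->; rewrite step_sum. Qed.

Lemma backDr t k x f g :
  back t k x (fun y => f y + g y) = (fun y => back t k x f y + back t k x g y).
Proof.
have := back_sum [:: true; false] (fun=> 1) (fun b => if b then f else g) t k x.
have e (F : bool -> (int -> E) -> R) :
    (fun y => \sum_(i <- [:: true; false]) 1 * F i y) =
    (fun y => F true y + F false y).
  by apply/funext => y; rewrite !big_cons big_nil addr0 !mul1r.
by rewrite (e (fun b => if b then f else g)) (e (fun b => back t k x (if b then f else g))).
Qed.

Lemma back_dist t k x g g' c : (forall y, `|g y - g' y| <= c) ->
  forall y, `|back t k x g y - back t k x g' y| <= c.
Proof.
move=> gg' y; rewrite ler_distl; apply/andP; split.
- rewrite lerBlDr; have := back_cst t k x c => /(congr1 (fun f => f y)) <-.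
  have := @backDr t k x g (fun=> c) => /(congr1 (fun f => f y)) /= <-.
  apply: back_le => z; have := gg' z; rewrite ler_distl => /andP[]; lra.
- have := back_cst t k x c => /(congr1 (fun f => f y)) /= {1}<-.
  have := @backDr t k x g' (fun=> c) => /(congr1 (fun f => f y)) /= <-.
  apply: back_le => z; have := gg' z; rewrite ler_distl => /andP[]; lra.
Qed.

Lemma back_bounds t k x g : (forall y, 0 <= g y <= 1) ->
  forall y, 0 <= back t k x g y <= 1.
Proof.
move=> g01 y; apply/andP; split.
- have := back_cst t k x 0 => /(congr1 (fun f => f y)) /= {1}<-.
  by apply: back_le => z; have /andP[] := g01 z.
- have := back_cst t k x 1 => /(congr1 (fun f => f y)) /= <-.
  by apply: back_le => z; have /andP[] := g01 z.
Qed.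

Lemma measurable_update (t : int) (w : E) :
  measurable_fun setT (fun y : int -> E => update y t w).
Proof.
apply: measurable_fun_coordP => i; rewrite /update; case: eqP => _.
  exact: measurable_cst.
exact: measurable_coord.
Qed.

Lemma bmfun_step t (G : (int -> E) * S -> R) : bmfun G ->
  bmfun (fun z => step t z.2 (fun y => G (y, z.2)) z.1).
Proof.
move=> bG; apply: bmfun_sum => w; apply: bmfunM.
  apply: (@bmfun_comp _ _ _ _ _ (fun z : (int -> E) * S => (past z.1 (t - 1), z.2))
    _ _ (bmfunQ t w)).
  apply: measurable_fun_pair; last exact: measurable_snd.
  exact: measurableT_comp (measurable_past _) measurable_fst.
apply: (@bmfun_comp _ _ _ _ _ (fun z : (int -> E) * S => (update z.1 t w, z.2))
    _ _ bG).
apply: measurable_fun_pair; last exact: measurable_snd.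
exact: measurableT_comp (measurable_update _ _) measurable_fst.
Qed.

Lemma bmfun_back t k (G : (int -> E) * S -> R) : bmfun G ->
  bmfun (fun z => back t k z.2 (fun y => G (y, z.2)) z.1).
Proof.
move=> bG; elim: k => [|k IH] /=.
  by rewrite (_ : (fun z => _) = G)//; apply/funext => -[].
exact: (bmfun_step (t - k%:Z) IH).
Qed.

Section solution.
Context {dO} {O : measurableType dO} (P : probability O R)
  (X : O -> S) (Y : int -> O -> E).
Hypothesis mX : measurable_fun setT X.
Hypothesis mY : forall t, measurable_fun setT (Y t).
Hypothesis solP : solves Q P X Y.

Let V (t : int) o := (past (trajectory Y o) (t - 1), X o).

Lemma measurable_past_pair t : measurable_fun setT (V t).
Proof.
apply: measurable_fun_pair => //.
exact: measurableT_comp (measurable_past _) (measurable_trajectory mY).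
Qed.

Lemma measurable_joint : measurable_fun setT (fun o => (trajectory Y o, X o)).
Proof. by apply: measurable_fun_pair => //; exact: measurable_trajectory. Qed.

Lemma bmfun_letter t w : bmfun (fun o => (Y t o == w)%:R : R).
Proof.
apply: (@bmfun_comp _ _ _ _ _ (Y t) (fun v => (v == w)%:R)) => //.
split; last by exists 1 => v; rewrite normr_nat lern1 leq_b1.
by move=> _ A mA; rewrite setTI; exact: discreteE.
Qed.

(* the path that follows z up to time t - 1 and takes the value w at time t *)
Let glue (t : int) (w : E) (z : nat -> E) : int -> E :=
  fun i => if i == t then w else z (absz (t - 1 - i)%R).

Lemma solves_step t (G : (int -> E) * S -> R) : bmfun G ->
  (forall x, depends_on [set i | i <= t] (fun y => G (y, x))) ->
  expect P (fun o => G (trajectory Y o, X o)) =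
  expect P (fun o => step t (X o) (fun y => G (y, X o)) (trajectory Y o)).
Proof.
move=> bG depG.
pose H w (z : (nat -> E) * S) := G (glue t w z.1, z.2).
have bH w : bmfun (H w).
  apply: (@bmfun_comp _ _ _ _ _ (fun z : (nat -> E) * S => (glue t w z.1, z.2))) => //.
  apply: measurable_fun_pair; last exact: measurable_snd.
  apply: measurable_fun_coordP => i; rewrite /glue; case: eqP => _.
    exact: measurable_cst.
  exact: measurableT_comp (measurable_coord _) measurable_fst.
have HE w o : H w (V t o) = G (update (trajectory Y o) t w, X o).
  apply: depG => i /= it; rewrite /glue /update; case: eqP => // /eqP nit.
  by rewrite /past; congr trajectory; lia.
have key w : expect P (fun o => H w (V t o) * (Y t o == w)%:R) =
    expect P (fun o => H w (V t o) * Q t w (past (trajectory Y o) (t - 1)) (X o)).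
  apply: (@expect_eq_of_sets _ _ _ P _ _ P _ _ (V t) (V t)) => //.
  - exact: measurable_past_pair.
  - exact: measurable_past_pair.
  - exact: bmfun_letter.
  - exact: (bmfun_comp (measurable_past_pair t) (bmfunQ t w)).
  - exact: solP.
transitivity (expect P (fun o => \sum_w H w (V t o) * (Y t o == w)%:R)).
  congr expect; apply/funext => o.
  rewrite (bigD1 (Y t o))//= eqxx mulr1 HE update_id big1 ?addr0// => w.
  by rewrite eq_sym => /negbTE ->; rewrite mulr0.
rewrite expect_sum; last first.
  move=> w; apply: bmfunM; last exact: bmfun_letter.
  exact: (bmfun_comp (measurable_past_pair t)).
rewrite (eq_bigr _ (fun w _ => key w)) -expect_sum; last first.
  move=> w; apply: bmfunM; first exact: (bmfun_comp (measurable_past_pair t)).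
  exact: (bmfun_comp (measurable_past_pair t) (bmfunQ t w)).
congr expect; apply/funext => o; apply: eq_bigr => w _.
by rewrite HE mulrC.
Qed.

Lemma solves_back t k (G : (int -> E) * S -> R) : bmfun G ->
  (forall x, depends_on [set i | i <= t] (fun y => G (y, x))) ->
  expect P (fun o => G (trajectory Y o, X o)) =
  expect P (fun o => back t k (X o) (fun y => G (y, X o)) (trajectory Y o)).
Proof.
move=> bG depG; elim: k => // k ->.
apply: (@solves_step _ (fun z => back t k z.2 (fun y => G (y, z.2)) z.1)).
  exact: bmfun_back.
by move=> x; exact: (@back_depends t k x (fun y => G (y, x)) (depG x)).
Qed.

End solution.

Section contraction.
Let b_ge0 := fading_b_ge0 HQ.
Let b_decr := fading_b_decr HQ.
Let b0_lt1 := fading_b0_lt1 HQ.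
Let b_tail := fading_b_tail HQ.
Let Q_tv := fading_tv HQ.

Lemma back_contract t L g k x : window t L g -> forall m y y',
  (forall i : int, t - k%:Z - m%:Z < i <= t - k%:Z -> y i = y' i) ->
  `|back t k x g y - back t k x g y'| <= house b L k m.
Proof.
move=> [g01 gd]; elim: k => [|k IH] m y y' yy' /=.
  case: ltnP => [mL|Lm].
    have /andP[h1 h2] := g01 y; have /andP[h3 h4] := g01 y'.
    by rewrite [true%:R]mulr1n ler_norml; apply/andP; split; lra.
  rewrite (gd y y') ?subrr ?normr0// => i /= ti; apply: yy'.
  by move: ti; lia.
have past_agree : agree m (past y (t - k%:Z - 1)) (past y' (t - k%:Z - 1)).
  by move=> j jm; rewrite /past; apply: yy'; lia.
apply: coupling_dist => //.
- exact: Q_tv.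
- exact: house_le0.
- move=> w; apply: IH => i ti; rewrite /update; case: eqP => // /eqP it.
  by apply: yy'; move: ti it; lia.
- by move=> w w'; apply: IH => i; lia.
Qed.

Lemma back_contract0 t L g k x y y' : window t L g ->
  `|back t k x g y - back t k x g y'| <= house b L k 0.
Proof. by move=> wg; apply: back_contract => // i; lia. Qed.

Section two_solutions.
Context {d1} {O1 : measurableType d1} (P1 : probability O1 R)
  (X1 : O1 -> S) (Y1 : int -> O1 -> E)
  {d2} {O2 : measurableType d2} (P2 : probability O2 R)
  (X2 : O2 -> S) (Y2 : int -> O2 -> E).
Hypothesis mX1 : measurable_fun setT X1.
Hypothesis mY1 : forall t, measurable_fun setT (Y1 t).
Hypothesis sol1 : solves Q P1 X1 Y1.
Hypothesis mX2 : measurable_fun setT X2.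
Hypothesis mY2 : forall t, measurable_fun setT (Y2 t).
Hypothesis sol2 : solves Q P2 X2 Y2.
Hypothesis lawX : same_law P1 P2 X1 X2.

Let near_forget {dO} {O : measurableType dO} (P : probability O R) (X : O -> S)
    (Y : int -> O -> E) t L g (C : set S) k y0 :
  measurable_fun setT X -> (forall t, measurable_fun setT (Y t)) ->
  solves Q P X Y -> window t L g -> measurable_fun setT g -> measurable C ->
  `|expect P (fun o => \1_C (X o) * g (trajectory Y o)) -
    expect P (fun o => \1_C (X o) * back t k (X o) g y0)| <= house b L k 0.
Proof.
move=> mX mY sol wg mg mC.
have bg : bmfun g.
  by split => //; exists 1 => y; have /andP[? ?] := wg.1 y; rewrite ger0_norm.
have b1 : bmfun (fun z : (int -> E) * S => \1_C z.2 * g z.1 : R).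
  apply: bmfunM.
    exact: (bmfun_comp measurable_snd (bmfun_indic mC)).
  exact: (bmfun_comp measurable_fst bg).
have pull x c : back t k x (fun y => c * g y) = (fun y => c * back t k x g y).
  have := back_sum [:: tt] (fun=> c) (fun=> g) t k x.
  have e (F : (int -> E) -> R) : (fun y => \sum_(i <- [:: tt]) c * F y) = (fun y => c * F y).
    by apply/funext => y; rewrite big_cons big_nil addr0.
  by rewrite !e.
have -> : expect P (fun o => \1_C (X o) * g (trajectory Y o)) =
    expect P (fun o => \1_C (X o) * back t k (X o) g (trajectory Y o)).
  rewrite (@solves_back _ _ P X Y mX mY sol t k _ b1).
    by congr expect; apply/funext => o /=; rewrite pull.
  by move=> x y y' yy'; rewrite /= (window_le wg yy').
have b2 := bmfun_back t k b1.
apply: expect_dist.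
- rewrite (_ : (fun o => _) = fun o => back t k (X o) (fun y => \1_C (X o) * g y) (trajectory Y o)).
    exact: (bmfun_comp (measurable_joint mX mY) b2).
  by apply/funext => o; rewrite pull.
- rewrite (_ : (fun o => _) = fun o => back t k (X o) (fun y => \1_C (X o) * g y) y0).
    have m2 : measurable_fun setT (fun o => (y0, X o)) by exact: measurable_fun_pair.
    exact: (bmfun_comp m2 b2).
  by apply/funext => o; rewrite pull.
move=> o; rewrite -mulrBr normrM -[leRHS]mul1r ler_pM//.
  by rewrite indicE normr_nat lern1 leq_b1.
exact: back_contract0.
Qed.

(** Started from any two pasts at time t - k, the chains driven by the same
    covariate path have laws on the letters of a fixed window that differ by at
    most house b L k 0. Hence the joint law is determined by the law of the
    covariate. *)
Theorem solution_unique : same_law P1 P2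
  (fun o => (trajectory Y1 o, X1 o)) (fun o => (trajectory Y2 o, X2 o)).
Proof.
apply: (same_law_gen (measurable_joint mX1 mY1) (measurable_joint mX2 mY2)
  (rectangles_generate (findep_generate discreteE) findepT)).
- exact: (rectangles_setI findepI).
- exact: (rectanglesT findepT).
move=> _ [A [C [fA mC ->]]].
pose g : (int -> E) -> R := \1_A.
have fg : findep g by exact: (findep_comp (fun p : Prop => (`[< p >])%:R) fA).
have g01 y : 0 <= g y <= 1 by rewrite /g indicE ler0n lern1 leq_b1.
have mg : measurable_fun setT g by exact: findep_measurable.
have [N /(_ N (leqnn N)) wg] := findep_window fg g01.
have e (O : Type) (X : O -> S) (Y : int -> O -> E) :
    (fun o => \1_(A `*` C) (trajectory Y o, X o)) =
    (fun o => \1_C (X o) * g (trajectory Y o)).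
  by apply/funext => o; rewrite /g !indicE in_setX/= mulrC -natrM mulnb.
rewrite !e; pose y0 : int -> E := fun=> point.
have back_eq k : expect P1 (fun o => \1_C (X1 o) * back N k (X1 o) g y0) =
    expect P2 (fun o => \1_C (X2 o) * back N k (X2 o) g y0).
  apply: (expect_same_law mX1 mX2 lawX
    (H := fun x => \1_C x * back N k x g y0)).
  apply: bmfunM; first exact: bmfun_indic.
  have m2 : measurable_fun setT (fun x : S => (y0, x)) by exact: measurable_fun_pair.
  have bg : bmfun (fun z : (int -> E) * S => g z.1).
    apply: (bmfun_comp measurable_fst); split => //.
    by exists 1 => y; have /andP[? ?] := g01 y; rewrite ger0_norm.
  exact: (bmfun_comp m2 (bmfun_back N k bg)).
apply/eqP; rewrite -subr_eq0 -normr_le0.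
have lim0 : (house b (N + N).+1 k 0 + house b (N + N).+1 k 0) @[k --> \oo] --> (0 : R).
  by rewrite -[X in _ --> X](addr0 0); apply: cvgD; exact: house_cvg0.
rewrite -(cvg_lim (@Rhausdorff R) lim0).
apply: limr_ge; first by apply/cvg_ex; exists 0.
apply: nearW => k.
apply: le_trans (lerD (near_forget k y0 mX1 mY1 sol1 wg mg mC)
  (near_forget k y0 mX2 mY2 sol2 wg mg mC)).
by rewrite [X in _ <= _ + X]distrC back_eq; exact: ler_distD.
Qed.

End two_solutions.
End contraction.
End driven_chain.

(** * Random sequences with prescribed cylinder probabilities *)

(** A finite-alphabet extension theorem with a parameter x: the sequence is read
    off a single uniform variable u, by splitting [0, 1) into intervals of lengths
    F x s, nested along the words s. *)
Section uniform_seed.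
Context {R : realType}.

Let idTR : measurableTypeR R -> R := idfun.

#[local] HB.instance Definition _ :=
  @isMeasurableFun.Build _ _ _ _ idTR (@measurable_id _ _ setT).

Definition unif : probability R R :=
  [the probability _ _ of distribution (uniform_prob (@ltr01 R)) idTR].

Lemma expect_unif_itv (a l : R) : 0 <= a -> 0 <= l -> a + l <= 1 ->
  expect unif \1_(`[a, (a + l)[%classic) = l.
Proof.
move=> a0 l0 al1; rewrite expect_indic; last exact: measurable_itv.
have -> : unif `[a, (a + l)[%classic = l%:E; last by [].
rewrite /unif /= /distribution /pushforward /= /uniform_prob integral_uniform_pdf.
have sub : `[a, (a + l)[%classic `<=` `[0, 1]%classic.
  move=> u /=; rewrite !in_itv/= => /andP[au ua].
  by rewrite (le_trans a0 au)/= (le_trans (ltW ua)).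
rewrite (setIidl sub) (eq_integral (fun=> 1%E)); last first.
  move=> u /set_mem /sub /=; rewrite in_itv/= /uniform_pdf => ->.
  by rewrite subr0 invr1.
rewrite integral_cst; last exact: measurable_itv.
rewrite mul1e; apply: etrans (lebesgue_measure_itv _) _; rewrite /= lte_fin ltrDl.
case: ltP => [_|l0']; first by rewrite -EFinB addrAC subrr add0r.
by apply/eqP; rewrite eq_le !lee_fin l0 l0'.
Qed.

End uniform_seed.

Section interval_splitting.
Context {R : realType} {dE} {E : finMeasurableType dE} (e0 : E)
  {dS} {S : measurableType dS}.
Variable F : S -> seq E -> R.
Hypothesis discreteE : forall A : set E, measurable A.
Hypothesis F_meas : forall s, measurable_fun setT (F ^~ s).
Hypothesis F_ge0 : forall x s, 0 <= F x s.
Hypothesis F_nil : forall x, F x [::] = 1.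
Hypothesis F_rcons : forall x s, F x s = \sum_w F x (rcons s w).

Let before (w : E) : seq E := take (index w (enum E)) (enum E).

Let left_end (x : S) (s : seq E) : R :=
  \sum_(k < size s) \sum_(w <- before (nth e0 s k)) F x (rcons (take k s) w).

Let left_end_rcons x s w : left_end x (rcons s w) =
  left_end x s + \sum_(w' <- before w) F x (rcons s w').
Proof.
rewrite /left_end size_rcons big_ord_recr/= nth_rcons ltnn eqxx.
rewrite -cats1 take_size_cat//; congr (_ + _); apply: eq_bigr => k _.
by rewrite nth_cat ltn_ord takel_cat// ltnW.
Qed.

Definition in_cell (x : S) (s : seq E) (u : R) : bool :=
  left_end x s <= u < left_end x s + F x s.

Let sum_enum x s : \sum_(w <- enum E) F x (rcons s w) = F x s.
Proof. by rewrite F_rcons big_enum. Qed.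

Let take_le x s k l : (k <= l)%N ->
  \sum_(w <- take k (enum E)) F x (rcons s w) <=
  \sum_(w <- take l (enum E)) F x (rcons s w).
Proof.
move=> kl; rewrite -(subnKC kl) takeD big_cat/= lerDl.
by apply: sumr_ge0 => w _.
Qed.

Let before_end x s w : \sum_(w' <- before w) F x (rcons s w') + F x (rcons s w) =
  \sum_(w' <- take (index w (enum E)).+1 (enum E)) F x (rcons s w').
Proof.
have iw : (index w (enum E) < size (enum E))%N by rewrite index_mem mem_enum.
rewrite (take_nth e0 iw) big_rcons/= nth_index ?mem_enum//.
Qed.

Let right_end_rcons x s w :
  left_end x (rcons s w) + F x (rcons s w) <= left_end x s + F x s.
Proof.
rewrite left_end_rcons -addrA lerD2l before_end -sum_enum.
rewrite -[X in _ <= \sum_(_ <- X) _](take_size (enum E)); apply: take_le.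
by rewrite index_mem mem_enum.
Qed.

Lemma in_cell_prefix x s w u : in_cell x (rcons s w) u -> in_cell x s u.
Proof.
rewrite /in_cell => /andP[h1 h2].
rewrite (lt_le_trans h2 (right_end_rcons x s w)) andbT.
by apply: le_trans h1; rewrite left_end_rcons lerDl sumr_ge0.
Qed.

Let in_cell_rcons_inj x s w w' u :
  in_cell x (rcons s w) u -> in_cell x (rcons s w') u -> w = w'.
Proof.
have key v v' : (index v (enum E) < index v' (enum E))%N ->
    in_cell x (rcons s v) u -> in_cell x (rcons s v') u -> False.
  rewrite /in_cell !left_end_rcons => vv' /andP[_ h2] /andP[h3 _].
  rewrite -addrA before_end in h2.
  have := take_le x s vv'; rewrite -[take (index v' _) _]/(before v'); lra.
move=> cw cw'; have wE : w \in enum E by rewrite mem_enum.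
have [||eqi] := ltngtP (index w (enum E)) (index w' (enum E)).
- by move=> /key /(_ cw cw').
- by move=> /key /(_ cw' cw).
- by rewrite -(nth_index e0 wE) eqi nth_index ?mem_enum.
Qed.

Lemma in_cell_inj x s s' u : size s = size s' ->
  in_cell x s u -> in_cell x s' u -> s = s'.
Proof.
elim/last_ind: s s' => [|s w IH] s'; first by case: s'.
case/lastP: s' => [|s' w']; rewrite ?size_rcons// => -[ss'] cw cw'.
have ess' := IH _ ss' (in_cell_prefix cw) (in_cell_prefix cw'); subst s'.
by rewrite (in_cell_rcons_inj cw cw').
Qed.

Lemma in_cell_ex x L u : 0 <= u < 1 -> exists2 s, size s = L & in_cell x s u.
Proof.
move=> u01; elim: L => [|L [s sL cs]].
  by exists [::]; rewrite // /in_cell /left_end big_ord0 F_nil add0r.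
suff [w cw] : exists w, in_cell x (rcons s w) u.
  by exists (rcons s w); rewrite // size_rcons sL.
pose f w := F x (rcons s w).
have split_list (l : seq E) a : uniq l -> a <= u < a + \sum_(w <- l) f w ->
    exists2 w, w \in l &
      a + \sum_(w' <- take (index w l) l) f w' <= u <
      a + \sum_(w' <- take (index w l) l) f w' + f w.
  elim: l a => [|v l IH] a /=.
    by rewrite big_nil addr0 => _ /andP[] /le_lt_trans h /h; rewrite ltxx.
  move=> /andP[vl ul] /andP[au]; rewrite big_cons addrA => ua.
  have [uv|vu] := ltP u (a + f v).
    by exists v; rewrite ?mem_head// eqxx big_nil addr0 au.
  have [|w wl hw] := IH (a + f v) ul; first by rewrite vu.
  exists w; first by rewrite inE wl orbT.
  have -> : (v == w) = false by apply/eqP => vw; move: vl; rewrite vw wl.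
  by rewrite /= big_cons addrA.
have [|w _ hw] := split_list (enum E) (left_end x s) (enum_uniq E).
  by rewrite sum_enum.
by exists w; rewrite /in_cell left_end_rcons.
Qed.

Definition letter (x : S) (u : R) (k : nat) : E :=
  xget e0 [set w | exists2 s, size s = k & in_cell x (rcons s w) u].

Lemma letter_in_cell x s u : in_cell x s u -> mkseq (letter x u) (size s) = s.
Proof.
elim/last_ind: s => [//|s w IH] cs; rewrite size_rcons mkseqS.
rewrite (IH (in_cell_prefix cs)); congr rcons; rewrite /letter.
case: xgetP => [w' _ [s' ss' cs']|/(_ w) []]; last by exists s.
have : rcons s' w' = rcons s w by apply: in_cell_inj cs' cs; rewrite !size_rcons ss'.
by move/eqP; rewrite eqseq_rcons => /andP[_ /eqP].
Qed.

Lemma letter_cellE x s u : 0 <= u < 1 ->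
  (mkseq (letter x u) (size s) == s) = in_cell x s u.
Proof.
move=> u01; apply/eqP/idP => [<-|]; last exact: letter_in_cell.
have [s' ss' cs'] := in_cell_ex x (size s) u01.
by rewrite -ss' letter_in_cell.
Qed.

Lemma in_cell01 x s u : in_cell x s u -> 0 <= u < 1.
Proof.
elim/last_ind: s => [|s w IH]; last by move/in_cell_prefix.
by rewrite /in_cell /left_end big_ord0 F_nil add0r.
Qed.

Lemma left_end_ge0 x s : 0 <= left_end x s.
Proof. by apply: sumr_ge0 => k _; apply: sumr_ge0. Qed.

Let right_end_le1 x s : left_end x s + F x s <= 1.
Proof.
elim/last_ind: s => [|s w]; last exact: le_trans (right_end_rcons x s w).
by rewrite /left_end big_ord0 F_nil add0r.
Qed.

Let unif_cell x s : expect unif (fun u : R => (in_cell x s u)%:R) = F x s.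
Proof.
rewrite -[RHS](expect_unif_itv (left_end_ge0 x s) (F_ge0 x s) (right_end_le1 x s)).
congr expect; apply/funext => u; rewrite indicE; congr (nat_of_bool _)%:R.
by apply/idP/idP => [h|/set_mem]; [apply/mem_set|]; rewrite /= in_itv.
Qed.

Let measurable_in_cell s : measurable [set z : S * R | in_cell z.1 s z.2].
Proof.
have ml : measurable_fun setT (fun z : S * R => left_end z.1 s).
  apply: (measurableT_comp (f := left_end ^~ s)); last exact: measurable_fst.
  rewrite /left_end; apply: measurable_sum => k; apply: measurable_sum => w.
  exact: F_meas.
have mF : measurable_fun setT (fun z : S * R => F z.1 s).
  exact: measurableT_comp (F_meas s) measurable_fst.
have -> : [set z : S * R | in_cell z.1 s z.2] =
    [set z : S * R | left_end z.1 s <= z.2] `&`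
    [set z : S * R | z.2 < left_end z.1 s + F z.1 s].
  by apply/seteqP; split => z; rewrite /= /in_cell; [move/andP|move/andP].
apply: measurableI.
- have := measurable_fun_ler ml measurable_snd measurableT (Y := [set true]) I.
  rewrite setTI; congr measurable; apply/seteqP; split=> z //=.
- have := measurable_fun_ltr measurable_snd (measurable_funD ml mF) measurableT
    (Y := [set true]) I.
  rewrite setTI; congr measurable; apply/seteqP; split=> z //=.
Qed.

Lemma measurable_letters :
  measurable_fun setT (fun z : S * R => letter z.1 z.2).
Proof.
apply: measurable_fun_coordP => k _ A mA; rewrite setTI.
pose C := \big[setU/set0]_(w <- [seq w <- enum E | w \in A])
  \big[setU/set0]_(s : k.-tuple E) [set z : S * R | in_cell z.1 (rcons s w) z.2].
have -> : (fun z : S * R => letter z.1 z.2 k) @^-1` A =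
    C `|` (if e0 \in A then ~` [set z : S * R | in_cell z.1 [::] z.2] else set0).
  rewrite /C; apply/seteqP; split => [[x u] /= Au|[x u]].
    rewrite /letter in Au; move: Au.
    case: xgetP => [w _ [s sk cs] Aw|nex Ae0].
      left; rewrite -bigcup_seq; exists w => /=.
        by rewrite mem_filter mem_enum andbT; exact: mem_set.
      rewrite -bigcup_seq; exists (tcast sk (in_tuple s)) => /=; first exact: mem_index_enum.
      by rewrite val_tcast.
    right; rewrite mem_set//= => c0; have := in_cell_ex x k.+1 (in_cell01 c0).
    move=> [s]; case/lastP: s => [//|s w]; rewrite size_rcons => -[sk] cs.
    by apply: (nex w); exists s.
  move=> [|]; last first.
    case: ifPn => // /set_mem Ae0 nc; rewrite /= /letter.
    case: xgetP => [w _ [s _ /in_cell01 u01]|//].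
    by exfalso; apply: nc; rewrite /= /in_cell /left_end big_ord0 F_nil add0r.
  rewrite -bigcup_seq => -[w /= wA]; rewrite -bigcup_seq => -[s _ /= cs].
  rewrite mem_filter in wA; have /andP[/set_mem Aw _] := wA.
  have := letter_in_cell cs; rewrite size_rcons mkseqS => /eqP.
  by rewrite eqseq_rcons size_tuple => /andP[_ /eqP ->].
apply: measurableU.
  by apply: bigsetU_measurable => w _; apply: bigsetU_measurable.
by case: ifP => // _; exact: measurableC.
Qed.

(** The event that the sequence starts with s is the event that u lies in the cell
    of s, except when u is outside [0, 1), which is a null event. *)
Lemma expect_letter x s :
  expect unif (fun u : R => (mkseq (letter x u) (size s) == s)%:R) = F x s.
Proof.
rewrite -unif_cell.
have bc s' : bmfun (fun u : R => (in_cell x s' u)%:R : R).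
  rewrite (_ : (fun u => _) = \1_[set u | in_cell x s' u]).
    apply: bmfun_indic; have := measurable_xsection x (measurable_in_cell s').
    by congr measurable; apply/seteqP; split => u; rewrite /xsection /= inE.
  by apply/funext => u; rewrite indic_pred.
have bl : bmfun (fun u : R => (mkseq (letter x u) (size s) == s)%:R : R).
  have ml : measurable_fun setT (fun u : R => letter x u).
    exact: (measurableT_comp measurable_letters (pair1_measurable x)).
  apply: (bmfun_comp (f := fun y => (mkseq y (size s) == s)%:R) ml).
  split; last by exists 1 => y; rewrite normr_nat lern1 leq_b1.
  apply: findep_measurable => //; exists (iota 0 (size s)) => y y' yy'.
  by congr (_ == _)%:R; apply/eq_in_map => i /yy'.
apply/eqP; rewrite -subr_eq0 -normr_le0.
have b0 : bmfun (fun u : R => 1 - (in_cell x [::] u)%:R : R).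
  by apply: bmfunB => //; exact: bmfun_cst.
have e0' : expect unif (fun u : R => 1 - (in_cell x [::] u)%:R) = 0.
  by rewrite (expectB unif (bmfun_cst 1) (bc _)) expect_cst unif_cell F_nil subrr.
rewrite -[leRHS]e0'; apply: expect_dist_fun => // u.
have [u01|u01] := boolP (in_cell x [::] u).
  by rewrite letter_cellE ?subrr ?normr0//; exact: in_cell01 u01.
rewrite subr0 (_ : in_cell x s u = false) ?subr0.
  by rewrite normr_nat lern1 leq_b1.
apply: contraNF u01 => /in_cell01.
by rewrite /in_cell /left_end big_ord0 F_nil add0r.
Qed.

End interval_splitting.

(** * Chains driven by a covariate: existence *)

Definition enum_int (k : nat) : int := if odd k then - (k./2.+1)%:Z else (k./2)%:Z.

Definition code_int (i : int) : nat :=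
  match i with Posz n => n.*2 | Negz n => n.*2.+1 end.

Lemma code_intK : cancel code_int enum_int.
Proof.
case=> n; rewrite /enum_int /=; first by rewrite odd_double doubleK.
by rewrite odd_double /= uphalf_double NegzE.
Qed.

Lemma enum_intK : cancel enum_int code_int.
Proof.
move=> k; rewrite /enum_int; case: ifPn => [ok|ek].
  by rewrite -NegzE /=; lia.
by rewrite /=; lia.
Qed.

Section existence.
Context {R : realType} {dE : measure_display} {E : finMeasurableType dE}
  {dS : measure_display} {S : measurableType dS}.
Variables (Q : int -> E -> (nat -> E) -> S -> R) (b : nat -> R).
Hypothesis discreteE : forall A : set E, measurable A.
Hypothesis HQ : fading Q b.

Let y0 : int -> E := fun=> point.

Lemma step_skip t x g : depends_on [set i | i <= t - 1] g -> step Q t x g = g.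
Proof.
move=> gd; apply/funext => y; rewrite /step.
under eq_bigr => w _.
  rewrite (gd (update y t w) y); last first.
    by move=> i /= it; rewrite /update; case: eqP => // it'; lia.
  over.
by rewrite -mulr_suml (fading_sum HQ) mul1r.
Qed.

Lemma back_skip t j x g : depends_on [set i | i <= t] g ->
  back Q (t + j%:Z) j x g = g.
Proof.
move=> gd; suff H k : (k <= j)%N -> back Q (t + j%:Z) k x g = g by exact: H.
elim: k => //= k IH kj; rewrite IH; last exact: ltnW.
apply: step_skip => y y' yy'; apply: gd => i /= it; apply: yy' => /=; lia.
Qed.

Let back_from (s t : int) (m j i : nat) x g : s = t + j%:Z -> m = (j + i)%N ->
  depends_on [set i | i <= t] g -> back Q s m x g = back Q t i x g.
Proof. by move=> -> -> gd; rewrite backD back_skip// addrK. Qed.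

(** The chain started at time - k from a constant past and run up to time k. *)
Let approx k x g : R := back Q k%:Z (k + k) x g y0.

Let approx_window n L g k x : window n%:Z L g -> (n <= k)%N ->
  approx k x g = back Q n%:Z (n + k) x g y0.
Proof.
move=> wg nk; congr (_ y0).
by apply: (@back_from _ _ _ (k - n)); [lia|lia|exact: window_le wg].
Qed.

Let approx_from (t : int) g k x : depends_on [set i | i <= t] g -> `|t| <= k%:Z ->
  approx k x g = back Q t (absz (t + k%:Z)%R) x g y0.
Proof.
move=> gd tk; congr (_ y0).
by apply: (@back_from _ _ _ (absz (k%:Z - t)%R)); [lia|lia|].
Qed.

Let approx_cvg g x : findep g -> (forall y, 0 <= g y <= 1) ->
  cvgn (fun k => approx k x g).
Proof.
move=> fg g01; have [N /(_ N (leqnn N)) wg] := findep_window fg g01.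
apply/cauchy_cvgP/cauchy_exP => e /= e0.
have := house_cvg0 (N + N).+1 (fading_b_ge0 HQ) (fading_b_decr HQ)
  (fading_b0_lt1 HQ) (fading_b_tail HQ).
move=> /cvgrPdist_lt /(_ e e0) [k0 _ hk0].
pose k := maxn k0 N; exists (approx k x g); exists k => // k' /= kk'.
rewrite /ball /= !(approx_window _ wg); [|lia|lia].
rewrite distrC; set w := (N + k)%N; set c := back Q N%:Z w x g y0.
have -> : (N + k' = w + (k' - k))%N by lia.
rewrite backD.
have close y : `|back Q N%:Z w x g y - c| <= house b (N + N).+1 w 0.
  exact: (back_contract0 HQ).
have := back_dist HQ (N%:Z - w%:Z) (k' - k) x close y0; rewrite (back_cst HQ).
move=> /le_lt_trans; apply; have := hk0 w; rewrite /= sub0r normrN ger0_norm.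
  by apply; lia.
by have /andP[] := house_bounds (N + N).+1 (fading_b_ge0 HQ) (fading_b_decr HQ)
  (fading_b0_lt1 HQ) w 0.
Qed.

(** The law on finitely many letters of the chain started in the infinite past. *)
Definition limit_law (x : S) (g : (int -> E) -> R) : R :=
  limn (fun k => approx k x g).

Let limit_cvg g x : findep g -> (forall y, 0 <= g y <= 1) ->
  approx k x g @[k --> \oo] --> limit_law x g.
Proof. by move=> fg g01; exact: approx_cvg. Qed.

Lemma limit_law_ge0 x g : findep g -> (forall y, 0 <= g y <= 1) ->
  0 <= limit_law x g.
Proof.
move=> fg g01; apply: limr_ge; first exact: approx_cvg.
by apply: nearW => k; have /andP[] := back_bounds HQ k%:Z (k + k) x g01 y0.
Qed.

Lemma limit_law_cst x : limit_law x (fun=> 1) = 1.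
Proof.
rewrite /limit_law; under eq_fun do rewrite /approx (back_cst HQ).
exact: lim_cst.
Qed.

Lemma limit_law_sum x (I : Type) (r : seq I) (c : I -> R)
    (F : I -> (int -> E) -> R) :
  (forall i, findep (F i)) -> (forall i y, 0 <= F i y <= 1) ->
  limit_law x (fun y => \sum_(i <- r) c i * F i y) =
  \sum_(i <- r) c i * limit_law x (F i).
Proof.
move=> fF F01; apply: cvg_lim => //.
rewrite (_ : (fun k => _) = fun k => \sum_(i <- r) c i * approx k x (F i)).
  elim: r => [|i r' IH].
    by under eq_fun do rewrite big_nil; rewrite big_nil; exact: cvg_cst.
  under eq_fun do rewrite big_cons; rewrite big_cons; apply: cvgD => //.
  by apply: cvgM; [exact: cvg_cst|exact: limit_cvg].
by apply/funext => k; rewrite /approx back_sum.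
Qed.

Lemma measurable_limit_law g : findep g -> (forall y, 0 <= g y <= 1) ->
  measurable_fun setT (fun x => limit_law x g).
Proof.
move=> fg g01; apply: (measurable_fun_cvg (h := fun k x => approx k x g)).
  move=> k; have bg : bmfun (fun z : (int -> E) * S => g z.1).
    apply: (bmfun_comp measurable_fst); split; first exact: findep_measurable.
    by exists 1 => y; have /andP[? ?] := g01 y; rewrite ger0_norm.
  have m2 : measurable_fun setT (fun x : S => (y0, x)) by exact: measurable_fun_pair.
  exact: (bmfun_comp m2 (bmfun_back HQ k%:Z (k + k) bg)).1.
by move=> x _; exact: limit_cvg.
Qed.

Let cyl (s : seq E) (y : int -> E) : R :=
  (mkseq (fun k => y (enum_int k)) (size s) == s)%:R.

Let cyl_findep s : findep (cyl s).
Proof.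
exists [seq enum_int k | k <- iota 0 (size s)] => y y' yy'; congr (_ == _)%:R.
by apply/eq_in_map => k ks; apply: yy'; exact: map_f.
Qed.

Let cyl01 s y : 0 <= cyl s y <= 1.
Proof. by rewrite ler0n lern1 leq_b1. Qed.

Let cyl_rcons s y : cyl s y = \sum_w cyl (rcons s w) y.
Proof.
rewrite /cyl; set f := fun k => y (enum_int k).
have e w : (mkseq f (size (rcons s w)) == rcons s w) =
    (mkseq f (size s) == s) && (f (size s) == w).
  by rewrite size_rcons mkseqS eqseq_rcons.
under eq_bigr do rewrite e.
rewrite (bigD1 (f (size s)))//= eqxx andbT big1 ?addr0// => w.
by rewrite eq_sym => /negbTE ->; rewrite andbF.
Qed.

Let F x s := limit_law x (cyl s).

Let F_meas s : measurable_fun setT (F ^~ s).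
Proof. exact: measurable_limit_law. Qed.

Let F_ge0 x s : 0 <= F x s.
Proof. exact: limit_law_ge0. Qed.

Let F_nil x : F x [::] = 1.
Proof. exact: limit_law_cst. Qed.

Let F_rcons x s : F x s = \sum_w F x (rcons s w).
Proof.
have := limit_law_sum x (index_enum E) (fun=> 1)
  (fun w => cyl_findep (rcons s w)) (fun w => cyl01 (rcons s w)).
rewrite [RHS](eq_bigr (fun w => F x (rcons s w))); last by move=> w _; rewrite mul1r.
move=> <-; congr limit_law; apply/funext => y; rewrite cyl_rcons.
by apply: eq_bigr => w _; rewrite mul1r.
Qed.

(** A random path with law limit_law x; its letters are drawn in the order of
    enum_int. *)
Definition chain (x : S) (u : R) : int -> E :=
  fun i => letter point F x u (code_int i).

Lemma measurable_chain : measurable_fun setT (fun z : S * R => chain z.1 z.2).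
Proof.
apply: measurable_fun_coordP => i.
have := measurable_letters point F_meas F_ge0 F_nil F_rcons.
by move=> /(measurableT_comp (measurable_coord (code_int i))).
Qed.

Lemma measurable_chain_seed x : measurable_fun setT (chain x).
Proof. exact: (measurableT_comp measurable_chain (pair1_measurable x)). Qed.

Lemma expect_chain x g : findep g -> (forall y, 0 <= g y <= 1) ->
  expect unif (fun u : R => g (chain x u)) = limit_law x g.
Proof.
move=> [s gs] g01.
pose L := (\max_(i <- s) code_int i).+1.
pose ext (l : L.-tuple E) : int -> E := fun i => nth point l (code_int i).
have gE : g = fun y => \sum_(l : L.-tuple E) g (ext l) * cyl l y.
  apply/funext => y.
  have [l0 l0E] : exists l0 : L.-tuple E,
      (l0 : seq E) = mkseq (fun k => y (enum_int k)) L.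
    by exists [tuple y (enum_int k) | k < L]; rewrite /= /mkseq -val_enum_ord -map_comp.
  rewrite (bigD1 l0)//= [X in _ + X]big1 ?addr0; last first.
    move=> l; rewrite /cyl size_tuple -l0E -val_eqE eq_sym => /negbTE ->.
    by rewrite mulr0.
  rewrite /cyl size_tuple -l0E eqxx mulr1; apply: gs => i /= si.
  have iL : (code_int i < L)%N by rewrite /L ltnS; exact: leq_bigmax_seq.
  by rewrite /ext l0E nth_mkseq// code_intK.
have bc l : bmfun (fun u : R => cyl l (chain x u)).
  apply: (bmfun_comp (measurable_chain_seed x)); split.
    exact: findep_measurable.
  by exists 1 => y; rewrite normr_nat lern1 leq_b1.
rewrite gE limit_law_sum//; rewrite expect_sum; last by move=> l; exact: bmfunZ.
apply: eq_bigr => l _; rewrite expectZ//; congr (_ * _).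
rewrite -[RHS]/(F x l) -(expect_letter point discreteE F_meas F_ge0 F_nil F_rcons).
congr expect; apply/funext => u; rewrite /cyl /chain.
by congr (_ == _)%:R; apply: eq_mkseq => k; rewrite enum_intK.
Qed.

Let trunc (m : nat) (z : nat -> E) : nat -> E := fun j => if (j < m)%N then z j else point.

Let Q_trunc t w z x m : `|Q t w z x - Q t w (trunc m z) x| <= 2 * b m.
Proof.
have am : agree m z (trunc m z) by move=> j jm; rewrite /trunc jm.
have := fading_tv HQ t x am; rewrite /dTV ler_pdivrMl// => h.
by apply: le_trans h; rewrite (bigD1 w)//= lerDl sumr_ge0.
Qed.

Let b_cvg0 : b m @[m --> \oo] --> (0 : R).
Proof.
apply/cvgrPdist_le => e /= e0; have [m hm] := fading_b_tail HQ e0.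
exists m => // k /= mk; rewrite sub0r normrN ger0_norm ?(fading_b_ge0 HQ)//.
have := hm (k - m).+1; apply: le_trans; rewrite addnS subnKC// big_nat_recr//=.
by rewrite lerDr; apply: sumr_ge0 => i _; exact: fading_b_ge0 HQ _.
Qed.

(** For the approximating laws this is the last step of the recursion for back,
    but the limit is only known on functions of finitely many letters, whereas
    Q t w looks at the whole past. It is therefore truncated to m letters, at the
    cost of an error 2 * b m. *)
Lemma chain_cond x t w (B : set (nat -> E)) : measurable B ->
  expect unif (fun u : R => \1_B (past (chain x u) (t - 1)) * (chain x u t == w)%:R) =
  expect unif (fun u : R => \1_B (past (chain x u) (t - 1)) *
                            Q t w (past (chain x u) (t - 1)) x).
Proof.
move=> mB.
have mV : measurable_fun setT (fun u : R => past (chain x u) (t - 1)).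
  exact: (measurableT_comp (measurable_past _) (measurable_chain_seed x)).
have bQ : bmfun (fun z : nat -> E => Q t w z x).
  exact: (bmfun_comp (pair2_measurable x) (bmfunQ HQ t w)).
have bl : bmfun (fun u : R => (chain x u t == w)%:R : R).
  apply: (bmfun_comp (measurable_chain_seed x)
    (f := fun y : int -> E => (y t == w)%:R)); split.
    apply: findep_measurable => //.
    exact: (findep_comp (fun v => (v == w)%:R) (findep_coord t)).
  by exists 1 => y; rewrite normr_nat lern1 leq_b1.
apply: (@expect_gen _ _ _ unif _ _ unif _ _ _ _ _ _ mV mV bl (bmfun_comp mV bQ)
  _ (findep_generate discreteE) findepI findepT _ _ (bmfun_indic mB)) => {mB}B fB.
pose f y : R := \1_B (past y (t - 1)).
have ff : findep f.
  have [s sB] := findep_comp (fun p : Prop => (`[< p >])%:R : R) fB.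
  exists [seq t - 1 - j%:Z | j <- s] => y y' yy'.
  by apply: sB => j js; apply: yy'; exact: (map_f (fun j : nat => t - 1 - j%:Z)).
have f01 y : 0 <= f y <= 1 by rewrite /f indicE ler0n lern1 leq_b1.
have fd : depends_on [set i | i <= t - 1] f.
  by move=> y y' yy'; congr \1_B; apply/funext => j; apply: yy' => /=; lia.
pose g y := f y * (y t == w)%:R.
have fg : findep g.
  apply: (findep_comp2 *%R ff).
  exact: (findep_comp (fun v => (v == w)%:R) (findep_coord t)).
have g01 y : 0 <= g y <= 1.
  rewrite /g; case: (y t == w); rewrite ?mulr1 ?mulr0 ?ler01 ?lexx//.
have gd : depends_on [set i | i <= t] g.
  move=> y y' yy'; rewrite /g (fd y y') ?yy'//= => i /= it; apply: yy' => /=; lia.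
pose q m y := f y * Q t w (trunc m (past y (t - 1))) x.
have fq m : findep (q m).
  apply: (findep_comp2 *%R ff).
  exists [seq t - 1 - j%:Z | j <- iota 0 m] => y y' yy'; congr Q.
  apply/funext => j; rewrite /trunc; case: ltnP => // jm; apply: yy'.
  by apply: (map_f (fun j : nat => t - 1 - j%:Z)); rewrite mem_iota.
have q01 m y : 0 <= q m y <= 1.
  have /andP[f0 f1] := f01 y; rewrite mulr_ge0 ?(fading_ge0 HQ)//=.
  by rewrite mulr_ile1// ?(fading_ge0 HQ)// (Q_le1 HQ).
have qd m : depends_on [set i | i <= t - 1] (q m).
  move=> y y' yy'; rewrite /q (fd y y')//; congr (_ * Q _ _ _ _).
  by apply/funext => j; rewrite /trunc; case: ifP => // _; apply: yy' => /=; lia.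
have stepg y : step Q t x g y = f y * Q t w (past y (t - 1)) x.
  rewrite /step (bigD1 w)//= big1 ?addr0 => [|v vw]; last first.
    by rewrite /g update_same (negbTE vw) !mulr0.
  rewrite /g update_same eqxx mulr1 mulrC; congr (_ * _); apply: fd => i /= it.
  by rewrite /update; case: eqP => // it'; lia.
have approx_close m : `|limit_law x g - limit_law x (q m)| <= 2 * b m.
  have cv : `|approx k x g - approx k x (q m)| @[k --> \oo] -->
      `|limit_law x g - limit_law x (q m)|.
    by apply: cvg_norm; apply: cvgB; exact: limit_cvg.
  rewrite -(cvg_lim (@Rhausdorff R) cv); apply: limr_le.
    by apply/cvg_ex; eexists; exact: cv.
  exists `|t|.+1%N => // k /= tk.
  have -> : approx k x g = back Q (t - 1) (absz (t - 1 + k%:Z)%R) x (step Q t x g) y0.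
    rewrite (approx_from x gd); last lia.
    have -> : absz (t + k%:Z)%R = (1 + absz (t - 1 + k%:Z)%R)%N by lia.
    by rewrite backD /= subr0.
  rewrite (approx_from x (qd m)); last lia.
  apply: (back_dist HQ) => y; rewrite stepg /q -mulrBr normrM.
  have /andP[f0 f1] := f01 y.
  rewrite -[leRHS]mul1r ler_pM// ?(ger0_norm f0)//; exact: Q_trunc.
have mc := measurable_chain_seed x.
have bfq m : bmfun (fun u : R => q m (chain x u)).
  apply: (bmfun_comp mc); split; first exact: findep_measurable.
  by exists 1 => y; have /andP[? ?] := q01 m y; rewrite ger0_norm.
have bfQ : bmfun (fun u : R => f (chain x u) * Q t w (past (chain x u) (t - 1)) x).
  apply: bmfunM; last exact: (bmfun_comp mV bQ).
  apply: (bmfun_comp mc); split; first exact: findep_measurable.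
  by exists 1 => y; have /andP[? ?] := f01 y; rewrite ger0_norm.
rewrite -[LHS]/(expect unif (fun u : R => g (chain x u))) expect_chain//.
apply/eqP; rewrite -subr_eq0 -normr_le0.
have lim4 : (2 * b m + 2 * b m) @[m --> \oo] --> (0 : R).
  rewrite -[X in _ --> X](addr0 0) -{1 2}(mulr0 2).
  by apply: cvgD; apply: cvgM => //; exact: cvg_cst.
rewrite -(cvg_lim (@Rhausdorff R) lim4); apply: limr_ge.
  by apply/cvg_ex; exists 0.
apply: nearW => m; apply: le_trans (ler_distD (limit_law x (q m)) _ _) _.
apply: lerD => //; rewrite -expect_chain//; apply: expect_dist => // u.
rewrite /q -mulrBr normrM distrC; have /andP[f0 f1] := f01 (chain x u).
by rewrite -[leRHS]mul1r ler_pM// ?(ger0_norm f0).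
Qed.

Section canonical_solution.
Context {dO} {O : measurableType dO} (P : probability O R) (X : O -> S).
Hypothesis mX : measurable_fun setT X.

Lemma measurable_chain_pair :
  measurable_fun setT (fun z : O * R => chain (X z.1) z.2).
Proof.
have m : measurable_fun setT (fun z : O * R => (X z.1, z.2)).
  apply: measurable_fun_pair; last exact: measurable_snd.
  exact: measurableT_comp mX measurable_fst.
exact: (measurableT_comp measurable_chain m).
Qed.

Lemma chain_solves :
  solves Q (P \x unif)%E (fun z : O * R => X z.1) (fun t z => chain (X z.1) z.2 t).
Proof.
move=> t w A mA.
have mV : measurable_fun setT
    (fun z : O * R => (past (chain (X z.1) z.2) (t - 1), X z.1)).
  apply: measurable_fun_pair.
    exact: (measurableT_comp (measurable_past _) measurable_chain_pair).
  exact: measurableT_comp mX measurable_fst.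
have bA := bmfun_comp mV (bmfun_indic (R := R) mA).
rewrite expect_prod; last first.
  apply: bmfunM => //.
  apply: (bmfun_comp measurable_chain_pair (f := fun y : int -> E => (y t == w)%:R)).
  split; last by exists 1 => y; rewrite normr_nat lern1 leq_b1.
  apply: findep_measurable => //.
  exact: (findep_comp (fun v => (v == w)%:R) (findep_coord t)).
rewrite expect_prod; last first.
  by apply: bmfunM => //; exact: (bmfun_comp mV (bmfunQ HQ t w)).
congr expect; apply/funext => o.
have := chain_cond (X o) t w (measurable_ysection (X o) mA).
have e y : \1_(ysection A (X o)) y = \1_A (y, X o) :> R.
  by rewrite !indicE mem_ysection.
by under eq_fun do rewrite e; under [X in _ = expect _ X -> _]eq_fun do rewrite e.
Qed.

End canonical_solution.

(** The approximating laws of the letters up to time t only iterate the transition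
    probabilities of the times up to t. *)
Lemma chain_past_law t x x' (h : (nat -> E) -> R) : bmfun h ->
  (forall t' w y, t' <= t -> Q t' w y x = Q t' w y x') ->
  expect unif (fun u : R => h (past (chain x u) t)) =
  expect unif (fun u : R => h (past (chain x' u) t)).
Proof.
move=> bh QQ.
have mV z : measurable_fun setT (fun u : R => past (chain z u) t).
  exact: (measurableT_comp (measurable_past _) (measurable_chain_seed z)).
have back_eq k g : back Q t k x g = back Q t k x' g.
  elim: k => //= k ->; apply/funext => y; apply: eq_bigr => w _.
  by rewrite QQ//; lia.
have := @expect_gen _ _ _ unif _ _ unif _ _ _ _ _ _ (mV x) (mV x')
  (bmfun_cst 1) (bmfun_cst 1) _ (findep_generate discreteE) findepI findepT _ _ bh.
have w1 (G : (nat -> E) -> R) z : (fun u : R => G (past (chain z u) t) * 1) =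
    (fun u => G (past (chain z u) t)) by apply/funext => u; rewrite mulr1.
rewrite !w1; apply => B fB; rewrite !w1.
pose f y : R := \1_B (past y t).
have ff : findep f.
  have [s sB] := findep_comp (fun p : Prop => (`[< p >])%:R : R) fB.
  exists [seq t - j%:Z | j <- s] => y y' yy'.
  by apply: sB => j js; apply: yy'; exact: (map_f (fun j : nat => t - j%:Z)).
have f01 y : 0 <= f y <= 1 by rewrite /f indicE ler0n lern1 leq_b1.
have fd : depends_on [set i | i <= t] f.
  by move=> y y' yy'; congr \1_B; apply/funext => j; apply: yy' => /=; lia.
rewrite -[LHS]/(expect unif (fun u : R => f (chain x u))).
rewrite -[RHS]/(expect unif (fun u : R => f (chain x' u))) !expect_chain//.
have cv z := @limit_cvg f z ff f01.
apply: cvg_lim => //; apply: cvg_trans (cv x'); apply: near_eq_cvg.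
exists `|t|%N => // k /= tk.
by rewrite !(approx_from _ fd) ?back_eq//; lia.
Qed.

End existence.

(** * Functions that factor through a projection *)

Section measure_of_unions.
Local Open Scope ereal_scope.
Context {R : realType} {d} {T : measurableType d} (P : probability T R).

Lemma measure_bigcup_le (F : (set T)^nat) (e : R) : (0 <= e)%R ->
  (forall n, measurable (F n)) -> (forall n, P (F n) <= (e / (2 ^ n.+1)%:R)%:E) ->
  P (\bigcup_n F n) <= e%:E.
Proof.
move=> e0 mF Fe; have mU : measurable (\bigcup_n F n) by exact: bigcup_measurable.
apply: (le_trans (@measure_sigma_subadditive _ _ _ P _ _ mF mU (@subset_refl _ _))).
apply: le_trans _ (epsilon_trick0 xpredT e0).
by apply: lee_nneseries => [n _ _|n _]; [exact: measure_ge0|exact: Fe].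
Qed.

Lemma measure_bigcup_tail (F : (set T)^nat) (e : R) : (0 < e)%R ->
  (forall n, measurable (F n)) ->
  exists N, P (\bigcup_n F n `\` \bigcup_(n < N) F n) <= e%:E.
Proof.
move=> e0 mF; pose U N := \bigcup_(n < N) F n.
have mU N : measurable (U N) by exact: bigcup_measurable.
have UE : \bigcup_N U N = \bigcup_n F n.
  apply/seteqP; split => [x [N _ [n nN Fx]]|x [n _ Fx]]; first by exists n.
  by exists n.+1 => //; exists n => /=.
have mUU : measurable (\bigcup_n F n) by exact: bigcup_measurable.
have cv : P (U N) @[N --> \oo] --> P (\bigcup_n F n).
  rewrite -UE; apply: nondecreasing_cvg_mu => //; first by rewrite UE.
  move=> m n mn; apply/subsetPset => x [k km Fx]; exists k => //.
  exact: leq_trans mn.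
have cv' : P (U N) @[N --> \oo] --> (fine (P (\bigcup_n F n)))%:E.
  by rewrite fineK// fin_num_measure.
have /fine_cvgP[_ /cvgrPdist_le /(_ e e0) [N _ /(_ N (leqnn N)) hN]] := cv'.
exists N; rewrite -/(U N) measureD//; last exact: le_lt_trans (probability_le1 P mUU) (ltry _).
rewrite (setIidr (_ : U N `<=` _)); last by move=> x [k _ Fx]; exists k.
have h : (fine (P (\bigcup_n F n)) - fine (P (U N)))%:E <= e%:E.
  by rewrite lee_fin; exact: le_trans (ler_norm _) hN.
by move: h; rewrite EFinB !fineK//; exact: fin_num_measure.
Qed.

End measure_of_unions.

HB.instance Definition _ := Finite.on bool.

Section cantor_space.
Context {R : realType} {J : eqType}.
Implicit Types A B K : set (J -> bool).

Lemma discrete_bool (A : set bool) : measurable A.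
Proof. by []. Qed.

(** Closed sets of the Cantor space, as countable intersections of sets that
    depend on finitely many bits. *)
Definition closed_bits K : Prop :=
  exists2 C : (set (J -> bool))^nat, forall n, findep (C n) & K = \bigcap_n C n.

Lemma closed_bits_measurable K : closed_bits K -> measurable K.
Proof.
move=> [C fC ->]; apply: bigcapT_measurable => n.
exact: (findep_set_measurable discrete_bool).
Qed.

Lemma closed_bits_findep A : findep A -> closed_bits A.
Proof. by move=> fA; exists (fun=> A) => //; rewrite bigcap_const. Qed.

Lemma closed_bits_bigcap (K : (set (J -> bool))^nat) :
  (forall n, closed_bits (K n)) -> closed_bits (\bigcap_n K n).
Proof.
move=> cK; have /choice[C hC] n : exists c : (set (J -> bool))^nat,
    (forall m, findep (c m)) /\ K n = \bigcap_m c m.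
  by have [c fc Kc] := cK n; exists c.
exists (fun k => if unpickle k is Some (n, m) then C n m else setT).
  by move=> k; case: unpickle => [[n m]|]; [exact: (hC n).1|exact: findepT].
apply/seteqP; split => [a Ka k _|a Ca n _].
  case: unpickle => [[n m]|//]; have := Ka n I.
  by rewrite (hC n).2; apply.
rewrite (hC n).2 => m _; have := Ca (pickle (n, m)) I.
by rewrite pickleK.
Qed.

Lemma closed_bitsU K K' : closed_bits K -> closed_bits K' -> closed_bits (K `|` K').
Proof.
move=> [C fC ->] [C' fC' ->].
have -> : (\bigcap_n C n) `|` (\bigcap_n C' n) =
    \bigcap_n \bigcap_m (C n `|` C' m).
  apply/seteqP; split => [a [Ca|Ca] n _ m _|a Ca].
  - by left; exact: Ca.
  - by right; exact: Ca.
  apply: contrapT => /not_orP[/existsNP[n /not_implyP[_ nC]] /existsNP[m /not_implyP[_ nC']]].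
  by have [] := Ca n I m I.
apply: closed_bits_bigcap => n; apply: closed_bits_bigcap => m.
by apply: closed_bits_findep; exact: findep_comp2.
Qed.

Lemma closed_bits_bigcup (K : (set (J -> bool))^nat) N :
  (forall n, closed_bits (K n)) -> closed_bits (\bigcup_(n < N) K n).
Proof.
move=> cK; elim: N => [|N IH].
  rewrite bigcup_mkord big_ord0; apply: closed_bits_findep; by exists [::].
by rewrite bigcup_mkord big_ord_recr/= -bigcup_mkord; exact: closed_bitsU.
Qed.

Section inner_regularity.
Variable P : probability (J -> bool) R.

Let inner A := forall e : R, 0 < e ->
  exists K, [/\ closed_bits K, K `<=` A & (P (A `\` K) <= e%:E)%E].

Let inner_bigcap (F : (set (J -> bool))^nat) : (forall n, measurable (F n)) ->
  (forall n, inner (F n)) -> inner (\bigcap_n F n).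
Proof.
move=> mF iF e e0.
have /choice[K hK] n : exists k, [/\ closed_bits k, k `<=` F n &
    (P (F n `\` k) <= (e / (2 ^ n.+1)%:R)%:E)%E].
  by apply: iF; rewrite divr_gt0// ltr0n expn_gt0.
exists (\bigcap_n K n); split.
- by apply: closed_bits_bigcap => n; have [] := hK n.
- by move=> a Ka n _; have [_ + _] := hK n; apply; exact: Ka.
have mK n : measurable (K n) by have [/closed_bits_measurable] := hK n.
have sub : \bigcap_n F n `\` \bigcap_n K n `<=` \bigcup_n (F n `\` K n).
  move=> a [Fa /existsNP[n /not_implyP[_ nK]]]; exists n => //; split => //.
  exact: Fa.
apply: le_trans (le_measure P _ _ sub) _; rewrite ?inE.
- by apply: measurableD; exact: bigcapT_measurable.
- by apply: bigcup_measurable => n _; exact: measurableD.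
apply: measure_bigcup_le => //; first exact: ltW.
  by move=> n; exact: measurableD.
by move=> n; have [] := hK n.
Qed.

Let inner_bigcup (F : (set (J -> bool))^nat) : (forall n, measurable (F n)) ->
  (forall n, inner (F n)) -> inner (\bigcup_n F n).
Proof.
move=> mF iF e e0; have e2 : 0 < e / 2 by rewrite divr_gt0.
have /choice[K hK] n : exists k, [/\ closed_bits k, k `<=` F n &
    (P (F n `\` k) <= (e / 2 / (2 ^ n.+1)%:R)%:E)%E].
  by apply: iF; rewrite divr_gt0// ltr0n expn_gt0.
have [N hN] := measure_bigcup_tail P e2 mF.
have mK n : measurable (K n) by have [/closed_bits_measurable] := hK n.
exists (\bigcup_(n < N) K n); split.
- by apply: closed_bits_bigcup => n; have [] := hK n.
- by move=> a [n _ Ka]; exists n => //; have [_ + _] := hK n; apply.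
have sub : \bigcup_n F n `\` \bigcup_(n < N) K n `<=`
    (\bigcup_n F n `\` \bigcup_(n < N) F n) `|` \bigcup_n (F n `\` K n).
  move=> a [Fa nK]; have [[n nN Fn]|nF] := pselect ((\bigcup_(n < N) F n) a).
    right; exists n => //; split => // Ka; apply: nK; by exists n.
  by left.
have m1 : measurable (\bigcup_n F n `\` \bigcup_(n < N) F n).
  by apply: measurableD; exact: bigcup_measurable.
have m2 : measurable (\bigcup_n (F n `\` K n)).
  by apply: bigcup_measurable => n _; exact: measurableD.
apply: le_trans (le_measure P _ _ sub) _; rewrite ?inE.
- by apply: measurableD; exact: bigcup_measurable.
- exact: measurableU.
apply: le_trans (measureU2 P m1 m2) _.
have -> : e%:E = ((e / 2)%:E + (e / 2)%:E)%E by rewrite -EFinD -splitr.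
apply: leeD => //; apply: measure_bigcup_le => //; first exact: ltW.
  by move=> n; exact: measurableD.
by move=> n; have [] := hK n.
Qed.

(** Sets that are approximated from inside by closed sets, together with their
    complement, form a sigma-algebra. *)
Lemma inner_regular A : measurable A -> forall e : R, 0 < e ->
  exists K, [/\ closed_bits K, K `<=` A & (P (A `\` K) <= e%:E)%E].
Proof.
have inner_findep B : findep B -> inner B.
  move=> fB e e0; exists B; split; [exact: closed_bits_findep|by []|].
  by rewrite setDv measure0 lee_fin ltW.
move=> mA; suff [] : inner A /\ inner (~` A) by [].
apply: (@dynkin_induction _ (J -> bool) [set B | findep B]
  (fun B => inner B /\ inner (~` B)) (findep_generate discrete_bool) findepI);
  last by rewrite -(findep_generate discrete_bool).
- split; apply: inner_findep; first exact: findepT.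
  by rewrite setCT; exists [::].
- by move=> B fB; split; apply: inner_findep => //; exact: (findep_comp not fB).
- by move=> B mB [iB iCB]; rewrite setCK.
- move=> F mF _ iF; split; first by apply: inner_bigcup => // n; have [] := iF n.
  rewrite setC_bigcup; apply: inner_bigcap => n; first exact: measurableC.
  by have [] := iF n.
Qed.

End inner_regularity.

(** The cylinder over the projection of A to the bits in J'. *)
Definition saturation (J' : set J) A : set (J -> bool) :=
  [set a | exists2 a', A a' & forall j, J' j -> a j = a' j].

Lemma saturation_depends J' A :
  depends_on J' (saturation J' A).
Proof.
move=> a c ac; apply/propext; split => -[a' Aa' aa']; exists a' => // j Jj.
  by rewrite -ac// aa'.
by rewrite ac// aa'.
Qed.

Lemma saturation_findep J' A : findep A -> findep (saturation J' A).
Proof.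
move=> [s sA]; exists s => a c ac; apply/propext.
suff H a1 c1 : (forall i, [set` s] i -> a1 i = c1 i) ->
    saturation J' A a1 -> saturation J' A c1.
  by split; apply: H => // i si; rewrite ac.
move=> ac1 [a' Aa' aa'].
pose c' j := if `[< J' j >] then c1 j else a' j.
exists c'; last by move=> j Jj; rewrite /c' asboolT.
rewrite -(sA a' c')// => j sj; rewrite /c'; case: asboolP => // Jj.
by rewrite -ac1// aa'.
Qed.

(** Compactness of the Cantor space: along an ultrafilter containing the tails,
    a sequence of points converges bitwise. *)
Lemma saturation_bigcap J' (C : (set (J -> bool))^nat) :
  (forall n, findep (C n)) -> (forall n, C n.+1 `<=` C n) ->
  saturation J' (\bigcap_n C n) = \bigcap_n saturation J' (C n).
Proof.
move=> fC decC; apply/seteqP; split => [a [a' Ca' aa'] n _|a aC].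
  by exists a' => //; exact: Ca'.
have /choice[c hc] n : exists c, C n c /\ forall j, J' j -> a j = c j.
  by have [c Cc ac] := aC n I; exists c.
have [U [UU subU]] := @ultraFilterLemma _ (nbhs \oo) _.
pose l j := `[< U [set n | c n j] >].
have lU j : U [set n | c n j = l j].
  rewrite /l; case: asboolP => [Uj|nUj]; first exact: Uj.
  have [//|Uj] := in_ultra_setVsetC [set n | c n j] UU.
  by apply: filterS Uj => n /= /negP/negbTE.
have lUs (s : seq J) : U [set n | forall i, i \in s -> c n i = l i].
  elim: s => [|i s IH]; first exact: filterS (fun _ _ _ => _) filterT.
  apply: filterS2 IH (lU i) => n h1 h2 k; rewrite inE => /orP[/eqP ->//|].
  exact: h1.
have antiC m n : (m <= n)%N -> C n `<=` C m.
  move=> mn; rewrite -(subnKC mn); elim: (n - m)%N => [|k IH]; first by rewrite addn0.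
  by rewrite addnS => a0 /decC; exact: IH.
exists l => [n _|j Jj].
  have [s sC] := fC n.
  have Un : U [set m | (n <= m)%N] by apply: subU; exists n.
  have [m [/= nm hm]] := filter_ex (filterI Un (lUs s)).
  rewrite -(sC (c m) l) => [|i si]; last exact: hm.
  by apply: antiC nm _ _; have [] := hc m.
have [m /= <-] := filter_ex (lU j).
by have [_ ->] := hc m.
Qed.

Lemma saturation_closed_measurable J' K : closed_bits K -> measurable (saturation J' K).
Proof.
move=> [C fC ->]; pose D n := \bigcap_(k < n.+1) C k.
have fD n : findep (D n).
  elim: n => [|n IH]; rewrite /D bigcap_mkord.
    by rewrite big_ord_recr/= big_ord0; exact: findepI findepT (fC _).
  by rewrite big_ord_recr/= -bigcap_mkord; exact: findepI.
have -> : \bigcap_n C n = \bigcap_n D n.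
  apply/seteqP; split => [a Ca n _ k _|a Da n _]; first exact: Ca.
  by apply: (Da n I n); rewrite /= ltnS.
rewrite saturation_bigcap//; last first.
  by move=> n a Da k /= kn; apply: Da => /=; exact: leqW.
apply: bigcapT_measurable => n; apply: (findep_set_measurable discrete_bool).
exact: saturation_findep.
Qed.

(** The projection of a measurable set need not be measurable, but that of a closed
    set is closed. So A is first exhausted, up to a null set, by countably many
    closed subsets, and B is the union of the cylinders over their projections. *)
Lemma saturated_separation (P : probability (J -> bool) R) J' A A' :
  measurable A ->
  (forall a a', A a -> A' a' -> ~ forall j, J' j -> a j = a' j) ->
  exists B, [/\ measurable B, depends_on J' B,
    P (A `\` B) = 0%E & B `&` A' = set0].
Proof.
move=> mA sep.
have /choice[K hK] (n : nat) : exists k, [/\ closed_bits k, k `<=` A &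
    (P (A `\` k) <= (n.+1%:R^-1)%:E)%E].
  by apply: inner_regular; rewrite // invr_gt0.
pose B := \bigcup_n saturation J' (K n).
have mB : measurable B.
  apply: bigcup_measurable => n _; apply: saturation_closed_measurable.
  by have [] := hK n.
exists B; split => //.
- move=> a c ac; apply/propext; split => -[n _ Ka]; exists n => //.
    by rewrite -(@saturation_depends J' (K n) _ _ ac).
  by rewrite (@saturation_depends J' (K n) _ _ ac).
- apply/eqP; rewrite eq_le measure_ge0 andbT; apply/lee_addgt0Pr => /= e e0.
  rewrite add0e; pose n := Num.truncn e^-1.
  have ne : n.+1%:R^-1 <= e.
    by rewrite -[leRHS]invrK lef_pV2 ?posrE ?invr_gt0//; exact/ltW/truncnS_gt.
  have [cK KA Pn] := hK n.
  apply: le_trans (le_trans Pn _); last by rewrite lee_fin.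
  apply: le_measure; rewrite ?inE.
  + exact: measurableD.
  + by apply: measurableD => //; exact: closed_bits_measurable.
  move=> a [Aa nBa]; split => // Ka; apply: nBa; exists n => //.
  by exists a.
- apply/seteqP; split => // a [[n _ [a' Ka' aa']] A'a].
  have [_ KA _] := hK n; apply: (sep a' a (KA _ Ka') A'a) => j Jj.
  by rewrite aa'.
Qed.

End cantor_space.

(** A real number x is coded by the bits q_j < x, for an enumeration q of the
    rationals. *)
Section real_coding.
Context {R : realType}.

Definition rat_seq (j : nat) : R := if unpickle j is Some q then ratr q else 0.

Definition decode (a : nat -> bool) : R :=
  fine (esups (fun j => if a j then (rat_seq j)%:E else -oo%E) 0%N).

Lemma measurable_decode : measurable_fun setT decode.
Proof.
apply: measurableT_comp => //.
apply: (@measurable_fun_esups _ (nat -> bool) R setT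
  (fun j a => if a j then (rat_seq j)%:E else -oo%E)) => j.
by apply: findep_measurable => //; exact: (findep_comp
  (fun v : bool => if v then (rat_seq j)%:E else -oo%E) (findep_coord j)).
Qed.

Lemma decodeK (x : R) : decode (fun j => rat_seq j < x) = x.
Proof.
rewrite /decode; suff -> : esups (fun j =>
    if rat_seq j < x then (rat_seq j)%:E else -oo%E) 0%N = x%:E by [].
apply/eqP; rewrite eq_le; apply/andP; split.
  apply: ge_ereal_sup => _ [j _ <-]; case: ifPn => [jx|_]; last exact: leNye.
  by rewrite lee_fin ltW.
rewrite leNgt; apply/negP => h.
have [y hy yx] : exists2 y : R, y < x & forall j, rat_seq j < x -> rat_seq j <= y.
  have ub j : rat_seq j < x ->
      ((rat_seq j)%:E <= esups (fun j => if (rat_seq j < x)%R then (rat_seq j)%:E else -oo) 0%N)%E.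
    by move=> jx; apply: ereal_sup_ubound; exists j; rewrite ?jx.
  move: h ub; set s := esups _ _; case: s => [s| |] //; rewrite ?lte_fin.
    by move=> sx ub; exists s => // j /ub; rewrite lee_fin.
  move=> _ ub; exists (x - 1); first by rewrite ltrBlDr ltrDl.
  by move=> j /ub.
have [q] := rat_in_itvoo hy; rewrite in_itv/= => /andP[yq qx].
have qj : rat_seq (pickle q) = ratr q by rewrite /rat_seq pickleK.
by have := yx (pickle q); rewrite qj => /(_ qx); rewrite leNgt yq.
Qed.

End real_coding.

Section factorization.
Context {R : realType} {n : nat}.

Let bit := (int * 'I_n * nat)%type.

Let encode (x : int -> n.-tuple R) : bit -> bool :=
  fun j => (rat_seq j.2 : R) < tnth (x j.1.1) j.1.2.

Let decode_path (a : bit -> bool) : int -> n.-tuple R :=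
  fun t => [tuple decode (fun j => a (t, k, j)) | k < n].

Let encodeK x : decode_path (encode x) = x.
Proof.
apply/funext => t; apply: eq_from_tnth => k; rewrite tnth_mktuple.
exact: (decodeK (tnth (x t) k)).
Qed.

Let measurable_encode : measurable_fun setT encode.
Proof.
apply: measurable_fun_coordP => j; apply: measurable_fun_ltr => //.
exact: (measurableT_comp (measurable_tnth j.1.2) (measurable_coord j.1.1)).
Qed.

Let measurable_decode_path : measurable_fun setT decode_path.
Proof.
apply: measurable_fun_coordP => t; apply/measurable_fun_tnthP => k.
rewrite (_ : _ \o _ = fun a : bit -> bool => decode (fun j => a (t, k, j))).
  apply: (measurableT_comp measurable_decode).
  by apply: measurable_fun_coordP => j; exact: measurable_coord.
by apply/funext => a /=; rewrite tnth_mktuple.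
Qed.

Context {dO} {O : measurableType dO} (P : probability O R)
  (X : O -> int -> n.-tuple R).
Hypothesis mX : measurable_fun setT X.

(** For every rational r, the paths of D with f x > r and those with f x <= r have
    distinct pasts, so saturated_separation yields a measurable set of pasts that
    tells them apart almost surely. These countably many sets are the bits of the
    value of g. *)
Lemma factor_through_past (t : int) (D : set (int -> n.-tuple R))
    (f : (int -> n.-tuple R) -> R) :
  measurable D -> {ae P, forall o, D (X o)} -> measurable_fun setT f ->
  (forall x x', D x -> D x' -> past x t = past x' t -> f x = f x') ->
  exists2 g : (nat -> n.-tuple R) -> R, measurable_fun setT g &
    {ae P, forall o, f (X o) = g (past (X o) t)}.
Proof.
move=> mD aeD mf fpast.
have mE : measurable_fun setT (encode \o X) by exact: measurableT_comp.
pose EX : {mfun O >-> (bit -> bool)} :=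
  mfun_of mE.
pose mu := [the probability _ _ of distribution P EX].
pose J' : set bit := [set j | j.1.1 <= t].
pose A r := decode_path @^-1` (D `&` [set x | r < f x]).
pose A' r := decode_path @^-1` (D `&` [set x | f x <= r]).
have mfr r : measurable [set x | r < f x].
  rewrite -[X in measurable X]setTI -preimage_itvoy; exact: mf.
have mA r : measurable (A r).
  apply: measurable_preimage => //; exact: measurableI.
have sep r a a' : A r a -> A' r a' -> ~ forall j, J' j -> a j = a' j.
  move=> [Da ra] [Da' ra'] aa'; have : f (decode_path a) = f (decode_path a').
    apply: fpast => //; apply/funext => i; apply: eq_from_tnth => k.
    rewrite /past !tnth_mktuple; congr decode; apply/funext => j.
    by apply: aa'; rewrite /J' /= gerBl.
  by move=> e; move: ra ra'; rewrite /= e => /lt_le_trans h /h; rewrite ltxx.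
have /choice[B hB] (j : nat) := saturated_separation mu (mA (rat_seq j)) (sep (rat_seq j)).
pose code_past (z : nat -> n.-tuple R) : bit -> bool :=
  fun j => if j.1.1 <= t then (rat_seq j.2 : R) < tnth (z (absz (t - j.1.1)%R)) j.1.2
           else false.
have mcode : measurable_fun setT code_past.
  apply: measurable_fun_coordP => j; case jt : (j.1.1 <= t); last first.
    rewrite (_ : (fun z => _) = cst false); first exact: measurable_cst.
    by apply/funext => z; rewrite /code_past jt.
  rewrite (_ : (fun z => _) = fun z : nat -> n.-tuple R =>
      (rat_seq j.2 : R) < tnth (z (absz (t - j.1.1)%R)) j.1.2); last first.
    by apply/funext => z; rewrite /code_past jt.
  apply: measurable_fun_ltr => //.
  exact: (measurableT_comp (measurable_tnth j.1.2) (measurable_coord _)).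
have Bpast j o : B j (encode (X o)) = B j (code_past (past (X o) t)).
  have [_ dB _ _] := hB j; apply: dB => i /= it; rewrite /code_past it /encode /past.
  by rewrite gez0_abs ?subr_ge0// opprB addrC subrK.
exists (fun z => decode (fun j => `[< B j (code_past z) >])).
  apply: (measurableT_comp measurable_decode); apply: measurable_fun_coordP => j.
  have mBj : measurable [set z | B j (code_past z)].
    by apply: measurable_preimage => //; have [] := hB j.
  apply: (measurable_fun_bool true); rewrite setTI.
  by congr measurable : mBj; apply/seteqP; split => z /= /asboolP.
have aeB j : {ae P, forall o, D (X o) -> (B j (encode (X o)) <-> rat_seq j < f (X o))}.
  have [mB dB AB BA'] := hB j.
  exists ((encode \o X) @^-1` (A (rat_seq j) `\` B j)); split.
  - by apply: measurable_preimage => //; exact: measurableD.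
  - exact: AB.
  move=> o /= nB; apply: contrapT => nN; apply: nB => Do; split => [Bo|fo].
    rewrite ltNge; apply/negP => fr.
    have : (B j `&` A' (rat_seq j)) (encode (X o)).
      by split => //; rewrite /A' /= encodeK.
    by rewrite BA'.
  by apply: contrapT => nBo; apply: nN; split => //; rewrite /A /= encodeK.
have : {ae P, forall o, forall j, D (X o) -> (B j (encode (X o)) <-> rat_seq j < f (X o))}.
  exact: ae_foralln.
apply: filterS2 aeD => o Do /= hB'.
rewrite -[LHS]decodeK; congr decode; apply/funext => j; rewrite -Bpast.
by apply/idP/asboolP => /hB' => /(_ Do).
Qed.

End factorization.

(** * Stationarity and ergodicity *)

Section algebra_approximation.
Context {R : realType} {d} {T : measurableType d} (P : probability T R)
  (G : set (set T)).
Hypothesis GE : @measurable _ T = <<s G >>.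
Hypothesis GT : G setT.
Hypothesis GC : forall A, G A -> G (~` A).
Hypothesis GU : forall A B, G A -> G B -> G (A `|` B).

Let mG A : G A -> measurable A.
Proof. by rewrite GE => GA; exact: sub_sigma_algebra. Qed.

Let gap (A B : set T) o : R := `|\1_A o - \1_B o|.

Let bmfun_gap A B : measurable A -> measurable B -> bmfun (gap A B).
Proof.
move=> mA mB; have [m [M hM]] := bmfunB (bmfun_indic (R := R) mA) (bmfun_indic mB).
by split; [exact: measurableT_comp|exists M => o; rewrite normr_id].
Qed.

Let close (A : set T) := forall e : R, 0 < e -> exists2 B, G B & expect P (gap A B) <= e.

Let closeG A : G A -> close A.
Proof.
move=> GA e e0; exists A => //; rewrite /gap.
by under eq_fun do rewrite subrr normr0; rewrite expect_cst ltW.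
Qed.

(** The sets that admit such approximations form a Dynkin system: for a disjoint
    union, all but finitely many members are dropped. *)
Lemma algebra_approx A : measurable A -> forall e : R, 0 < e ->
  exists2 B, G B & expect P (fun o => `|\1_A o - \1_B o|) <= e.
Proof.
have GI : setI_closed G.
  move=> B C GB GC'; rewrite -[B `&` C]setCK setCI.
  by apply: GC; apply: GU; exact: GC.
have G0 : G set0 by rewrite -setCT; exact: GC.
have GbigU (B : (set T)^nat) N : (forall n, G (B n)) -> G (\bigcup_(n < N) B n).
  move=> GB; elim: N => [|N IH]; first by rewrite bigcup_mkord big_ord0.
  by rewrite bigcup_mkord big_ord_recr/= -bigcup_mkord; exact: GU.
move=> mA; apply: (@dynkin_induction _ T G close GE GI) => //;
  last by rewrite -GE.
- exact: closeG.
- move=> B mB cB e e0; have [C GC' hC] := cB e e0; exists (~` C); first exact: GC.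
  rewrite (_ : gap (~` B) (~` C) = gap B C)//; apply/funext => o.
  rewrite /gap !indicE !in_setC.
  by case: (o \in B); case: (o \in C); rewrite //= ?subrr ?subr0 ?sub0r ?normrN.
move=> F mF _ cF e e0; have e2 : 0 < e / 2 by rewrite divr_gt0.
have [N hN] := measure_bigcup_tail P e2 mF.
have eN : 0 < e / 2 / N.+1%:R by rewrite divr_gt0.
have /choice[C hC] n : exists C, G C /\ expect P (gap (F n) C) <= e / 2 / N.+1%:R.
  by have [C GC' hC] := cF n _ eN; exists C.
have GCn n : G (C n) by have [] := hC n.
exists (\bigcup_(n < N) C n); first exact: GbigU.
pose U := \bigcup_n F n; pose V := U `\` \bigcup_(n < N) F n.
have mU : measurable U by exact: bigcup_measurable.
have mV : measurable V by apply: measurableD => //; exact: bigcup_measurable.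
have bV := bmfun_indic (R := R) mV.
have bgap n : bmfun (gap (F n) (C n)) by apply: bmfun_gap => //; exact: mG.
have bsum : bmfun (fun o => \sum_(n < N) gap (F n) (C n) o) by exact: bmfun_sum.
apply: (@le_trans _ _ (expect P (fun o => \1_V o + \sum_(n < N) gap (F n) (C n) o))).
  apply: le_expect.
  - by apply: bmfun_gap => //; apply: mG; exact: GbigU.
  - exact: bmfunD.
  move=> o.
  have gap0 n : 0 <= gap (F n) (C n) o by rewrite /gap.
  have S0 : 0 <= \sum_(n < N) gap (F n) (C n) o by apply: sumr_ge0.
  have big n : (n < N)%N -> gap (F n) (C n) o = 1 ->
      1 <= \sum_(n < N) gap (F n) (C n) o.
    move=> nN g1; rewrite (bigD1 (Ordinal nN))//= g1 lerDl.
    exact: sumr_ge0.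
  have gle A1 B1 : gap A1 B1 o <= 1.
    rewrite /gap !indicE; case: (o \in A1); case: (o \in B1);
    by rewrite /= ?subrr ?subr0 ?sub0r ?normrN ?normr0 ?normr1.
  have V0 : 0 <= \1_V o :> R by rewrite indicE.
  have gap10 (A1 B1 : set T) : A1 o -> ~ B1 o -> gap A1 B1 o = 1.
    by move=> hA hB; rewrite /gap !indicE (mem_set hA) (memNset hB) subr0 normr1.
  have gap00 (A1 B1 : set T) : ~ A1 o -> ~ B1 o -> gap A1 B1 o = 0.
    by move=> hA hB; rewrite /gap !indicE (memNset hA) (memNset hB) subrr normr0.
  have gap11 (A1 B1 : set T) : A1 o -> B1 o -> gap A1 B1 o = 0.
    by move=> hA hB; rewrite /gap !indicE (mem_set hA) (mem_set hB) subrr normr0.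
  have gap01 (A1 B1 : set T) : ~ A1 o -> B1 o -> gap A1 B1 o = 1.
    by rewrite /gap distrC => hA hB; exact: gap10.
  have [[n _ Fn]|nF] := pselect (U o); last first.
    have [[n nN Cn]|nC] := pselect ((\bigcup_(n < N) C n) o).
      apply: le_trans (gle _ _) _; apply: ler_wpDl => //.
      by apply: (big n nN); apply: gap01 => // Fn; apply: nF; exists n.
    by rewrite gap00//; exact: addr_ge0.
  have [Vo|nVo] := pselect (V o).
    apply: le_trans (gle _ _) _; apply: ler_wpDr => //.
    by rewrite indicE mem_set.
  have {n Fn} [n nN Fn] : (\bigcup_(n < N) F n) o.
    by apply: contrapT => nFN; apply: nVo; split => //; exists n.
  have [Cn|nCn] := pselect (C n o).
    by rewrite gap11; [exact: addr_ge0|exists n|exists n].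
  apply: le_trans (gle _ _) _; apply: ler_wpDl => //.
  by apply: (big n nN); exact: gap10.
rewrite expectD// expect_sum// expect_indic//.
have -> : e = e / 2 + e / 2 by rewrite -splitr.
apply: lerD.
  by rewrite -lee_fin fineK//; exact: fin_num_measure.
apply: (@le_trans _ _ (\sum_(n < N) e / 2 / N.+1%:R)).
  by apply: ler_sum => n _; have [] := hC n.
move: e2; move: (e / 2) => c c0; rewrite sumr_const card_ord -[leLHS]mulr_natr mulrAC.
by rewrite ler_pdivrMr ?ltr0n// ler_pM2l// ler_nat.
Qed.

End algebra_approximation.

Section probability_difference.
Context {R : realType} {d} {T : measurableType d} (nu mu : probability T R).

Let charge_diff := [the charge _ _ of cadd (charge_of_finite_measure nu)
  (copp (charge_of_finite_measure mu))].

Lemma hahn_probability : exists2 H, measurable H &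
  (forall A, measurable A -> A `<=` H -> (mu A <= nu A)%E) /\
  (forall A, measurable A -> A `<=` ~` H -> (nu A <= mu A)%E).
Proof.
have [H [N [[mH posH] [mN negN] HN _]]] := Hahn_decomposition charge_diff.
have fin (m : probability T R) A : measurable A -> m A \is a fin_num.
  exact: fin_num_measure.
exists H => //; split => A mA AH.
  by have := posH A mA AH; rewrite /charge_diff /= /cadd /copp /= sube_ge0// fin.
have AN : A `<=` N.
  by move=> x Ax; have : setT x by []; rewrite -HN => -[Hx|//]; have := AH x Ax.
by have := negN A mA AN; rewrite /charge_diff /= /cadd /copp /= sube_le0// fin.
Qed.

End probability_difference.

Section ergodic_extremality.
Context {R : realType} {d} {T : measurableType d}.
Variables nu mu : probability (int -> T) R.
Hypothesis nu_dom : forall A, measurable A -> mu A = 0%E -> nu A = 0%E.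
Hypothesis nu_inv : forall k A, measurable A -> nu (Defs.shift k @^-1` A) = nu A.
Hypothesis mu_inv : forall k A, measurable A -> mu (Defs.shift k @^-1` A) = mu A.
Hypothesis mu_ergodic : forall A, measurable A -> Defs.shift 1 @^-1` A = A ->
  mu A = 0%E \/ mu A = 1%E.

Let shiftD k l (x : int -> T) : Defs.shift k (Defs.shift l x) = Defs.shift (k + l) x.
Proof. by apply/funext => t; rewrite /Defs.shift addrA. Qed.

Let r A : R := fine (nu A) - fine (mu A).

Let r_split A B : measurable A -> measurable B -> r A = r (A `&` B) + r (A `\` B).
Proof.
move=> mA mB.
have fin (m : probability (int -> T) R) C : measurable C -> m C \is a fin_num.
  exact: fin_num_measure.
have split_m (m : probability (int -> T) R) :
    fine (m A) = fine (m (A `&` B)) + fine (m (A `\` B)).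
  have mAB := measurableI _ _ mA mB; have mADB := measurableD mA mB.
  by apply: EFin_inj; rewrite EFinD !fineK ?fin// [LHS](measureDI m mA mB) addeC.
by rewrite /r !split_m; ring.
Qed.

Let r_eq0 A : measurable A -> nu A = mu A -> r A = 0.
Proof. by move=> mA e; rewrite /r e subrr. Qed.

Let r_eqW A : measurable A -> r A = 0 -> nu A = mu A.
Proof.
by move=> mA /eqP; rewrite subr_eq0 => /eqP; exact: probability_eq_fine.
Qed.

(** An ergodic law is extremal among the stationary ones. A Hahn set H for nu - mu
    is invariant up to sets on which nu and mu coincide, so it can be replaced by
    the union U of its translates, which is invariant and hence trivial for mu;
    then nu - mu has a constant sign and, having total mass 0, it vanishes. *)
Lemma ergodic_unique A : measurable A -> nu A = mu A.
Proof.
have [H mH [posH negH]] := hahn_probability nu mu.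
have fin (m : probability (int -> T) R) C : measurable C -> m C \is a fin_num.
  exact: fin_num_measure.
have rpos C : measurable C -> C `<=` H -> 0 <= r C.
  by move=> mC CH; rewrite subr_ge0 fine_le ?fin//; exact: posH.
have rneg C : measurable C -> C `<=` ~` H -> r C <= 0.
  by move=> mC CH; rewrite subr_le0 fine_le ?fin//; exact: negH.
pose Hk (n : nat) : set (int -> T) := Defs.shift (enum_int n) @^-1` H.
have mHk n : measurable (Hk n).
  by apply: measurable_preimage => //; exact: measurable_shift.
have rHk n : r (Hk n) = r H by rewrite /r nu_inv// mu_inv.
have null n C : measurable C -> C `<=` Hk n `\` H -> r C = 0.
  move=> mC CH; have mD : measurable (Hk n `\` H) by exact: measurableD.
  have rD : 0 <= r (Hk n `\` H).
    have := r_split (mHk n) mH; have := r_split mH (mHk n).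
    rewrite rHk setIC => -> /eqP; rewrite (inj_eq (addrI _)) => /eqP <-.
    by apply: rpos; [exact: measurableD|exact: subDsetl].
  have sub B : B `<=` Hk n `\` H -> B `<=` ~` H by move=> BH x /BH[].
  have r1 : r C <= 0 by apply: rneg => //; exact: sub.
  have r2 : r (Hk n `\` H `\` C) <= 0.
    by apply: rneg; [exact: measurableD|apply: sub; exact: subDsetl].
  have := r_split mD mC; rewrite (setIidr CH); lra.
pose U := \bigcup_n Hk n.
have mU : measurable U by exact: bigcup_measurable.
have HU : H `<=` U.
  move=> x Hx; exists 0%N => //; rewrite /Hk /=.
  by rewrite (_ : Defs.shift _ x = x)//; apply/funext => t; rewrite /Defs.shift addr0.
have nullU C : measurable C -> C `<=` U `\` H -> r C = 0.
  move=> mC CU; apply: r_eq0 => //.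
  pose F n := C `&` (Hk n `\` H).
  have mF n : measurable (F n) by apply: measurableI => //; exact: measurableD.
  have CF : C = \bigcup_n F n.
    apply/seteqP; split => [x Cx|x [n _ []]//].
    by have [[n _ Hx] nHx] := CU x Cx; exists n => //; split.
  have mS n : measurable (seqDU F n).
    by apply: measurableD => //; exact: bigsetU_measurable.
  rewrite CF seqDU_bigcup_eq !measure_bigcup//.
  apply: eq_eseriesr => n _; apply: r_eqW => //; apply: (null n) => //.
  by move=> x [[_ ?] _].
have invU : Defs.shift 1 @^-1` U = U.
  apply/seteqP; split => [x [n _]|x [n _]]; rewrite /Hk /= => Hx.
    by exists (code_int (enum_int n + 1)) => //; rewrite /Hk /= code_intK -shiftD.
  exists (code_int (enum_int n - 1)) => //.
  by rewrite /Hk /= code_intK shiftD subrK.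
suff const_sign : (forall B, measurable B -> 0 <= r B) \/ (forall B, measurable B -> r B <= 0).
  move=> mA; apply: r_eqW => //.
  have rT : r setT = 0.
    by apply: r_eq0 => //; rewrite !probability_setT.
  have := r_split measurableT mA; rewrite setTI setTD rT.
  have mCA := measurableC mA.
  by case: const_sign => sgn; have := sgn A mA; have := sgn _ mCA; lra.
have zero (m : probability (int -> T) R) B C : measurable B -> measurable C ->
    B `<=` C -> m C = 0%E -> m B = 0%E.
  by move=> mB mC BC mC0; exact: (subset_measure0 mB mC BC mC0).
have [U0|U1] := mu_ergodic mU invU.
- right => B mB; rewrite (r_split mB mU).
  rewrite (_ : r (B `&` U) = 0); last first.
    have mBU := measurableI _ _ mB mU.
    have sub : B `&` U `<=` U by exact: subIsetr.
    apply: r_eq0 => //; rewrite (zero mu _ _ mBU mU sub U0).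
    exact: (zero nu _ _ mBU mU sub (nu_dom mU U0)).
  rewrite add0r; apply: rneg; first exact: measurableD.
  by move=> x [_ nUx] /HU.
- left => B mB; rewrite (r_split mB mU).
  have mCU := measurableC mU.
  have muCU : mu (~` U) = 0%E by rewrite probability_setC// U1 subee.
  rewrite (_ : r (B `\` U) = 0); last first.
    have mBU := measurableD mB mU.
    have sub : B `\` U `<=` ~` U by move=> x [].
    apply: r_eq0 => //; rewrite (zero mu _ _ mBU mCU sub muCU).
    exact: (zero nu _ _ mBU mCU sub (nu_dom mCU muCU)).
  have mBU := measurableI _ _ mB mU.
  rewrite addr0 (r_split mBU mH) (nullU (_ `\` H)); last 2 first.
  + exact: measurableD.
  + by move=> x [[_ Ux] nHx]; split.
  by rewrite addr0; apply: rpos; [exact: measurableI|exact: subIsetr].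
Qed.

End ergodic_extremality.

Section conditioning.
Context {R : realType} {d} {T : measurableType d} (P : probability T R)
  (A : set T) (mA : measurable A).

Definition conditioned : probability T R :=
  [the probability _ _ of mnormalize (mrestr P mA) P].

Hypothesis PA0 : P A != 0%E.

Lemma expect_conditioned (f : T -> R) : bmfun f ->
  expect conditioned f = (fine (P A))^-1 * expect P (fun o => \1_A o * f o).
Proof.
move=> bf; pose c := (fine (P A))^-1.
have finP B : measurable B -> P B \is a fin_num by exact: fin_num_measure.
have setwise B : measurable B ->
    expect conditioned (fun o => \1_B o * 1) = expect P (fun o => \1_B o * (c * \1_A o)).
  move=> mB; under eq_fun do rewrite mulr1; rewrite expect_indic//.
  have mBA := measurableI _ _ mB mA.
  have -> : (fun o => \1_B o * (c * \1_A o)) = (fun o => c * \1_(B `&` A) o).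
    by apply/funext => o; rewrite indicI mulrCA.
  rewrite expectZ; last exact: bmfun_indic.
  rewrite expect_indic// mulrC -[RHS]/(fine (P (B `&` A)) * c).
  have -> : conditioned B = (P (B `&` A) * c%:E)%E.
    have RT : mrestr P mA setT = P A by rewrite /mrestr setTI.
    rewrite -[LHS]/(mnormalize (mrestr P mA) P B) /mnormalize /= RT ifF//.
    apply/negbTE; rewrite negb_or PA0/=.
    by have := finP A mA; rewrite fin_numE => /andP[].
  by rewrite fineM ?finP.
have bA : bmfun (fun o => c * \1_A o : R) by apply: bmfunZ; exact: bmfun_indic.
have := @expect_eq_of_sets R _ _ conditioned _ _ P _ _ id id (fun=> 1)
  (fun o => c * \1_A o) (@measurable_id _ _ setT) (@measurable_id _ _ setT)
  (bmfun_cst 1) bA setwise f bf.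
have -> : (fun o => f o * 1) = f by apply/funext => o; rewrite mulr1.
move=> ->; have -> : (fun o => f o * (c * \1_A o)) = (fun o => c * (\1_A o * f o)).
  by apply/funext => o; ring.
by rewrite expectZ//; apply: bmfunM => //; exact: bmfun_indic.
Qed.

End conditioning.

Section driven_chain_ergodic.
Context {R : realType} {dE : measure_display} {E : finMeasurableType dE}
  {dT : measure_display} {T : measurableType dT}.
Variables (Q : int -> E -> (nat -> E) -> (int -> T) -> R) (b : nat -> R).
Hypothesis discreteE : forall A : set E, measurable A.
Hypothesis HQ : fading Q b.
Hypothesis Q_shift : forall k t w y x, Q t w y (Defs.shift k x) = Q (t + k) w y x.

Context {dO} {O : measurableType dO} (P : probability O R)
  (X : O -> int -> T) (Y : int -> O -> E).
Hypothesis mX : measurable_fun setT X.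
Hypothesis mY : forall t, measurable_fun setT (Y t).
Hypothesis solP : solves Q P X Y.
Hypothesis X_stationary : forall k, same_law P P X (Defs.shift k \o X).

Let Z o := (trajectory Y o, X o).
Let shiftZ (k : int) (z : (int -> E) * (int -> T)) := (Defs.shift k z.1, Defs.shift k z.2).

Let mZ : measurable_fun setT Z.
Proof. exact: measurable_joint. Qed.

Let mshiftZ k : measurable_fun setT (shiftZ k).
Proof.
apply: measurable_fun_pair.
  exact: measurableT_comp (measurable_shift k) measurable_fst.
exact: measurableT_comp (measurable_shift k) measurable_snd.
Qed.

Let solves_shift k :
  solves Q P (Defs.shift k \o X) (fun t o => Y (t + k) o).
Proof.
move=> t w A mA.
pose A' : set ((nat -> E) * (int -> T)) := (fun z => (z.1, Defs.shift k z.2)) @^-1` A.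
have mA' : measurable A'.
  apply: measurable_preimage => //; apply: measurable_fun_pair; first exact: measurable_fst.
  exact: measurableT_comp (measurable_shift k) measurable_snd.
have e o : past (trajectory (fun t o => Y (t + k) o) o) (t - 1) =
    past (trajectory Y o) (t + k - 1).
  by apply/funext => j; rewrite /past /trajectory; congr (Y _ o); ring.
have := solP (t + k) w mA'; under eq_fun do rewrite -e.
under [X in _ = expect _ X -> _]eq_fun do rewrite -e -Q_shift.
exact.
Qed.

(** The shifted process solves the same equation with the same covariate law. *)
Lemma chain_stationary k : same_law P P Z (shiftZ k \o Z).
Proof.
apply: (solution_unique discreteE HQ mX mY solP _ _ (solves_shift k)) => //.
exact: measurableT_comp (measurable_shift k) mX.
Qed.

Let expect_shift k (h : (int -> E) * (int -> T) -> R) : bmfun h ->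
  expect P (fun o => h (Z o)) = expect P (fun o => h (shiftZ k (Z o))).
Proof.
move=> bh; apply: (expect_same_law mZ _ (chain_stationary k) bh).
exact: measurableT_comp (mshiftZ k) mZ.
Qed.

Let shiftZD k l z : shiftZ k (shiftZ l z) = shiftZ (k + l) z.
Proof. by rewrite /shiftZ; congr (_, _); apply/funext => t; rewrite /Defs.shift addrA. Qed.

Let shiftZ0 z : shiftZ 0 z = z.
Proof.
by case: z => y x; rewrite /shiftZ; congr (_, _); apply/funext => t; rewrite /Defs.shift addr0.
Qed.

(* these events form an algebra, and a shift moves each of them arbitrarily far
   into the past *)
Let early (S : set ((int -> E) * (int -> T))) :=
  measurable S /\ exists M : int, forall x, depends_on [set i | i <= M] (fun y => S (y, x)).

Let early_generate : @measurable _ ((int -> E) * (int -> T))%type = <<s early >>.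
Proof.
apply/seteqP; split; last first.
  by apply: smallest_sub; [exact: sigma_algebra_measurable|move=> S []].
rewrite (rectangles_generate (findep_generate discreteE) findepT).
apply: smallest_sub; first exact: smallest_sigma_algebra.
move=> _ [A [C [fA mC ->]]]; apply: sub_sigma_algebra; split.
  by apply: measurableX => //; exact: findep_set_measurable.
have [s sA] := fA; exists (\sum_(i <- s) absz i)%N%:Z => x y y' yy'.
rewrite /setX /= (sA y y')// => i si; apply: yy' => /=.
apply: le_trans (ler_norm (i : int)) _; rewrite -abszE lez_nat.
by rewrite (big_rem i)//= leq_addr.
Qed.

Let earlyT : early setT.
Proof. by split => //; exists 0. Qed.

Let earlyC S : early S -> early (~` S).
Proof.
move=> [mS [M dM]]; split; first exact: measurableC.
by exists M => x y y' yy'; rewrite /setC /= (dM x y y').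
Qed.

Let earlyU S S' : early S -> early S' -> early (S `|` S').
Proof.
move=> [mS [M dM]] [mS' [M' dM']]; split; first exact: measurableU.
exists (Num.max M M') => x y y' yy'; rewrite /setU /=.
rewrite (dM x y y') 1?(dM' x y y')// => i /= iM; apply: yy' => /=;
by rewrite le_max iM ?orbT.
Qed.

Section invariant_event.
Variable B : set ((int -> E) * (int -> T)).
Hypothesis mB : measurable B.
Hypothesis invB : shiftZ 1 @^-1` B = B.

Let invBk k : shiftZ k @^-1` B = B.
Proof.
have pos (j : nat) : shiftZ j%:Z @^-1` B = B.
  elim: j => [|j IH].
    by apply/seteqP; split => z; rewrite /preimage /= shiftZ0.
  rewrite -{2}IH -{2}invB; apply/seteqP; split => z; rewrite /preimage /= shiftZD.
    by rewrite (_ : 1 + j%:Z = j.+1)//; lia.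
  by rewrite (_ : 1 + j%:Z = j.+1)//; lia.
case: k => j; first exact: pos.
have := pos j.+1 => posj; rewrite -{1}posj; apply/seteqP; split => z.
  by rewrite /preimage /= shiftZD NegzE subrr shiftZ0.
by rewrite /preimage /= shiftZD NegzE subrr shiftZ0.
Qed.

Let A := Z @^-1` B.

Let mA : measurable A.
Proof. exact: measurable_preimage. Qed.

(* By stationarity an invariant event is approximated by events that only look at
   letters of the arbitrarily remote past. *)
Let invariant_remote (t : int) (e : R) : 0 < e ->
  exists S : set ((int -> E) * (int -> T)), [/\ measurable S,
    forall x, depends_on [set i | i <= t] (fun y => S (y, x)) &
    expect P (fun o => `|\1_A o - \1_S (Z o)|) <= e].
Proof.
move=> e0; pose PZ := [the probability _ _ of distribution P (mfun_of mZ)].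
have expPZ (h : (int -> E) * (int -> T) -> R) : bmfun h ->
    expect PZ h = expect P (fun o => h (Z o)).
  move=> bh; apply: (@expect_same_law _ _ _ PZ _ _ P _ _ id Z) => //.
have [S [mS [M dM]] hS] := algebra_approx PZ early_generate earlyT earlyC
  earlyU mB e0.
pose j := absz (M - t)%R.
have bgap (S' : set ((int -> E) * (int -> T))) : measurable S' ->
    bmfun (fun z => `|\1_B z - \1_S' z| : R).
  move=> mS'; have [m [N hN]] := bmfunB (bmfun_indic (R := R) mB) (bmfun_indic mS').
  by split; [exact: measurableT_comp|exists N => o; rewrite normr_id].
exists (shiftZ (- j%:Z) @^-1` S); split.
- exact: measurable_preimage.
- move=> x y y' yy'; rewrite /preimage /shiftZ /=; apply: dM => i /= iM.
  by rewrite /Defs.shift; apply: yy' => /=; rewrite /j; lia.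
apply: le_trans hS; rewrite expPZ; last exact: bgap.
rewrite (expect_shift (- j%:Z) (bgap S mS)).
rewrite (_ : (fun o => _) = fun o => `|\1_B (shiftZ (- j%:Z) (Z o)) -
  \1_S (shiftZ (- j%:Z) (Z o))|)//; apply/funext => o.
congr (`|_ - _|); rewrite !indicE; congr (nat_of_bool _)%:R.
have h : B (shiftZ (- j%:Z) (Z o)) = A o.
  exact: (congr1 (fun S : set _ => S (Z o)) (invBk (- j%:Z))).
by apply/idP/idP => /set_mem hh; apply/mem_set; move: hh; rewrite h.
Qed.

Hypothesis PA0 : P A != 0%E.

Let cond_solves : solves Q (conditioned P mA) X Y.
Proof.
move=> t w C mC.
pose V o := (past (trajectory Y o) (t - 1), X o).
have mV : measurable_fun setT V by exact: measurable_past_pair.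
pose l o : R := (Y t o == w)%:R; pose q o := Q t w (past (trajectory Y o) (t - 1)) (X o).
have bl : bmfun l by exact: bmfun_letter.
have bq : bmfun q by exact: (bmfun_comp mV (bmfunQ HQ t w)).
have bC : bmfun (fun o => \1_C (V o) : R) by exact: (bmfun_comp mV (bmfun_indic mC)).
rewrite expect_conditioned//; last exact: bmfunM.
rewrite expect_conditioned//; last exact: bmfunM.
congr (_ * _); apply/eqP; rewrite -subr_eq0 -normr_le0.
have bA : bmfun (\1_A : O -> R) by exact: bmfun_indic.
rewrite -expectB; last 2 first.
- by apply: bmfunM => //; exact: bmfunM.
- by apply: bmfunM => //; exact: bmfunM.
apply/ler_addgt0Pr => /= e e0; rewrite add0r.
have [S [mS dS hS]] := invariant_remote (t - 1) e0.
(* an extension of the past to a path, with arbitrary letters from time t on *)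
pose ext (z : (nat -> E) * (int -> T)) : (int -> E) * (int -> T) :=
  ((fun i => z.1 (absz (t - 1 - i)%R)), z.2).
have mext : measurable_fun setT ext.
  apply: measurable_fun_pair; last exact: measurable_snd.
  by apply: measurable_fun_coordP => i; exact: measurableT_comp (measurable_coord _) measurable_fst.
have SE o : \1_S (Z o) = \1_(ext @^-1` S) (V o) :> R.
  rewrite !indicE; congr (nat_of_bool _)%:R.
  suff h : S (Z o) = S (ext (V o)).
    by apply/idP/idP => /set_mem hh; apply/mem_set; move: hh; rewrite /preimage /= h.
  by apply: dS => i /= it; rewrite /past; congr trajectory; lia.
have mCS : measurable (C `&` ext @^-1` S) by apply: measurableI => //; exact: measurable_preimage.
have bS : bmfun (fun o => \1_S (Z o) : R) by exact: (bmfun_comp mZ (bmfun_indic mS)).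
have := solP t w mCS => /eqP; rewrite -subr_eq0 -expectB; last 2 first.
- by apply: bmfunM => //; exact: (bmfun_comp mV (bmfun_indic mCS)).
- by apply: bmfunM => //; exact: (bmfun_comp mV (bmfun_indic mCS)).
rewrite (_ : (fun o => _) = fun o => \1_S (Z o) * (\1_C (V o) * l o) -
    \1_S (Z o) * (\1_C (V o) * q o)); last first.
  by apply/funext => o; rewrite SE indicI /l /q /V /=; ring.
move=> /eqP e1; rewrite -[X in `|X|]subr0 -e1.
have bprod (f g h : O -> R) : bmfun f -> bmfun g -> bmfun h -> bmfun (fun o => f o * (g o * h o)).
  by move=> ? ? ?; apply: bmfunM => //; exact: bmfunM.
apply: le_trans hS; apply: expect_dist_fun.
- by apply: bmfunB; exact: bprod.
- by apply: bmfunB; exact: bprod.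
- have [m [N hN]] := bmfunB bA bS.
  by split; [exact: measurableT_comp|exists N => o; rewrite normr_id].
move=> o; rewrite [X in `|X|](_ : _ = (\1_A o - \1_S (Z o)) * (\1_C (V o) * (l o - q o)));
  last by rewrite /l /q /V; ring.
rewrite normrM ler_piMr// normrM mulr_ile1//.
  by rewrite indicE normr_nat lern1 leq_b1.
have q0 : 0 <= q o by exact: fading_ge0 HQ _ _ _ _.
have q1 : q o <= 1 by exact: Q_le1 HQ _ _ _ _.
by rewrite /l ler_norml; case: (Y t o == w); apply/andP; split; rewrite /= ?mulr1n ?mulr0n; lra.
Qed.

Hypothesis X_ergodic : forall C, measurable C -> Defs.shift 1 @^-1` C = C ->
  P (X @^-1` C) = 0%E \/ P (X @^-1` C) = 1%E.

Let law (m : probability O R) := [the probability _ _ of distribution m (mfun_of mX)].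

Let conditionedE C : measurable C ->
  fine (conditioned P mA C) = (fine (P A))^-1 * fine (P (A `&` C)).
Proof.
move=> mC; rewrite -(expect_indic (conditioned P mA) mC).
rewrite -(expect_indic P (measurableI _ _ mA mC)).
rewrite expect_conditioned//; last exact: bmfun_indic.
by congr (_ * expect _ _); apply/funext => o; rewrite indicI.
Qed.

Let cond_lawX : same_law (conditioned P mA) P X X.
Proof.
move=> C mC.
have mXC D : measurable D -> measurable (X @^-1` D) by move=> mD; exact: measurable_preimage.
apply: (@ergodic_unique _ _ _ (law (conditioned P mA)) (law P)) => //.
- move=> D mD PD0; rewrite -(measure0 P).
  apply: probability_eq_fine => //.
  rewrite -[LHS]/(fine (conditioned P mA (X @^-1` D))) conditionedE; last exact: mXC.
  have -> : P (A `&` X @^-1` D) = 0%E.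
    have mAD := measurableI _ _ mA (mXC _ mD).
    exact: (subset_measure0 mAD (mXC _ mD) (@subIsetr _ _ _) PD0).
  by rewrite mulr0 measure0.
- move=> k D mD; have msD : measurable (Defs.shift k @^-1` D).
    by apply: measurable_preimage => //; exact: measurable_shift.
  apply: probability_eq_fine => //.
  rewrite -[LHS]/(fine (conditioned P mA (X @^-1` (Defs.shift k @^-1` D)))).
  rewrite -[RHS]/(fine (conditioned P mA (X @^-1` D))).
  rewrite !conditionedE; [|exact: mXC|exact: mXC]; congr (_ * fine _).
  have mBD : measurable (B `&` (snd @^-1` D)).
    by apply: measurableI => //; apply: measurable_preimage => //; exact: measurable_snd.
  have := chain_stationary k mBD; rewrite -[X in _ = X -> _]/(P _).
  move=> ->; congr (P _); rewrite /A -{1}(invBk k).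
  by apply/seteqP; split.
- by move=> k D mD; rewrite -[RHS]/(P _) (X_stationary k mD).
Qed.

Lemma invariant_event_full : P A = 1%E.
Proof.
have lawZ := solution_unique discreteE HQ mX mY cond_solves mX mY solP cond_lawX.
have finA := fin_num_measure P _ mA.
have nA0 : fine (P A) != 0 by rewrite fine_eq0.
rewrite -[LHS](lawZ B mB) -[LHS]fineK; last exact: fin_num_measure.
by rewrite (conditionedE mA) setIid mulVf.
Qed.

End invariant_event.

(** Ergodicity follows from uniqueness: conditionally on an invariant event, the
    pair still solves the equation, because the event is determined by the remote
    past, and the covariate keeps its law, because it is ergodic. *)
Lemma chain_ergodic B : measurable B -> shiftZ 1 @^-1` B = B ->
  (forall C, measurable C -> Defs.shift 1 @^-1` C = C ->
    P (X @^-1` C) = 0%E \/ P (X @^-1` C) = 1%E) ->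
  P (Z @^-1` B) = 0%E \/ P (Z @^-1` B) = 1%E.
Proof.
move=> mB invB X_ergodic.
by have [->|PB0] := eqVneq (P (Z @^-1` B)) 0%E; [left|right; exact: invariant_event_full].
Qed.

End driven_chain_ergodic.

(** * Conditional expectations and tests on indicators *)

Section conditional_expectation.
Context {R : realType} {dO} {O : measurableType dO} (P : probability O R)
  {dS} {S : measurableType dS} (V : O -> S).
Hypothesis mV : measurable_fun setT V.

Let indic_preimage B (f : O -> R) :
  (fun o => \1_(V @^-1` B) o * f o) = (fun o => \1_B (V o) * f o).
Proof. by apply/funext => o; rewrite !indicE; congr (_%:R * _). Qed.

Lemma is_cond_exp_version (f g : O -> R) (G : S -> R) : bmfun f -> bmfun G ->
  (forall B, measurable B ->
    expect P (fun o => \1_B (V o) * f o) = expect P (fun o => \1_B (V o) * G (V o))) ->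
  {ae P, forall o, g o = G (V o)} -> is_cond_exp P V f g.
Proof.
move=> bf bG fG gG; have bGV : bmfun (fun o => G (V o)) by exact: bmfun_comp.
exists (fun o => G (V o)); split => //.
- move=> _ C mC; rewrite setTI; exists (G @^-1` C); last by rewrite setTI.
  by rewrite -[X in measurable X]setTI; apply: bG.1.
- exact: bmfun_integrable.
- move=> _ [B mB <-]; rewrite setTI.
  have mVB : measurable (V @^-1` B) by rewrite -[X in measurable X]setTI; exact: mV.
  by rewrite !expect_setI// !indic_preimage fG.
Qed.

Lemma is_cond_exp_expect (f g G : O -> R) : bmfun f -> bmfun G ->
  is_cond_exp P V f g -> {ae P, forall o, g o = G o} ->
  forall B, measurable B ->
    expect P (fun o => \1_B (V o) * f o) = expect P (fun o => \1_B (V o) * G o).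
Proof.
move=> bf bG [g' [mg' ig' eg' gg']] gG B mB.
have mVB : measurable (V @^-1` B) by rewrite -[X in measurable X]setTI; exact: mV.
have VB : g_sigma_algebra_preimage V (V @^-1` B) by exists B => //; rewrite setTI.
have m' : measurable_fun setT (EFin \o g').
  by have /integrableP[] := ig'.
apply: EFin_inj; rewrite -!indic_preimage -!expect_setI// -(eg' _ VB).
apply: ae_eq_integral => //.
- exact: measurable_funTS.
- by apply/measurable_EFinP; apply: measurable_funTS; exact: bG.1.
- by apply: filterS2 gg' gG => o /= <- ->.
Qed.

End conditional_expectation.

Lemma same_law_ae {R : realType} {d1} {O1 : measurableType d1} (P1 : probability O1 R)
    {d2} {O2 : measurableType d2} (P2 : probability O2 R)
    {d} {S : measurableType d} (V1 : O1 -> S) (V2 : O2 -> S) (A : set S) :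
  measurable_fun setT V1 -> measurable_fun setT V2 -> same_law P1 P2 V1 V2 ->
  measurable A -> {ae P2, forall o, A (V2 o)} -> {ae P1, forall o, A (V1 o)}.
Proof.
move=> mV1 mV2 law mA A2; have mAC := measurableC mA.
apply: (negligibleP P1 (measurable_preimage mV1 mAC)).2.
by rewrite [LHS]law//; apply: (negligibleP P2 (measurable_preimage mV2 mAC)).1.
Qed.

Lemma same_law_fst {R : realType} {d1} {O1 : measurableType d1} (P1 : probability O1 R)
    {d2} {O2 : measurableType d2} (P2 : probability O2 R)
    {d} {S : measurableType d} (V : O1 -> S) :
  measurable_fun setT V -> same_law (P1 \x P2)%E P1 (V \o fst) V.
Proof.
move=> mV A mA; have -> : (V \o fst) @^-1` A = (V @^-1` A) `*` [set: O2].
  by apply/seteqP; split => z //= -[].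
transitivity (P1 (V @^-1` A) * P2 setT)%E.
  by apply: product_measure1E => //; exact: measurable_preimage.
by rewrite (@probability_setT _ _ _ P2) mule1.
Qed.

Section law_invariant_notions.
Context {R : realType} {d1} {O1 : measurableType d1} (P1 : probability O1 R)
  {d2} {O2 : measurableType d2} (P2 : probability O2 R)
  {d} {T : measurableType d} (X1 : int -> O1 -> T) (X2 : int -> O2 -> T).
Hypothesis lawX : same_law P1 P2 (trajectory X1) (trajectory X2).

Lemma stationary_same_law : stationary P2 X2 -> stationary P1 X1.
Proof.
move=> st k A mA; rewrite (lawX mA) (st k A mA).
by rewrite [RHS](lawX (measurable_preimage (measurable_shift k) mA)).
Qed.

Lemma ergodic_same_law : ergodic P2 X2 -> ergodic P1 X1.
Proof. by move=> er A mA invA; rewrite (lawX mA); exact: er. Qed.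

End law_invariant_notions.

(** * The model as a chain driven by the covariate *)

Section model.
Context {R : realType} {dE : measure_display} {E : finMeasurableType dE} {n : nat}.
Variables (D : set (int -> n.-tuple R)) (q : E -> (nat -> E) -> (nat -> n.-tuple R) -> R).

(** The paths all of whose shifts lie in D: a shift-invariant substitute for D,
    which need not be invariant. *)
Definition regular_paths : set (int -> n.-tuple R) := [set x | forall k, D (Defs.shift k x)].

(** Outside the regular paths q is replaced by the uniform law, which gives
    transition probabilities that are defined everywhere, commute with the shift and
    agree with q almost surely. *)
Definition kernel (t : int) (w : E) (y : nat -> E) (x : int -> n.-tuple R) : R :=
  if `[< regular_paths x >] then q w y (past x t) else #|E|%:R^-1.

Lemma regular_paths_shift k x : regular_paths (Defs.shift k x) <-> regular_paths x.
Proof.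
have sD i j (z : int -> n.-tuple R) : Defs.shift i (Defs.shift j z) = Defs.shift (i + j) z.
  by apply/funext => t; rewrite /Defs.shift addrA.
split => Dx i; last by rewrite sD.
by have := Dx (i - k); rewrite sD subrK.
Qed.

Lemma regular_paths_sub x : regular_paths x -> D x.
Proof.
move=> /(_ 0); congr D; apply/funext => t; by rewrite /Defs.shift addr0.
Qed.

Lemma kernel_shift k t w y x : kernel t w y (Defs.shift k x) = kernel (t + k) w y x.
Proof.
rewrite /kernel (propext (regular_paths_shift k x)); case: asboolP => // _.
by congr q; apply/funext => j; rewrite /past /Defs.shift; congr x; ring.
Qed.

Lemma kernel_past t t' w y x x' : t' <= t -> regular_paths x -> regular_paths x' ->
  past x t = past x' t -> kernel t' w y x = kernel t' w y x'.
Proof.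
move=> tt' Dx Dx' xx'; rewrite /kernel !asboolT//; congr q; apply/funext => j.
have := congr1 (fun z => z (absz (t - t')%R + j)%N) xx'; rewrite /past PoszD.
rewrite gez0_abs ?subr_ge0//.
by rewrite (_ : t - (t - t' + j%:Z) = t' - j%:Z)//; ring.
Qed.

Hypothesis mD : measurable D.

Lemma measurable_regular_paths : measurable regular_paths.
Proof.
rewrite (_ : regular_paths = \bigcap_k (Defs.shift (enum_int k) @^-1` D)).
  apply: bigcapT_measurable => k; rewrite -[X in measurable X]setTI.
  exact: measurable_shift.
apply/seteqP; split => x Dx k; first by move=> _; exact: Dx.
by have := Dx (code_int k) I; rewrite /= code_intK.
Qed.

(** D has full measure at every time by stationarity, and there are countably many
    times. *)
Lemma regular_paths_ae {dO} {O : measurableType dO} (P : probability O R)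
    (X : int -> {RV P >-> n.-tuple R}) :
  P (trajectory X @^-1` D) = 1%E -> stationary P X ->
  {ae P, forall o, regular_paths (trajectory X o)}.
Proof.
move=> PD stX.
have mX : measurable_fun setT (trajectory X).
  by apply: measurable_trajectory => t; exact: measurable_funPT.
have D_ae k : {ae P, forall o, D (Defs.shift (enum_int k) (trajectory X o))}.
  have mDk := measurable_preimage (measurable_shift (enum_int k)) mD.
  have mA := measurable_preimage mX mDk; apply: (negligibleP P (measurableC mA)).2.
  transitivity (1 - P ((Defs.shift (enum_int k) \o trajectory X) @^-1` D))%E.
    exact: probability_setC.
  by rewrite -(stX (enum_int k) _ mD) PD subee.
have := ae_foralln D_ae; apply: filterS => o Do k.
by have := Do (code_int k); rewrite code_intK.
Qed.

Hypothesis discreteE : forall A : set E, measurable A.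
Hypothesis D0 : D !=set0.
Hypothesis q_meas : forall t : int,
  measurable_fun [set z : E * (nat -> E) * (int -> n.-tuple R) | D z.2]
    (fun z => q z.1.1 z.1.2 (past z.2 t)).
Hypothesis q_range : forall (t : int) (w : E) (y : nat -> E) (x : int -> n.-tuple R),
  D x -> 0 < q w y (past x t) < 1.
Hypothesis q_sum : forall (t : int) (y : nat -> E) (x : int -> n.-tuple R),
  D x -> \sum_(w : E) q w y (past x t) = 1.
Hypothesis b0_lt1 : (b_coef q D 0 < 1)%E.
Hypothesis b_summable : (\sum_(0 <= m <oo) b_coef q D m < +oo)%E.

Let card_gt0 : 0 < #|E|%:R :> R.
Proof. by rewrite ltr0n; apply/card_gt0P; exists point. Qed.

Let b_ge m y y' x t : D x -> agree m y y' ->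
  ((dTV (fun w => q w y (past x t)) (fun w => q w y' (past x t)))%:E <= b_coef q D m)%E.
Proof. by move=> Dx yy'; apply: ereal_sup_ubound; exists y, y', x, t. Qed.

Let dTV0 (f : E -> R) : dTV f f = 0.
Proof. by rewrite /dTV big1 ?mulr0// => e _; rewrite subrr normr0. Qed.

Let b_ge0 m : (0 <= b_coef q D m)%E.
Proof.
have [x Dx] := D0.
by have := @b_ge m (fun=> point) (fun=> point) x 0 Dx; rewrite dTV0; apply.
Qed.

Let b_decr m : (b_coef q D m.+1 <= b_coef q D m)%E.
Proof.
apply: ub_ereal_sup => _ [y [y' [x [t [Dx yy' ->]]]]]; apply: b_ge => // i im.
by apply: yy'; exact: ltnW.
Qed.

Let b_le0 m : (b_coef q D m <= b_coef q D 0)%E.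
Proof. by elim: m => // m IH; exact: le_trans (b_decr m) IH. Qed.

Let b_fin m : b_coef q D m \is a fin_num.
Proof.
rewrite ge0_fin_numE//; apply: le_lt_trans (b_le0 m) _.
by apply: lt_trans b0_lt1 _; rewrite ltry.
Qed.

Lemma kernel_fading : fading kernel (fun m => fine (b_coef q D m)).
Proof.
split.
- move=> t w; apply: measurable_fun_if => //.
  + apply: (measurable_fun_bool true); rewrite setTI.
    rewrite (_ : _ @^-1` _ = snd @^-1` regular_paths).
      rewrite -[X in measurable X]setTI; apply: measurable_snd => //.
      exact: measurable_regular_paths.
    by apply/seteqP; split => z /=; [move/asboolP|move=> ?; apply/asboolP].
  + apply: (measurable_comp (F := [set z : E * (nat -> E) * (int -> n.-tuple R) | D z.2])
      (f := fun z => q z.1.1 z.1.2 (past z.2 t))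
      (g := fun z : (nat -> E) * (int -> n.-tuple R) => (w, z.1, z.2))).
    * rewrite -[X in measurable X]setTI; exact: measurable_snd.
    * by move=> _ [z [_ /= /asboolP Dz] <-] /=; exact: regular_paths_sub.
    * exact: q_meas.
    * apply: measurable_funTS; apply: measurable_fun_pair; last exact: measurable_snd.
      by apply: measurable_fun_pair; [exact: measurable_cst|exact: measurable_fst].
- move=> t w y x; rewrite /kernel; case: asboolP => Dx.
    by have /andP[/ltW] := q_range t w y (regular_paths_sub Dx).
  by rewrite invr_ge0 ltW.
- move=> t y x; rewrite /kernel; case: asboolP => Dx; first exact/q_sum/regular_paths_sub.
  by rewrite sumr_const -[LHS]mulr_natr mulVf// gt_eqF.
- move=> t m y y' x yy'; rewrite /kernel; case: asboolP => Dx; last first.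
    by rewrite dTV0 fine_ge0.
  by rewrite -lee_fin fineK//; apply: b_ge => //; exact: regular_paths_sub.
- by move=> m; rewrite fine_ge0.
- by move=> m; rewrite fine_le.
- by rewrite -lte_fin fineK.
- move=> e e0.
  have /fine_cvgP[[N1 _ fin_tail] /cvgrPdist_le /(_ e e0) [N2 _ small]] :=
    nneseries_tail_cvg b_summable (fun k _ => b_ge0 k).
  exists (maxn N1 N2) => k.
  have /= tail_fin := fin_tail _ (leq_maxl N1 N2).
  have /= := small _ (leq_maxr N1 N2); rewrite sub0r normrN => tail_le.
  rewrite -lee_fin -sumEFin; apply: (@le_trans _ _
      (\sum_(maxn N1 N2 <= j <oo) b_coef q D j)%E).
    apply: le_trans (nneseries_lim_ge (maxn N1 N2 + k) _); last by move=> j _ _; exact: b_ge0.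
    by apply: lee_sum => j _; rewrite fineK.
  by rewrite -(fineK tail_fin) lee_fin; exact: le_trans (ler_norm _) tail_le.
Qed.

Section equation.
Context {dO} {O : measurableType dO} (P : probability O R)
  (X : int -> {RV P >-> n.-tuple R}) (Y : int -> {RV P >-> E}).
Hypothesis regX : {ae P, forall o, regular_paths (trajectory X o)}.

Let mX : measurable_fun setT (trajectory X).
Proof. by apply: measurable_trajectory => t; exact: measurable_funPT. Qed.

Let mY t : measurable_fun setT (Y t).
Proof. exact: measurable_funPT. Qed.

Let letterE t w : (fun o => \1_(Y t @^-1` [set w]) o) = (fun o => (Y t o == w)%:R : R).
Proof.
by apply/funext => o; rewrite indicE; congr (nat_of_bool _)%:R; apply/idP/eqP; rewrite inE.
Qed.

Let kernelE t w : {ae P, forall o,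
  q w (past (trajectory Y o) (t - 1)) (past (trajectory X o) t) =
  kernel t w (past (trajectory Y o) (t - 1)) (trajectory X o)}.
Proof. by apply: filterS regX => o Xo; rewrite /kernel asboolT. Qed.

Let bmfun_event t w : bmfun (fun o => \1_(Y t @^-1` [set w]) o : R).
Proof. by rewrite letterE; exact: (bmfun_letter discreteE mY). Qed.

Let mV t : measurable_fun setT (fun o => (past (trajectory Y o) (t - 1), trajectory X o)).
Proof. exact: measurable_past_pair. Qed.

(** Conditional expectations are tested on the events generated by the conditioning
    pair, and kernel agrees with q almost surely. *)
Lemma cond_law_eq_solves : cond_law_eq q P X Y -> solves kernel P (trajectory X) Y.
Proof.
move=> eqY t w B mB.
have bG := bmfun_comp (mV t) (bmfunQ kernel_fading t w).
have := is_cond_exp_expect (mV t) (bmfun_event t w) bG (eqY t w) (kernelE t w) mB.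
by rewrite -(congr1 (fun f => expect P (fun o => _ * f o)) (letterE t w)).
Qed.

Lemma solves_cond_law_eq : solves kernel P (trajectory X) Y -> cond_law_eq q P X Y.
Proof.
move=> solY t w.
apply: (is_cond_exp_version (mV t) (bmfun_event t w) (bmfunQ kernel_fading t w)
  _ (kernelE t w)) => B mB.
by rewrite (congr1 (fun f => expect P (fun o => _ * f o)) (letterE t w)); exact: solY.
Qed.
End equation.

Lemma solution_exists {dO} {O : measurableType dO} (P : probability O R)
    (X : int -> {RV P >-> n.-tuple R}) :
  {ae P, forall o, regular_paths (trajectory X o)} ->
  exists (P1 : probability (O * R)%type R)
         (X1 : int -> {RV P1 >-> n.-tuple R}) (Y1 : int -> {RV P1 >-> E}),
    same_law P1 P (trajectory X1) (trajectory X) /\ cond_law_eq q P1 X1 Y1.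
Proof.
move=> regX.
have mX : measurable_fun setT (trajectory X).
  by apply: measurable_trajectory => t; exact: measurable_funPT.
pose P1 : probability (O * R)%type R := [the probability _ _ of (P \x unif)%E].
have mX1 t : measurable_fun setT (fun z : O * R => X t z.1).
  by apply: measurableT_comp measurable_fst; exact: measurable_funPT.
have mY1 t : measurable_fun setT (fun z : O * R => chain kernel (trajectory X z.1) z.2 t).
  exact: measurableT_comp (measurable_coord t)
    (measurable_chain_pair discreteE kernel_fading mX).
pose X1 t : {RV P1 >-> n.-tuple R} := mfun_of (mX1 t).
pose Y1 t : {RV P1 >-> E} := mfun_of (mY1 t).
have law1 : same_law P1 P (trajectory X1) (trajectory X).
  exact: (@same_law_fst _ _ _ P _ _ unif _ _ (trajectory X) mX).
exists P1, X1, Y1; split => //; apply: solves_cond_law_eq.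
  apply: (same_law_ae _ mX law1 measurable_regular_paths regX).
  by apply: measurable_trajectory => t; exact: mX1.
exact: (chain_solves discreteE kernel_fading P mX).
Qed.

Section consequences.
Context {dO} {O : measurableType dO} (P : probability O R)
  (X : int -> {RV P >-> n.-tuple R}) (Y : int -> {RV P >-> E}).
Hypothesis regX : {ae P, forall o, regular_paths (trajectory X o)}.
Hypothesis eqY : cond_law_eq q P X Y.

Let mX : measurable_fun setT (trajectory X).
Proof. by apply: measurable_trajectory => t; exact: measurable_funPT. Qed.

Let mY t : measurable_fun setT (Y t).
Proof. exact: measurable_funPT. Qed.

Let solY : solves kernel P (trajectory X) Y.
Proof. exact: cond_law_eq_solves. Qed.

(* the conditional expectation of h given the covariate path *)
Let G (h : (nat -> E) -> R) (t : int) (x : int -> n.-tuple R) : R :=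
  expect unif (fun u : R => h (past (chain kernel x u) t)).

Let bmfunG h t : bmfun h -> bmfun (G h t).
Proof.
move=> bh; apply: (bmfun_expect
  [the probability _ _ of \d_(point : int -> n.-tuple R)] unif
  (f := fun z : (int -> n.-tuple R) * R => h (past (chain kernel z.1 z.2) t))).
apply: (bmfun_comp _ bh).
exact: measurableT_comp (measurable_past t) (measurable_chain discreteE kernel_fading).
Qed.

(* By uniqueness of the joint law, Y may be replaced by the chain driven by a
   uniform variable independent of the covariate, and that variable is integrated
   out first. *)
Let expectG h t B : bmfun h -> measurable B ->
  expect P (fun o => \1_B (trajectory X o) * h (past (trajectory Y o) t)) =
  expect P (fun o => \1_B (trajectory X o) * G h t (trajectory X o)).
Proof.
move=> bh mB.
have mY' t' := measurableT_comp (measurable_coord t')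
    (measurable_chain_pair discreteE kernel_fading mX).
have mX' := measurableT_comp mX (@measurable_fst _ _ O R).
have lawX : same_law P (P \x unif)%E (trajectory X) (trajectory X \o fst).
  by move=> A mA; rewrite (same_law_fst P unif mX mA).
pose H (z : (int -> E) * (int -> n.-tuple R)) := \1_B z.2 * h (past z.1 t).
have bH : bmfun H.
  apply: bmfunM; first exact: (bmfun_comp measurable_snd (bmfun_indic mB)).
  by apply: (bmfun_comp _ bh); exact: measurableT_comp (measurable_past t) measurable_fst.
have law := solution_unique discreteE kernel_fading mX mY solY mX' mY'
  (chain_solves discreteE kernel_fading P mX) lawX.
have := expect_same_law (measurable_joint mX mY) (measurable_joint mX' mY') law bH.
rewrite /H/= => ->.
rewrite expect_prod; last exact: (bmfun_comp (measurable_joint mX' mY') bH).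
congr expect; apply/funext => o; have mt := measurableT_comp (measurable_past t)
  (measurable_chain_seed discreteE kernel_fading (trajectory X o)).
by rewrite /= expectZ//; exact: (bmfun_comp mt bh).
Qed.

(** The conditional expectation given the covariate path is G h t. On the regular
    paths G h t only depends on the past at t, by chain_past_law, so it has a version
    that is a function of that past, and this version serves both conditionings. *)
Lemma cond_exp_past h t : bmfun h ->
  same_cond_exp P (trajectory X) (fun o => past (trajectory X o) t)
    (fun o => h (past (trajectory Y o) t)).
Proof.
move=> bh; have bG := bmfunG t bh.
have [g mg Gg] : exists2 g : (nat -> n.-tuple R) -> R, measurable_fun setT g &
    {ae P, forall o, G h t (trajectory X o) = g (past (trajectory X o) t)}.
  apply: (factor_through_past mX measurable_regular_paths regX bG.1) => x x' Dx Dx' xx'.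
  apply: (chain_past_law discreteE kernel_fading bh) => t' w y tt'.
  exact: (kernel_past _ _ tt' Dx Dx' xx').
have [_ [M GM]] := bG.
(* g is only known to be bounded almost surely *)
pose g' z := Num.max (- M) (Num.min M (g z)).
have bg' : bmfun g'.
  split.
    by apply: measurable_maxr; [exact: measurable_cst|apply: measurable_minr].
  have M0 : 0 <= M := le_trans (normr_ge0 _) (GM point).
  by exists M => z; rewrite ler_norml /g' le_max lexx ge_max ge_min lexx ge0_cp.
have Gg' : {ae P, forall o, G h t (trajectory X o) = g' (past (trajectory X o) t)}.
  apply: filterS Gg => o Go; rewrite /g' -Go; have := GM (trajectory X o).
  by rewrite ler_norml => /andP[M1 M2]; rewrite (min_idPr M2) (max_idPr M1).
have mXt : measurable_fun setT (fun o => past (trajectory X o) t).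
  exact: measurableT_comp (measurable_past t) mX.
have bhY : bmfun (fun o => h (past (trajectory Y o) t)).
  apply: (bmfun_comp _ bh).
  exact: measurableT_comp (measurable_past t) (measurable_trajectory mY).
have bg'X : bmfun (fun x : int -> n.-tuple R => g' (past x t)).
  exact: (bmfun_comp (measurable_past t) bg').
have key B : measurable B ->
    expect P (fun o => \1_B (trajectory X o) * h (past (trajectory Y o) t)) =
    expect P (fun o => \1_B (trajectory X o) * g' (past (trajectory X o) t)).
  move=> mB; rewrite expectG//; have b1 := bmfun_comp mX (bmfun_indic (R := R) mB).
  apply: eq_expect_ae.
  - exact: (bmfunM b1 (bmfun_comp mX bG)).
  - exact: (bmfunM b1 (bmfun_comp mX bg'X)).
  - by apply: filterS Gg' => o ->.
exists (fun o => g' (past (trajectory X o) t)); split.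
- exact: (is_cond_exp_version mX bhY bg'X key (aeW _ _)).
- apply: (is_cond_exp_version mXt bhY bg' _ (aeW _ _)) => // B mB.
  exact: (key _ (measurable_preimage (measurable_past t) mB)).
Qed.

Hypothesis X_stationary : stationary P X.

Let zip (z : (int -> E) * (int -> n.-tuple R)) : int -> E * n.-tuple R :=
  fun t => (z.1 t, z.2 t).

Let measurable_zip : measurable_fun setT zip.
Proof.
apply: measurable_fun_coordP => t; apply: measurable_fun_pair.
- exact: measurableT_comp (measurable_coord t) measurable_fst.
- exact: measurableT_comp (measurable_coord t) measurable_snd.
Qed.

Lemma pair_stationary : stationary P (fun t o => (Y t o, X t o)).
Proof.
move=> k A mA.
exact: (chain_stationary discreteE kernel_fading kernel_shift mX mY solY X_stationary
  k (measurable_preimage measurable_zip mA)).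
Qed.

Lemma pair_ergodic : ergodic P X -> ergodic P (fun t o => (Y t o, X t o)).
Proof.
move=> X_ergodic A mA invA.
apply: (chain_ergodic discreteE kernel_fading kernel_shift mX mY solY X_stationary
  (measurable_preimage measurable_zip mA)) => //.
by rewrite -[in RHS]invA.
Qed.

End consequences.

End model.

Theorem theorem1 (R : realType) (n : nat)
  (dE : measure_display) (E : finMeasurableType dE)
  (discreteE : forall A : set E, measurable A)
  (dO : measure_display) (O : measurableType dO) (P : probability O R)
  (X : int -> {RV P >-> n.-tuple R})
  (D : set (int -> n.-tuple R)) (mD : measurable D)
  (PXD : P (trajectory X @^-1` D) = 1%E)
  (q : E -> (nat -> E) -> (nat -> n.-tuple R) -> R)
  (q_meas : forall t : int,
    measurable_fun [set z : E * (nat -> E) * (int -> n.-tuple R) | D z.2]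
      (fun z => q z.1.1 z.1.2 (past z.2 t)))
  (q_range : forall (t : int) (w : E) (y : nat -> E) (x : int -> n.-tuple R),
    D x -> 0 < q w y (past x t) < 1)
  (q_sum : forall (t : int) (y : nat -> E) (x : int -> n.-tuple R),
    D x -> \sum_(w : E) q w y (past x t) = 1)
  (S1_stationary : stationary P X)
  (S1_ergodic : ergodic P X)
  (S2_b0 : (b_coef q D 0 < 1)%E)
  (S2_sum : (\sum_(0 <= m <oo) b_coef q D m < +oo)%E) :
  [/\ (exists (d1 : measure_display) (O1 : measurableType d1)
              (P1 : probability O1 R)
              (X1 : int -> {RV P1 >-> n.-tuple R}) (Y1 : int -> {RV P1 >-> E}),
         same_law P1 P (trajectory X1) (trajectory X) /\
         cond_law_eq q P1 X1 Y1),
      (forall (d1 : measure_display) (O1 : measurableType d1)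
              (P1 : probability O1 R)
              (X1 : int -> {RV P1 >-> n.-tuple R}) (Y1 : int -> {RV P1 >-> E})
              (d2 : measure_display) (O2 : measurableType d2)
              (P2 : probability O2 R)
              (X2 : int -> {RV P2 >-> n.-tuple R}) (Y2 : int -> {RV P2 >-> E}),
         same_law P1 P (trajectory X1) (trajectory X) -> cond_law_eq q P1 X1 Y1 ->
         same_law P2 P (trajectory X2) (trajectory X) -> cond_law_eq q P2 X2 Y2 ->
         same_law P1 P2 (fun o => (trajectory Y1 o, trajectory X1 o))
                        (fun o => (trajectory Y2 o, trajectory X2 o)))
    & (forall (d1 : measure_display) (O1 : measurableType d1)
              (P1 : probability O1 R)
              (X1 : int -> {RV P1 >-> n.-tuple R}) (Y1 : int -> {RV P1 >-> E}),
         same_law P1 P (trajectory X1) (trajectory X) -> cond_law_eq q P1 X1 Y1 ->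
         [/\ (forall (h : (nat -> E) -> R) (t : int),
                measurable_fun setT h -> (exists M : R, forall y, `|h y| <= M) ->
                same_cond_exp P1 (trajectory X1)
                  (fun o => past (trajectory X1 o) t)
                  (fun o => h (past (trajectory Y1 o) t))),
             stationary P1 (fun t o => (Y1 t o, X1 t o))
           & ergodic P1 (fun t o => (Y1 t o, X1 t o))])].
Proof.
have D0 : D !=set0.
  apply/set0P/eqP => D_empty; move: PXD; rewrite D_empty preimage_set0 measure0.
  by move/eqP; rewrite eq_sym onee_eq0.
have HX : measurable_fun setT (trajectory X).
  by apply: measurable_trajectory => t; exact: measurable_funPT.
have regX := regular_paths_ae mD PXD S1_stationary.
have reg d1 (O1 : measurableType d1) (P1 : probability O1 R)
    (X1 : int -> {RV P1 >-> n.-tuple R}) :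
    same_law P1 P (trajectory X1) (trajectory X) ->
    {ae P1, forall o, regular_paths D (trajectory X1 o)}.
  move=> law1; apply: (same_law_ae _ HX law1 (measurable_regular_paths mD) regX).
  by apply: measurable_trajectory => t; exact: measurable_funPT.
split.
- have [P1 [X1 [Y1 H]]] := solution_exists mD discreteE D0 q_meas q_range q_sum S2_b0 S2_sum regX.
  by exists _, _, P1, X1, Y1.
- move=> d1 O1 P1 X1 Y1 d2 O2 P2 X2 Y2 law1 eq1 law2 eq2.
  have fK := kernel_fading mD D0 q_meas q_range q_sum S2_b0 S2_sum.
  apply: (solution_unique discreteE fK).
  + by apply: measurable_trajectory => t; exact: measurable_funPT.
  + by move=> t; exact: measurable_funPT.
  + by apply: cond_law_eq_solves => //; exact: reg.
  + by apply: measurable_trajectory => t; exact: measurable_funPT.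
  + by move=> t; exact: measurable_funPT.
  + by apply: cond_law_eq_solves => //; exact: reg.
  + by move=> A mA; rewrite law1// law2.
- move=> d1 O1 P1 X1 Y1 law1 eq1; have reg1 := reg _ _ _ _ law1.
  have st1 := stationary_same_law law1 S1_stationary.
  have er1 := ergodic_same_law law1 S1_ergodic.
  split.
  + by move=> h t mh bh; apply: (cond_exp_past mD discreteE D0 q_meas q_range q_sum S2_b0 S2_sum reg1 eq1).
  + exact: (pair_stationary mD discreteE D0 q_meas q_range q_sum S2_b0 S2_sum reg1 eq1 st1).
  + exact: (pair_ergodic mD discreteE D0 q_meas q_range q_sum S2_b0 S2_sum reg1 eq1 st1 er1).
Qed.
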